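(* Let $0<\alpha<1$. a) There exists an absolute constant $c_\alpha$, depending only on $\alpha$, such that for every martingale $F\in H_{1/(1+\alpha)}(G)$ $$\left\Vert \widetilde{\sigma}^{\alpha,\ast}F\right\Vert_{1/(1+\alpha)}\leq c_\alpha\left\Vert F\right\Vert_{H_{1/(1+\alpha)}},\qquad\text{where}\quad \widetilde{\sigma}^{\alpha,\ast}F:=\sup_{n\geq 2}\frac{|\sigma_n^\alpha F|}{\log^{1+\alpha}n}.$$ b) Let $\varphi:\mathbb{N}_+\to[1,\infty)$ be a non-decreasing function satisfying $$\limsup_{n\to\infty}\frac{\log^{1+\alpha}n}{\varphi(n)}=+\infty.$$ Then there exists a martingale $F\in H_{1/(1+\alpha)}(G)$ such that $$\sup_{n\in\mathbb{N}_+}\left\Vert\frac{\sigma_n^\alpha F}{\varphi(n)}\right\Vert_{1/(1+\alpha)}=\infty.$$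
   Context: Notation: $\mathbb{N}_+$ is the set of positive integers, $\mathbb{N}=\mathbb{N}_+\cup\{0\}$, and $\log^{1+\alpha}n=(\log n)^{1+\alpha}$. The group. $Z_2=\{0,1\}$ is the discrete cyclic group of order 2 with Haar measure giving each singleton measure $1/2$. $G$ is the complete direct product of countably many copies of $Z_2$ (indexed by $\mathbb{N}$), with product topology and normalized (product) Haar measure $\mu$; its elements are sequences $x=(x_0,x_1,\dots)$ with $x_k\in\{0,1\}$. For $x\in G$ put $I_0(x):=G$, $I_n(x):=\{y\in G: y_0=x_0,\dots,y_{n-1}=x_{n-1}\}$. For $0<p<\infty$, $\|f\|_p:=\left(\int_G|f|^p\,d\mu\right)^{1/p}$. Walsh system. Every $n\in\mathbb{N}$ is written uniquely as $n=\sum_{j=0}^\infty n_j2^j$ with $n_j\in\{0,1\}$. Rademacher functions: $r_k(x):=(-1)^{x_k}$. Walsh(-Paley) functions: $w_n(x):=\prod_{k=0}^\infty r_k^{n_k}(x)$. Dyadic martingales and Hardy spaces. Let $\mathcal{F}_n$ be the $\sigma$-algebra generated by $\{I_n(x):x\in G\}$ and $E_n$ the conditional expectation operator relative to $\mathcal{F}_n$. A (dyadic) martingale is a sequence $F=(F_n,n\in\mathbb{N})$ of functions $F_n\in L_1(G)$ such that $F_n$ is $\mathcal{F}_n$-measurable for all $n$ and $E_nF_m=F_n$ for all $n\leq m$. Its maximal function is $F^\ast:=\sup_{n\in\mathbb{N}}|F_n|$. For $0<p<\infty$, $H_p(G)$ consists of all martingales $F$ with $\|F\|_{H_p}:=\|F^\ast\|_p<\infty$.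 Fourier coefficients and partial sums. For a martingale $F$, $\widehat{F}(k):=\lim_{n\to\infty}\int_G F_n w_k\,d\mu$ (the limit always exists), and $S_nF:=\sum_{k=0}^{n-1}\widehat{F}(k)w_k$ for $n\in\mathbb{N}_+$, $S_0F:=0$. Cesàro means. For $\beta\neq-1,-2,\dots$ put $A_0^\beta:=1$ and $A_n^\beta:=\frac{(\beta+1)\cdots(\beta+n)}{n!}$ for $n\in\mathbb{N}_+$. The Cesàro $(C,\alpha)$ means are $$\sigma_n^\alpha F:=\frac{1}{A_n^\alpha}\sum_{k=1}^nA_{n-k}^{\alpha-1}S_kF\qquad(n\in\mathbb{N}_+).$$ *)

(* Defs.v *)
From HB Require Import structures.
From mathcomp Require Import all_boot all_order all_algebra.
From mathcomp Require Import ring lra.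
From mathcomp Require Import all_classical all_reals all_analysis.
From mathcomp Require Import measurable_realfun.

Set Implicit Arguments.
Unset Strict Implicit.
Unset Printing Implicit Defensive.

Import Order.TTheory GRing.Theory Num.Theory.
Import numFieldNormedType.Exports.

Local Open Scope classical_set_scope.
Local Open Scope ring_scope.

(* The group G = Z_2^N: [cantor_space] is bool^nat with the product topology,
   equipped here with its Borel sigma-algebra; Z_2 is bool with [addb]. *)
Definition dyadic_group := g_sigma_algebraType (@open cantor_space).

HB.instance Definition _ := Measurable.on dyadic_group.

Definition dyadic_add (x y : dyadic_group) : dyadic_group :=
  fun k => x k (+) y k.

Definition dyadic_itv (n : nat) (x : dyadic_group) : set dyadic_group :=
  [set y | forall k, (k < n)%N -> y k = x k].

Lemma dyadic_itv_sub m n (x : dyadic_group) :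
  (m <= n)%N -> dyadic_itv n x `<=` dyadic_itv m x.
Proof. by move=> mn y xy k km; apply: xy; exact: leq_trans mn. Qed.

Lemma dyadic_itv_eq n (x y : dyadic_group) :
  dyadic_itv n x y -> dyadic_itv n y = dyadic_itv n x.
Proof.
move=> xy; apply/seteqP; split => z zz k kn.
  by rewrite (zz _ kn) xy.
by rewrite (zz _ kn) xy.
Qed.

Lemma dyadic_itv_open n (x : dyadic_group) :
  open (dyadic_itv n x : set cantor_space).
Proof.
have -> : dyadic_itv n x =
    \bigcap_(k in `I_n) ((fun y : cantor_space => y k) @^-1` [set x k]).
  by apply/seteqP; split => y xy k /=; exact: xy.
rewrite bigcap_mkord; elim/big_ind : _ => //.
- exact: openT.
- by move=> A B; exact: openI.
- move=> k _; apply: open_comp.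
    by move=> y _; exact: (@proj_continuous nat (fun=> bool)).
  exact: discrete_open.
Qed.

Lemma measurable_dyadic_itv n (x : dyadic_group) : measurable (dyadic_itv n x).
Proof. by apply: sub_sigma_algebra; exact: dyadic_itv_open. Qed.

Lemma dyadic_itv_nbhs (U : set cantor_space) (x : dyadic_group) :
  open U -> U x -> exists n, dyadic_itv n x `<=` U.
Proof.
move=> oU Ux; apply: contrapT => /forallNP nU.
have /choice[y yP] : forall n, exists y, dyadic_itv n x y /\ ~ U y.
  move=> n; apply: contrapT => /forallNP H; apply: (nU n) => y xy.
  by apply: contrapT => Uy; apply: (H y).
have cvy : (y : nat -> cantor_space) @ \oo --> (x : cantor_space).
  apply/cvg_sup => i A [B [[C oC <-]]] /= Cx CA.
  apply: filterS CA _; exists i.+1 => //= n /= ni.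
  by rewrite /preimage/= (yP n).1.
have : nbhs (x : cantor_space) U by exact: open_nbhs_nbhs.
by move=> /cvy[n _ /(_ n (leqnn n))] /(yP n).2.
Qed.

Definition bits_itv (s : seq bool) : set dyadic_group :=
  dyadic_itv (size s) (nth false s).

Lemma bits_itvE n (x : dyadic_group) : bits_itv (mkseq x n) = dyadic_itv n x.
Proof.
rewrite /bits_itv size_mkseq; apply/seteqP.
by split => y xy k kn; move: (xy _ kn); rewrite nth_mkseq.
Qed.

Lemma open_bits (U : set cantor_space) : open U ->
  U = \bigcup_(s in [set s | bits_itv s `<=` U]) bits_itv s.
Proof.
move=> oU; apply/seteqP; split => [x Ux|x [s sU sx]]; last exact: sU.
have [n xU] := dyadic_itv_nbhs oU Ux.
by exists (mkseq x n); rewrite /= bits_itvE.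
Qed.

Lemma measurable_dyadicE : @measurable _ dyadic_group =
  <<s [set A | A = set0 \/ exists n x, A = dyadic_itv n x] >>.
Proof.
apply/seteqP; split; apply: smallest_sub.
- exact: smallest_sigma_algebra.
- move=> U oU; rewrite (open_bits oU).
  rewrite bigcup_mkcond.
  apply: (@countable_bigcupT_measurable _ (g_sigma_algebraType
    [set A : set dyadic_group | A = set0 \/ exists n x, A = dyadic_itv n x])).
    exact: countableP.
  move=> s; case: ifP => _; last exact: measurable0.
  by apply: sub_sigma_algebra; right; exists (size s), (nth false s).
- exact: sigma_algebra_measurable.
- move=> A [->|[n [x ->]]]; first exact: measurable0.
  exact: measurable_dyadic_itv.
Qed.

(* Existence of the normalized Haar measure, as the image of Lebesgue measure
   on [0, 1] under the binary digits. *)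
Definition doubling {R : realType} (t : R) : R := 2 * t - ((2^-1 <= t)%R : bool)%:R.

Definition binary_digits {R : realType} (t : R) : dyadic_group :=
  fun k => 2^-1 <= iter k doubling t.


Lemma measurable_doubling {R : realType} :
  measurable_fun setT (doubling : R -> R).
Proof.
rewrite /doubling; apply: measurable_funB.
  exact: measurable_funM.
have -> : (fun t : R => ((2^-1 <= t)%R : bool)%:R) =
    (fun t : R => if 2^-1 <= t then 1 else 0 : R).
  by apply/funext => t; case: ifP.
by apply: measurable_fun_ifT => //; exact: measurable_fun_ler.
Qed.

Lemma measurable_binary_digits {R : realType} :
  measurable_fun setT (binary_digits : R -> dyadic_group).
Proof.
apply: (measurability _ measurable_dyadicE) => _ [_ [->|[n [x ->]]] <-].
  by rewrite preimage_set0 setI0.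
have -> : setT `&` (@binary_digits R) @^-1` dyadic_itv n x =
    \bigcap_(k in `I_n) ((fun t : R => 2^-1 <= iter k doubling t) @^-1` [set x k]).
  by rewrite setTI; apply/seteqP; split => t tx k /=; exact: tx.
rewrite bigcap_mkord; apply: bigsetI_measurable => k _.
rewrite -[X in measurable X]setTI.
suff : measurable_fun setT (fun t : R => 2^-1 <= iter k doubling t) by apply.
apply: measurable_fun_ler => //.
elim: (nat_of_ord k) => [|m IH]; first exact: measurable_id.
exact: (measurableT_comp measurable_doubling IH).
Qed.

(* The left endpoint of the interval of reals in [0, 1[ whose first [n] binary
   digits are those of [x]. *)
Fixpoint digit_sum {R : realType} (n : nat) (x : dyadic_group) : R :=
  if n is m.+1 then ((x 0%N)%:R + digit_sum m (x \o S)) / 2 else 0.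

Lemma digit_sum_bounds {R : realType} n x :
  0 <= digit_sum n x :> R /\ digit_sum n x + (2^-1) ^+ n <= 1 :> R.
Proof.
elim: n x => [|n IH] x /=; first by rewrite expr0; split; lra.
have [] := IH (x \o S); rewrite exprS; set e : R := _ ^+ n.
by case: (x 0%N) => /= h1 h2; split; lra.
Qed.

Lemma binary_digits_itv {R : realType} n x (t : R) :
  (0 <= t < 1 /\ dyadic_itv n x (binary_digits t)) <->
  digit_sum n x <= t < digit_sum n x + (2^-1) ^+ n.
Proof.
elim: n x t => [|n IH] x t /=.
  by rewrite expr0 add0r; split => [[]//|->]; split.
have H : (0 <= t < 1 /\ dyadic_itv n.+1 x (binary_digits t)) <->
   ((2^-1 <= t)%R = x 0%N :> bool /\
     (0 <= doubling t < 1 /\ dyadic_itv n (x \o S) (binary_digits (doubling t)))).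
  split.
    move=> [t01 H]; split; first exact: (H 0%N).
    split; last first.
      by move=> k kn; have := H k.+1 kn; rewrite /binary_digits iterSr.
    by rewrite /doubling; case: (lerP 2^-1 t) => /= h; lra.
  move=> [h0 [t01 H]]; split.
    by move: t01; rewrite /doubling; case: (lerP 2^-1 t) => /= h; lra.
  by case=> [|k] kn //; rewrite /binary_digits iterSr; exact: H.
apply: (iff_trans H); rewrite IH exprS {H}; have [] := @digit_sum_bounds R n (x \o S).
rewrite /doubling; set a := digit_sum _ _; set e : R := _ ^+ n.
case: (x 0%N); case: (lerP 2^-1 t) => /= h a0 a1; split.
all: try (by case=> // _; lra).
all: try (by move=> ?; lra).
all: by move=> ?; split => //; lra.
Qed.

Definition unit_lebesgue (R : realType) : set (measurableTypeR R) -> \bar R :=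
  @mrestr _ (measurableTypeR R) R `[0%R, 1%R[ (@lebesgue_measure R)
    (measurable_itv `[0%R, 1%R[).

HB.instance Definition _ (R : realType) := Measure.on (@unit_lebesgue R).

Lemma unit_lebesgueT (R : realType) : @unit_lebesgue R setT = 1%E.
Proof.
by rewrite /unit_lebesgue /mrestr setTI lebesgue_measure_itv/= lte01 sube0.
Qed.

HB.instance Definition _ (R : realType) :=
  Measure_isProbability.Build _ _ _ (@unit_lebesgue R) (@unit_lebesgueT R).

Definition haar_digits (R : realType) : measurableTypeR R -> dyadic_group :=
  @binary_digits R.

HB.instance Definition _ (R : realType) :=
  @isMeasurableFun.Build _ _ (measurableTypeR R) dyadic_group
    (@haar_digits R) measurable_binary_digits.

Lemma haar_exists (R : realType) : exists mu : probability dyadic_group R,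
  forall n x, mu (dyadic_itv n x) = ((2^-1) ^+ n)%:E.
Proof.
exists (distribution (@unit_lebesgue R) (@haar_digits R)) => n x.
rewrite /= /distribution /pushforward /unit_lebesgue /mrestr.
have -> : (@binary_digits R) @^-1` dyadic_itv n x `&` `[0%R, 1%R[ =
    `[digit_sum n x, digit_sum n x + (2^-1) ^+ n[%classic :> set R.
  apply/seteqP; split => t /=; rewrite !in_itv/=.
    by move=> [H t01]; apply/binary_digits_itv.
  by move/binary_digits_itv => [].
rewrite lebesgue_measure_itv/= lte_fin ltrDl exprn_gt0 ?invr_gt0//.
by rewrite -EFinB addrAC subrr add0r.
Qed.

(* The normalized Haar measure: the product of the uniform measures on Z_2. *)
Definition haar (R : realType) : probability dyadic_group R :=
  projT1 (cid (haar_exists R)).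

Lemma haar_dyadic_itv (R : realType) n x :
  haar R (dyadic_itv n x) = ((2^-1) ^+ n)%:E.
Proof. exact: projT2 (cid (haar_exists R)) n x. Qed.

Lemma dyadic_itv_setI_closed :
  setI_closed [set A | A = set0 \/ exists n x, A = dyadic_itv n x].
Proof.
move=> A B [->|[m [x ->]]]; first by rewrite set0I; left.
move=> [->|[n [y ->]]]; first by rewrite setI0; left.
have [->|/set0P[z [xz yz]]] := eqVneq (dyadic_itv m x `&` dyadic_itv n y) set0.
  by left.
right; rewrite -(dyadic_itv_eq xz) -(dyadic_itv_eq yz); exists (maxn m n), z.
apply/seteqP; split => [w [zw zw'] k|w zw].
  by rewrite leq_max => /orP[/zw|/zw'].
by split; apply: dyadic_itv_sub zw; rewrite ?leq_maxl ?leq_maxr.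
Qed.

Lemma haar_unique (R : realType) (mu : {measure set dyadic_group -> \bar R}) :
  (forall n x, mu (dyadic_itv n x) = ((2^-1) ^+ n)%:E) ->
  forall A, measurable A -> mu A = haar R A.
Proof.
move=> muE; apply: (measure_unique
  [set A | A = set0 \/ exists n x, A = dyadic_itv n x]
  (fun=> dyadic_itv 0 point) measurable_dyadicE dyadic_itv_setI_closed).
- by move=> _; right; exists 0%N, point.
- by apply/seteqP; split => // x _; exists 0%N.
- move=> A [->|[n [x ->]]]; first by rewrite !measure0.
  by rewrite muE; exact/esym/haar_dyadic_itv.
- by move=> _; rewrite muE ltry.
Qed.

Lemma dyadic_addK (a : dyadic_group) : involutive (dyadic_add a).
Proof. by move=> x; apply/funext => k; rewrite /dyadic_add addKb. Qed.

Lemma preimage_dyadic_itv n (a x : dyadic_group) :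
  dyadic_add a @^-1` dyadic_itv n x = dyadic_itv n (dyadic_add a x).
Proof.
apply/seteqP; split => y xy k kn; move: (xy _ kn); rewrite /dyadic_add /=.
  by move=> <-; rewrite addKb.
by move=> ->; rewrite addKb.
Qed.

Lemma measurable_dyadic_add (a : dyadic_group) :
  measurable_fun setT (dyadic_add a).
Proof.
apply: (measurability _ measurable_dyadicE) => _ [_ [->|[n [x ->]]] <-].
  by rewrite preimage_set0 setI0.
by rewrite setTI preimage_dyadic_itv; exact: measurable_dyadic_itv.
Qed.

HB.instance Definition _ (a : dyadic_group) :=
  isMeasurableFun.Build _ _ _ _ (dyadic_add a) (measurable_dyadic_add a).

Lemma haar_translation (R : realType) (a : dyadic_group)
    (A : set dyadic_group) :
  measurable A -> haar R (dyadic_add a @^-1` A) = haar R A.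
Proof.
move=> mA.
apply: (haar_unique (mu := distribution (haar R) (dyadic_add a))) mA => n x.
rewrite /= /distribution /pushforward preimage_dyadic_itv.
exact: haar_dyadic_itv.
Qed.

Definition rademacher {R : realType} (k : nat) (x : dyadic_group) : R :=
  (-1) ^+ (x k).

(* Binary digits of [n] of rank [k >= n] vanish, so the product can stop
   before [n]. *)
Definition walsh {R : realType} (n : nat) (x : dyadic_group) : R :=
  \prod_(k < n) rademacher k x ^+ odd (n %/ 2 ^ k).

(* [g] is a version of the conditional expectation of [f] relative to the
   sigma-algebra generated by [B]. *)
Definition is_cond_exp {R : realType} (B : set (set dyadic_group))
    (f g : dyadic_group -> R) :=
  [/\ measurable_fun setT (g : g_sigma_algebraType B -> R),
      (haar R).-integrable setT (EFin \o g) &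
      forall A, <<s B >> A ->
        (\int[haar R]_(x in A) (g x)%:E = \int[haar R]_(x in A) (f x)%:E)%E].

Definition dyadic_martingale {R : realType} (F : nat -> dyadic_group -> R) :=
  [/\ forall n, (haar R).-integrable setT (EFin \o F n),
      forall n, measurable_fun setT
        (F n : g_sigma_algebraType (range (dyadic_itv n)) -> R) &
      forall n m, (n <= m)%N ->
        is_cond_exp (range (dyadic_itv n)) (F m) (F n)].

Definition maximal_function {R : realType} (F : nat -> dyadic_group -> R)
    (x : dyadic_group) : \bar R :=
  ereal_sup [set `|F n x|%:E | n in [set: nat]].

Definition hardy_norm {R : realType} (p : R) (F : nat -> dyadic_group -> R) :
  \bar R := ('N[haar R]_p%:E[maximal_function F])%E.

Definition in_hardy {R : realType} (p : R) (F : nat -> dyadic_group -> R) :=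
  dyadic_martingale F /\ (hardy_norm p F < +oo)%E.

Definition fourier_coef {R : realType} (F : nat -> dyadic_group -> R)
    (k : nat) : R :=
  limn (fun n => \int[haar R]_x (F n x * walsh k x)).

Definition walsh_sum {R : realType} (n : nat) (F : nat -> dyadic_group -> R)
    (x : dyadic_group) : R :=
  \sum_(k < n) fourier_coef F k * walsh k x.

Definition cesaro_number {R : realType} (b : R) (n : nat) : R :=
  (\prod_(1 <= j < n.+1) (b + j%:R)) / n`!%:R.

Definition cesaro_mean {R : realType} (a : R) (n : nat)
    (F : nat -> dyadic_group -> R) (x : dyadic_group) : R :=
  (cesaro_number a n)^-1 *
  \sum_(1 <= k < n.+1) cesaro_number (a - 1) (n - k) * walsh_sum k F x.

Definition weighted_maximal {R : realType} (a : R)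
    (F : nat -> dyadic_group -> R) (x : dyadic_group) : \bar R :=
  ereal_sup [set (`|cesaro_mean a n F x| / ln n%:R `^ (1 + a))%:E
            | n in [set n | (2 <= n)%N]].

(* Main.v *)
(** Write p = 1 / (1 + alpha), q = 2^alpha, D_k for the Dirichlet kernels and P_n
for A_n^alpha times the kernel of sigma_n^alpha.  Abel summation along the binary
digits of n gives |P_n| <= C sum_j (q / 2)^j Phi_j over the j with 2^j <= n, where
Phi_j >= 0 is 2^j times the Fejer kernel of order 2^j.

(a) No atomic decomposition is needed: for 2^M < n <= 2^(M+1), sigma_n^alpha F
only sees F_(M+1), and |F_(M+1)| <= 2 (s_0 + ... + s_M) where s_m is the value at
time m of a predictable majorant of |F| when this majorant more than doubles
there, and 0 otherwise; the nonzero s_m grow geometrically along each path, so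
that sum_m s_m^p <= C (F* )^p.  Since s_m depends on m bits only, the
convolution of s_m with |P_n| / A_n^alpha is at most C times that with
H_m = q^(-m) sum_(j <= m) (q / 2)^j Phi_j + D_(2^m), and
int H_m^p <= C (m + 1) 2^(m (p - 1)).  The factor m + 1 is absorbed by
log^(1 + alpha) n, and p-subadditivity concludes.

(b) For n = 1 + 2^H + ... + 2^(r H) with H large and fixed, |P_n| is at least
c (2 q)^(k H) on half of the points whose first nonzero bits are at the ranks k H
and k H + 1, for all k < r; as (2 q)^p = 2 this gives int |P_n|^p >= c' r.  For
f_m = r_m D_(2^m), |sigma_(2^m + n)^alpha f_m| = |P_n| / A_(2^m + n)^alpha, and F is
a sum of multiples of the f_m along a sparse sequence of m, chosen greedily. *)

Require Import Defs.
From mathcomp Require Import all_boot all_order all_algebra.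
From mathcomp Require Import zify ring lra.
From mathcomp Require Import all_classical all_reals all_analysis measurable_realfun.

Set Implicit Arguments.
Unset Strict Implicit.
Unset Printing Implicit Defensive.

Import Order.TTheory GRing.Theory Num.Theory.
Import numFieldNormedType.Exports.

Local Open Scope classical_set_scope.
Local Open Scope ring_scope.

(* MathComp-Analysis exports another constant of this name. *)
Local Notation dyadic_itv := Defs.dyadic_itv.

(** * Averages of functions of finitely many bits *)

(** Both halves turn on (2 q)^p = 2, that is q^p = 2^(1 - p). It keeps the integral of ((q / 2)^j
    Phi_j)^p bounded in j with no decay to spare, so that the m + 1 ranks up to m add up to the
    factor m + 1. Read from below on disjoint shells, the same balance makes all ranks contribute
    alike to int |P_n|^p, whence the sharpness. The obstacle in (a) is p < 1: a convolution is not
    controlled by the p-th powers of its factors. For functions of m bits it is, at the price 2^(m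
    (1 - p)), and the decay 2^(m (p - 1)) of int H_m^p pays exactly that price. Hence the pieces s_m
    must depend on m bits only, although F_(m+1) depends on one more. In (b) the limsup gives growth
    along some indices only, and the terms already chosen perturb the new one; the greedy choice
    waits for an index that is good enough for both. Each estimate involves finitely many bits, so
    integrals are replaced by the finite averages [mean]; measure theory enters only to sum the
    estimates over all levels. *)

Definition level {T : Type} (m : nat) (f : dyadic_group -> T) :=
  forall x y, (forall k, (k < m)%N -> x k = y k) -> f x = f y.

Definition set_bit (m : nat) (b : bool) (x : dyadic_group) : dyadic_group :=
  fun k => if k == m then b else x k.

(* The integral of [f], when [f] only depends on the first [m] bits. *)
Fixpoint mean {R : realType} (m : nat) (f : dyadic_group -> R) : R :=
  if m is m'.+1 then
    (mean m' (f \o set_bit m' false) + mean m' (f \o set_bit m' true)) / 2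
  else f (fun=> false).

Lemma levelW {T : Type} m n (f : dyadic_group -> T) :
  (m <= n)%N -> level m f -> level n f.
Proof. by move=> mn mf x y xy; apply: mf => k km; apply: xy; exact: leq_trans mn. Qed.

Lemma level_comp {T U : Type} m (h : T -> U) (f : dyadic_group -> T) :
  level m f -> level m (fun x => h (f x)).
Proof. by move=> mf x y /mf ->. Qed.

Lemma level_comp2 {T U V : Type} m (h : T -> U -> V)
    (f : dyadic_group -> T) (g : dyadic_group -> U) :
  level m f -> level m g -> level m (fun x => h (f x) (g x)).
Proof. by move=> mf mg x y xy; rewrite (mf _ _ xy) (mg _ _ xy). Qed.

Lemma level_sum {R : realType} m (I : Type) (r : seq I) (P : pred I)
    (f : I -> dyadic_group -> R) :
  (forall i, P i -> level m (f i)) ->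
  level m (fun x => \sum_(i <- r | P i) f i x).
Proof. by move=> mf x y xy; apply: eq_bigr => i /mf; apply. Qed.

Lemma level_set_bit {T : Type} m n b (f : dyadic_group -> T) :
  level m f -> (m <= n)%N -> f \o set_bit n b = f.
Proof.
move=> mf mn; apply/funext => x; apply: mf => k km.
by rewrite /set_bit; case: eqP => // kn; move: km; rewrite kn ltnNge mn.
Qed.

Lemma level_comp_set_bit {T : Type} m b (f : dyadic_group -> T) :
  level m.+1 f -> level m (f \o set_bit m b).
Proof.
move=> mf x y xy; apply: mf => k; rewrite /set_bit ltnS leq_eqVlt.
by case: eqP => //= _ /xy.
Qed.

Lemma set_bit_id m x : set_bit m (x m) x = x.
Proof. by apply/funext => k; rewrite /set_bit; case: eqP => [->|]. Qed.

Lemma level_dyadic_add {T : Type} m x (f : dyadic_group -> T) :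
  level m f -> level m (fun t => f (dyadic_add x t)).
Proof. by move=> mf y z yz; apply: mf => k km; rewrite /dyadic_add yz. Qed.

Lemma dyadic_addC x y : dyadic_add x y = dyadic_add y x.
Proof. by apply/funext => k; rewrite /dyadic_add addbC. Qed.

Section mean_theory.
Context {R : realType}.
Implicit Types f g : dyadic_group -> R.

Lemma eq_mean m f g : f =1 g -> mean m f = mean m g.
Proof. by move=> /funext ->. Qed.

Lemma meanD m f g : mean m (fun x => f x + g x) = mean m f + mean m g.
Proof.
elim: m f g => [//|m IH] f g /=.
have H b : mean m ((fun x => f x + g x) \o set_bit m b) =
  mean m (f \o set_bit m b) + mean m (g \o set_bit m b) by rewrite -IH.
by rewrite !H; field.
Qed.

Lemma meanZ m c f : mean m (fun x => c * f x) = c * mean m f.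
Proof.
elim: m f => [//|m IH] f /=.
have H b : mean m ((fun x => c * f x) \o set_bit m b) =
  c * mean m (f \o set_bit m b) by rewrite -IH.
by rewrite !H; field.
Qed.

Lemma mean_cst m c : mean m (fun=> c : R) = c.
Proof.
elim: m => [//|m IH] /=.
by have -> b : (fun=> c) \o set_bit m b = (fun=> c) by []; rewrite IH; field.
Qed.

Lemma mean_sum m (I : Type) (r : seq I) (P : pred I) (f : I -> dyadic_group -> R) :
  mean m (fun x => \sum_(i <- r | P i) f i x) = \sum_(i <- r | P i) mean m (f i).
Proof.
elim: r => [|i r IH].
  by under eq_mean do rewrite big_nil; rewrite mean_cst big_nil.
rewrite big_cons -IH; under eq_mean do rewrite big_cons.
by case: (P i) => //; rewrite meanD.
Qed.

Lemma le_mean m f g : (forall x, f x <= g x) -> mean m f <= mean m g.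
Proof.
elim: m f g => [//|m IH] f g fg /=; first exact: fg.
by rewrite ler_pM2r ?invr_gt0// lerD// IH// => x; exact: fg.
Qed.

Lemma mean_ge0 m f : (forall x, 0 <= f x) -> 0 <= mean m f.
Proof. by move=> f0; rewrite -(mean_cst m 0) le_mean. Qed.

Lemma ler_norm_mean m f : `|mean m f| <= mean m (fun x => `|f x|).
Proof.
rewrite ler_norml -mulN1r -meanZ; apply/andP; split.
  by apply: le_mean => x; rewrite mulN1r lerNl -normrN ler_norm.
by apply: le_mean => x; rewrite ler_norm.
Qed.

(** The bit of rank [m] is independent of [f]. The recursions on [1 + rademacher m x] below are
    averaged through this splitting. *)
Lemma mean_split m (h : bool -> R -> R) f : level m f ->
  mean m.+1 (fun x => h (x m) (f x)) =
  (mean m (fun x => h false (f x)) + mean m (fun x => h true (f x))) / 2.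
Proof.
move=> mf /=; congr (_ / 2); congr (_ + _); apply: eq_mean => x /=;
  by rewrite {1}/set_bit eqxx -[f (set_bit _ _ _)]/((f \o _) x) (level_set_bit _ mf).
Qed.

Lemma mean_level m n f : level m f -> (m <= n)%N -> mean n f = mean m f.
Proof.
move=> mf; elim: n => [|n IH]; first by rewrite leqn0 => /eqP ->.
rewrite leq_eqVlt ltnS => /predU1P[->//|mn] /=.
by rewrite !(level_set_bit _ mf)// IH//; field.
Qed.

Lemma mean_dyadic_add m x f : level m f ->
  mean m (fun t => f (dyadic_add x t)) = mean m f.
Proof.
elim: m x f => [|m IH] x f mf /=; first exact: mf.
have H b : mean m ((fun t => f (dyadic_add x t)) \o set_bit m b) =
    mean m (f \o set_bit m (x m (+) b)).
  rewrite -(IH x _ (level_comp_set_bit _ mf)); apply: eq_mean => t /=.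
  congr f; apply/funext => k; rewrite /set_bit /dyadic_add.
  by case: eqP => [->|].
by rewrite !H; case: (x m) => //=; rewrite addrC.
Qed.

Lemma exchange_mean m n (f : dyadic_group -> dyadic_group -> R) :
  mean m (fun x => mean n (f x)) = mean n (fun t => mean m (fun x => f x t)).
Proof.
elim: m f => [//|m IH] f /=.
have H b : mean m ((fun x => mean n (f x)) \o set_bit m b) =
    mean n (fun t => mean m ((fun x => f x t) \o set_bit m b)).
  by rewrite -IH.
rewrite !H -meanD mulrC -meanZ.
by apply: eq_mean => t; rewrite mulrC.
Qed.

End mean_theory.

(** * Walsh functions, Dirichlet and Fejer kernels *)

Section walsh_theory.
Context {R : realType}.
Implicit Types x y : dyadic_group.
Local Notation rademacher := (@rademacher R).
Local Notation walsh := (@walsh R).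

Lemma rademacher_sqr k x : rademacher k x * rademacher k x = 1.
Proof. by rewrite /rademacher -expr2 -exprM mulnC exprM sqrrN !expr1n. Qed.

Lemma norm_rademacher k x : `|rademacher k x| = 1.
Proof. by rewrite /rademacher normrX normrN1 expr1n. Qed.

Lemma rademacher_dyadic_add k x y :
  rademacher k (dyadic_add x y) = rademacher k x * rademacher k y.
Proof. by rewrite /rademacher /dyadic_add signr_addb. Qed.

Lemma level_rademacher k m : (k < m)%N -> level m (rademacher k).
Proof. by move=> km x y xy; rewrite /rademacher xy. Qed.

(** The definition stops its product at [n] by convention; any length that reaches the last nonzero
    digit gives the same value. *)
Lemma walshE A n x : (n < 2 ^ A)%N ->
  walsh n x = \prod_(k < A) rademacher k x ^+ odd (n %/ 2 ^ k).
Proof.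
move=> nA; pose f k := rademacher k x ^+ odd (n %/ 2 ^ k).
have f1 k : (minn n A <= k)%N -> f k = 1.
  move=> nAk; rewrite /f divn_small//; move: nAk; rewrite geq_min => /orP[nk|Ak].
    exact: leq_ltn_trans nk (ltn_expl _ _).
  by apply: leq_trans nA _; rewrite leq_exp2l.
have H N : (minn n A <= N)%N -> \prod_(k < N) f k = \prod_(k < minn n A) f k.
  move=> mN; rewrite -!(big_mkord xpredT f) (big_cat_nat (leq0n _) mN)//=.
  rewrite [X in _ * X](_ : _ = 1) ?mulr1//.
  by rewrite big_nat big1// => k /andP[/f1].
by rewrite /walsh (H n) ?geq_minl// -(H A) ?geq_minr.
Qed.

Lemma walsh_0 x : walsh 0 x = 1.
Proof. by rewrite /walsh big_ord0. Qed.

Lemma level_walsh A n : (n < 2 ^ A)%N -> level A (walsh n).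
Proof.
move=> nA x y xy; rewrite !(walshE _ nA); apply: eq_bigr => k _.
by rewrite (@level_rademacher k A _ x y).
Qed.

Lemma walsh_addl A i x : (i < 2 ^ A)%N ->
  walsh (2 ^ A + i) x = rademacher A x * walsh i x.
Proof.
move=> iA; rewrite (walshE (A := A.+1)); last by rewrite expnS; lia.
rewrite (walshE x iA) big_ord_recr/= mulrC divnDl ?dvdnn// divnn expn_gt0/=.
rewrite (divn_small iA); congr (_ * _); apply: eq_bigr => k _; congr (_ ^+ nat_of_bool _).
  rewrite divnDl; last by rewrite dvdn_exp2l// ltnW.
by rewrite -expnB ?(ltnW (ltn_ord k))// oddD oddX/= orbF subn_eq0 leqNgt ltn_ord.
Qed.

Lemma norm_walsh n x : `|walsh n x| = 1.
Proof.
by rewrite /walsh normr_prod big1// => k _; rewrite normrX norm_rademacher expr1n.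
Qed.

Lemma walsh_dyadic_add n x y :
  walsh n (dyadic_add x y) = walsh n x * walsh n y.
Proof.
rewrite /walsh -big_split/=; apply: eq_bigr => k _.
by rewrite rademacher_dyadic_add exprMn.
Qed.

(** Below rank [A], the digits of [2 ^ A - 1 - i] are the complements of those of [i], and Walsh
    functions are multiplicative for digitwise addition. *)
Lemma walsh_rev A i x : (i < 2 ^ A)%N ->
  walsh (2 ^ A - 1 - i) x = walsh (2 ^ A - 1) x * walsh i x.
Proof.
elim: A i => [|A IH] i.
  by rewrite expn0 ltnS leqn0 => /eqP ->; rewrite !walsh_0 mulr1.
have A0 : (0 < 2 ^ A)%N by rewrite expn_gt0.
have -> : (2 ^ A.+1 - 1 = 2 ^ A + (2 ^ A - 1))%N by rewrite expnS; lia.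
rewrite walsh_addl; last by lia.
have [iA _|Ai iA] := ltnP i (2 ^ A).
  have -> : (2 ^ A + (2 ^ A - 1) - i = 2 ^ A + (2 ^ A - 1 - i))%N by lia.
  by rewrite walsh_addl ?IH ?mulrA//; lia.
rewrite expnS in iA.
have -> : (2 ^ A + (2 ^ A - 1) - i = 2 ^ A - 1 - (i - 2 ^ A))%N by lia.
rewrite -{2}(subnKC Ai) walsh_addl ?IH; [|lia|lia].
rewrite mulrACA [_ * rademacher _ _]mulrC.
by rewrite -[LHS]mul1r -(rademacher_sqr A x); ring.
Qed.

End walsh_theory.

Definition dirichlet {R : realType} (n : nat) (x : dyadic_group) : R :=
  \sum_(k < n) walsh k x.

(* [n] times the Fejer kernel. *)
Definition fejer {R : realType} (n : nat) (x : dyadic_group) : R :=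
  \sum_(i < n.+1) dirichlet i x.

Section dirichlet_theory.
Context {R : realType}.
Implicit Types x y : dyadic_group.
Local Notation rademacher := (@rademacher R).
Local Notation walsh := (@walsh R).
Local Notation dirichlet := (@dirichlet R).
Local Notation fejer := (@fejer R).

Lemma dirichlet0 x : dirichlet 0 x = 0.
Proof. by rewrite /dirichlet big_ord0. Qed.

Lemma dirichletS n x : dirichlet n.+1 x = dirichlet n x + walsh n x.
Proof. by rewrite /dirichlet big_ord_recr. Qed.

Lemma fejer0 x : fejer 0 x = 0.
Proof. by rewrite /fejer big_ord1 dirichlet0. Qed.

Lemma fejerS n x : fejer n.+1 x = fejer n x + dirichlet n.+1 x.
Proof. by rewrite /fejer big_ord_recr. Qed.

Lemma level_dirichlet A n : (n <= 2 ^ A)%N -> level A (dirichlet n).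
Proof.
move=> nA; apply: level_sum => i _; apply: level_walsh.
exact: leq_trans nA.
Qed.

Lemma level_fejer A n : (n <= 2 ^ A)%N -> level A (fejer n).
Proof.
move=> nA; apply: level_sum => i _; apply: level_dirichlet.
by apply: leq_trans nA; rewrite -ltnS.
Qed.

Lemma dirichlet_addl A i x : (i <= 2 ^ A)%N ->
  dirichlet (2 ^ A + i) x = dirichlet (2 ^ A) x + rademacher A x * dirichlet i x.
Proof.
elim: i => [|i IH] iA; first by rewrite addn0 dirichlet0 mulr0 addr0.
by rewrite addnS !dirichletS IH 1?ltnW// walsh_addl// mulrDr addrA.
Qed.

Lemma dirichlet_rev A i x : (i <= 2 ^ A)%N ->
  dirichlet (2 ^ A - i) x = dirichlet (2 ^ A) x - walsh (2 ^ A - 1) x * dirichlet i x.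
Proof.
elim: i => [|i IH] iA; first by rewrite subn0 dirichlet0 mulr0 subr0.
have := IH (ltnW iA).
have -> : (2 ^ A - i = (2 ^ A - i.+1).+1)%N by lia.
rewrite !dirichletS => /(canRL (addrK _)) ->.
have -> : (2 ^ A - i.+1 = 2 ^ A - 1 - i)%N by lia.
by rewrite walsh_rev// mulrDr opprD addrA.
Qed.

Lemma dirichlet_pow2S A x :
  dirichlet (2 ^ A.+1) x = (1 + rademacher A x) * dirichlet (2 ^ A) x.
Proof. by rewrite expnS mul2n -addnn dirichlet_addl// mulrDl mul1r. Qed.

Lemma dirichlet_1 x : dirichlet 1 x = 1.
Proof. by rewrite dirichletS dirichlet0 walsh_0 add0r. Qed.

Lemma rademacherD1_ge0 A x : 0 <= 1 + rademacher A x.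
Proof. by rewrite /rademacher; case: (x A); rewrite /= ?expr1 ?expr0 ?subrr// addr_ge0. Qed.

Lemma dirichlet_pow2_ge0 A x : 0 <= dirichlet (2 ^ A) x.
Proof.
elim: A => [|A IH]; first by rewrite expn0 dirichlet_1.
by rewrite dirichlet_pow2S mulr_ge0// rademacherD1_ge0.
Qed.

Lemma dirichlet_small A n x : (n <= 2 ^ A)%N -> (forall k, (k < A)%N -> x k = false) ->
  dirichlet n x = n%:R.
Proof.
move=> nA xA; have : forall i, (i < n)%N -> walsh i x = 1.
  move=> i ni; rewrite (@walshE _ A); last exact: leq_trans nA.
  by apply: big1 => k _; rewrite /rademacher xA//= expr0 expr1n.
move=> w1; rewrite /dirichlet (eq_bigr (fun=> 1)); last by move=> i _; exact: w1.
by rewrite sumr_const card_ord.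
Qed.

Lemma dirichlet_pow2_eq0 A k x : (k < A)%N -> x k -> dirichlet (2 ^ A) x = 0.
Proof.
elim: A => [//|A IH]; rewrite ltnS leq_eqVlt dirichlet_pow2S => /predU1P[->|kA] xk.
  by rewrite /rademacher xk expr1 subrr mul0r.
by rewrite IH// mulr0.
Qed.

Lemma fejer_addl A i x : (i <= 2 ^ A)%N ->
  fejer (2 ^ A + i) x =
  fejer (2 ^ A) x + i%:R * dirichlet (2 ^ A) x + rademacher A x * fejer i x.
Proof.
elim: i => [|i IH] iA; first by rewrite addn0 fejer0 mulr0 addr0 mul0r addr0.
rewrite addnS !fejerS IH 1?ltnW// -addnS dirichlet_addl// -natr1.
by ring.
Qed.

Lemma fejer_pow2S A x : fejer (2 ^ A.+1) x =
  (1 + rademacher A x) * fejer (2 ^ A) x + 2 ^+ A * dirichlet (2 ^ A) x.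
Proof. by rewrite expnS mul2n -addnn fejer_addl// natrX; ring. Qed.

Lemma fejer_1 x : fejer 1 x = 1.
Proof. by rewrite fejerS fejer0 dirichlet_1 add0r. Qed.

Lemma fejer_pow2_ge0 A x : 0 <= fejer (2 ^ A) x.
Proof.
elim: A => [|A IH]; first by rewrite expn0 fejer_1.
rewrite fejer_pow2S addr_ge0// mulr_ge0 ?rademacherD1_ge0 ?exprn_ge0//.
exact: dirichlet_pow2_ge0.
Qed.

(** On the interval of rank [A] around 0 the two sides are 4^A and 2^A (2^A + 1); elsewhere the left
    one vanishes. This absorbs all Dirichlet terms into Fejer kernels. *)
Lemma dirichlet_le_fejer A x :
  2 ^+ A * dirichlet (2 ^ A) x <= 2 * fejer (2 ^ A) x.
Proof.
elim: A => [|A IH]; first by rewrite expn0 fejer_1 dirichlet_1 expr0; lra.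
rewrite fejer_pow2S dirichlet_pow2S exprS.
have := rademacherD1_ge0 A x; have := dirichlet_pow2_ge0 A x.
have : 1 + rademacher A x <= 2.
  by rewrite /rademacher; case: (x A); rewrite /= ?expr1 ?expr0; lra.
have : 0 <= 2 ^+ A :> R by rewrite exprn_ge0.
move: IH; set e := 2 ^+ A; set d := dirichlet _ _; set f := fejer _ _.
set r := 1 + _ => h e0 r2 d0 r0.
have ed : 0 <= e * d by rewrite mulr_ge0.
have h1 : r * (e * d) <= r * (2 * f) by rewrite ler_pM.
have h2 : r * (e * d) <= 2 * (e * d) by rewrite ler_wpM2r.
have -> : 2 * e * (r * d) = 2 * (r * (e * d)) by ring.
have -> : 2 * (r * f + e * d) = r * (2 * f) + 2 * (e * d) by ring.
lra.
Qed.

(** Strip the leading digit 2^A of [n]: it costs one Fejer kernel, plus (n - 2^A) D_(2^A), which is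
    at most two more; hence 3. The condition [2 ^ j <= n] is what makes the differences telescope in
    [norm_kernel_tail]. *)
Lemma norm_fejer A n x : (n < 2 ^ A)%N ->
  `|fejer n x| <= 3 * \sum_(j < A | (2 ^ j <= n)%N) fejer (2 ^ j) x.
Proof.
elim: A n => [|A IH] n.
  by rewrite expn0 ltnS leqn0 => /eqP ->; rewrite fejer0 normr0 big_ord0 mulr0.
rewrite big_mkcond big_ord_recr -big_mkcond/= => nA.
case: leqP => An; last by rewrite addr0 IH.
rewrite expnS in nA.
have n'A : (n - 2 ^ A < 2 ^ A)%N by lia.
rewrite -{1}(subnKC An) fejer_addl ?(ltnW n'A)// mulrDr addrC.
apply: (le_trans (ler_normD _ _)); rewrite normrM norm_rademacher mul1r lerD//.
  apply: (le_trans (IH _ n'A)); rewrite ler_pM2l//.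
  rewrite big_mkcond [leRHS]big_mkcond/=; apply: ler_sum => j _.
  case: ifP => h1; case: ifP => h2 //; last exact: fejer_pow2_ge0.
  by move: h2; rewrite (leq_trans h1)// leq_subr.
rewrite ger0_norm; last first.
  by rewrite addr_ge0 ?mulr_ge0 ?fejer_pow2_ge0 ?dirichlet_pow2_ge0.
have -> : 3 * fejer (2 ^ A) x = fejer (2 ^ A) x + 2 * fejer (2 ^ A) x by ring.
rewrite lerD2l (le_trans _ (dirichlet_le_fejer A x))//.
by rewrite ler_wpM2r ?dirichlet_pow2_ge0// -natrX ler_nat ltnW.
Qed.

Lemma mean_dirichlet N : mean N (dirichlet (2 ^ N)) = 1.
Proof.
elim: N => [|N IH]; first by rewrite expn0 /= dirichlet_1.
rewrite -{1}/(mean N.+1 _); under eq_mean do rewrite dirichlet_pow2S.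
have H : level N (dirichlet (2 ^ N)) by exact: level_dirichlet.
rewrite (mean_split (fun b u => (1 + (-1) ^+ b) * u) H)/= !meanZ IH.
by field.
Qed.

(** Reproducing kernel: [dirichlet (2 ^ N)] lives where the first [N] bits vanish, and there the
    translation does not change [f]. *)
Lemma mean_mul_dirichlet N (f : dyadic_group -> R) x : level N f ->
  mean N (fun t => f t * dirichlet (2 ^ N) (dyadic_add x t)) = f x.
Proof.
move=> fN.
have HN : level N (fun t => f (dyadic_add x t) * dirichlet (2 ^ N) t).
  apply: level_comp2; first exact: level_dyadic_add.
  exact: level_dirichlet.
transitivity (mean N (fun t => f (dyadic_add x t) * dirichlet (2 ^ N) t)).
  by rewrite -(mean_dyadic_add x HN); apply: eq_mean => t; rewrite dyadic_addK.
transitivity (mean N (fun t => f x * dirichlet (2 ^ N) t)); last first.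
  by rewrite meanZ mean_dirichlet mulr1.
apply: eq_mean => t.
have [/forallP H|/forallPn[k]] := boolP [forall k : 'I_N, t k == false].
  congr (_ * _); apply: fN => k kN.
  by rewrite /dyadic_add (eqP (H (Ordinal kN))) addbF.
by rewrite eqbF_neg negbK => tk; rewrite (dirichlet_pow2_eq0 (ltn_ord k))// !mulr0.
Qed.

End dirichlet_theory.

(** * Kernels of weighted means *)

(* The kernel of the summation method with weights [a]: with
   [a = cesaro_number (alpha - 1)], [cesaro_mean alpha n] is the convolution
   with [weighted_kernel a n] divided by [cesaro_number alpha n]. *)
Definition weighted_kernel {R : realType} (a : nat -> R) (n : nat)
    (x : dyadic_group) : R :=
  \sum_(k < n) a k * dirichlet (n - k) x.

Section weighted_kernel_theory.
Context {R : realType}.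
Implicit Types x y : dyadic_group.
Local Notation rademacher := (@rademacher R).
Local Notation walsh := (@walsh R).
Local Notation dirichlet := (@dirichlet R).
Local Notation fejer := (@fejer R).
Variable a : nat -> R.
Hypothesis a_ge0 : forall n, 0 <= a n.
Hypothesis a_noninc : forall n, a n.+1 <= a n.

Local Notation kernel := (weighted_kernel a).

Lemma level_weighted_kernel A n : (n <= 2 ^ A)%N -> level A (kernel n).
Proof.
move=> nA; apply: level_sum => k _; apply: level_comp.
by apply: level_dirichlet; apply: leq_trans nA; exact: leq_subr.
Qed.

(** What the Dirichlet kernels of order at most [2 ^ A] leave in [kernel (2 ^ A + n)] once
    [dirichlet_rev] has reversed them. The weights now decrease as the order grows, which is the
    setting of Abel summation. *)
Definition kernel_tail A n x : R := \sum_(i < 2 ^ A) a (n + i) * dirichlet i x.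

Lemma level_kernel_tail A n : level A (kernel_tail A n).
Proof.
apply: level_sum => k _; apply: level_comp.
by apply: level_dirichlet; exact: ltnW.
Qed.

Lemma weighted_kernel_addl A n x : (n <= 2 ^ A)%N ->
  kernel (2 ^ A + n) x = (\sum_(i < 2 ^ A + n) a i) * dirichlet (2 ^ A) x -
    walsh (2 ^ A - 1) x * kernel_tail A n x + rademacher A x * kernel n x.
Proof.
move=> nA; rewrite /weighted_kernel addnC !big_split_ord/= mulrDl !mulr_suml.
rewrite (eq_bigr (fun k : 'I_n => a k * dirichlet (2 ^ A) x +
   rademacher A x * (a k * dirichlet (n - k) x))); last first.
  move=> k _; have -> : (n + 2 ^ A - k = 2 ^ A + (n - k))%N.
    by have := ltn_ord k; lia.
  by rewrite dirichlet_addl; [ring|lia].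
rewrite [X in _ + X](eq_bigr (fun k : 'I_(2 ^ A) => a (n + k)%N * dirichlet (2 ^ A) x -
   walsh (2 ^ A - 1) x * (a (n + k)%N * dirichlet k x))); last first.
  move=> k _; rewrite subnDl dirichlet_rev; [by ring|by rewrite ltnW].
rewrite big_split/= sumrB -!mulr_sumr /kernel_tail.
by ring.
Qed.

(** Abel summation turns Dirichlet kernels into Fejer kernels with nonnegative coefficients, to
    which [norm_fejer] applies. After the sums are exchanged, the differences of [a] from [2 ^ j] on
    telescope to the single value [a (n + 2 ^ j)]. *)
Lemma norm_kernel_tail A n x :
  `|kernel_tail A n x| <= 3 * \sum_(j < A) a (n + 2 ^ j) * fejer (2 ^ j) x.
Proof.
have abel M : \sum_(i < M.+1) a (n + i) * dirichlet i x =
    \sum_(i < M) (a (n + i) - a (n + i.+1)) * fejer i x + a (n + M) * fejer M x.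
  elim: M => [|M IH]; first by rewrite big_ord1 big_ord0 fejer0 dirichlet0 !mulr0 addr0.
  by rewrite big_ord_recr IH/= [in RHS]big_ord_recr/= fejerS; ring.
have [M MA] : exists M, (2 ^ A = M.+1)%N.
  by exists (2 ^ A).-1; rewrite prednK// expn_gt0.
rewrite /kernel_tail MA abel.
have fb i : (i <= M)%N -> `|fejer i x| <= 3 * \sum_(j < A | (2 ^ j <= i)%N) fejer (2 ^ j) x.
  by move=> iM; apply: norm_fejer; rewrite MA ltnS.
apply: (@le_trans _ _ (\sum_(i < M) (a (n + i) - a (n + i.+1)) *
    (3 * \sum_(j < A | (2 ^ j <= i)%N) fejer (2 ^ j) x) +
    a (n + M) * (3 * \sum_(j < A | (2 ^ j <= M)%N) fejer (2 ^ j) x))).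
  apply: (le_trans (ler_normD _ _)); apply: lerD; last first.
    by rewrite normrM ger0_norm// ler_wpM2l// fb.
  apply: (le_trans (ler_norm_sum _ _ _)); apply: ler_sum => i _.
  have d0 : 0 <= a (n + i) - a (n + i.+1) by rewrite subr_ge0 addnS.
  by rewrite normrM (ger0_norm d0) ler_wpM2l// fb// ltnW.
(* Nothing more is lost: the rest is the exchange of sums and the telescoping. *)
rewrite le_eqVlt; apply/orP; left; apply/eqP.
transitivity (3 * \sum_(j < A) (\sum_(i < M | (2 ^ j <= i)%N) (a (n + i) - a (n + i.+1))
     + a (n + M)) * fejer (2 ^ j) x); last first.
  congr (_ * _); apply: eq_bigr => j _; congr (_ * _).
  have jM : (2 ^ j <= M)%N by rewrite -ltnS -MA ltn_exp2l.
  rewrite -(big_mkord (fun i => 2 ^ j <= i)%N (fun i => a (n + i) - a (n + i.+1))).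
  rewrite (big_cat_nat (leq0n _) jM)/=.
  rewrite [X in X + _ + _](_ : _ = 0) ?add0r; last first.
    by rewrite big_nat_cond big1// => i /andP[/andP[_ +] +]; lia.
  have -> : \sum_(2 ^ j <= i < M | (2 ^ j <= i)%N) (a (n + i) - a (n + i.+1)) =
     \sum_(2 ^ j <= i < M) ((- a (n + i.+1)) - (- a (n + i))).
    rewrite big_nat_cond [in RHS]big_nat_cond; apply: eq_big => i.
      by rewrite andbT andb_idr// => /andP[].
    by move=> _; rewrite opprK addrC.
  by rewrite (telescope_sumr (fun i => - a (n + i))) // opprK addrAC addNr add0r.
have -> : \sum_(j < A) (\sum_(i < M | (2 ^ j <= i)%N) (a (n + i) - a (n + i.+1)) +
      a (n + M)) * fejer (2 ^ j) x =
    \sum_(j < A) \sum_(i < M | (2 ^ j <= i)%N) (a (n + i) - a (n + i.+1)) * fejer (2 ^ j) x +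
    \sum_(j < A) a (n + M) * fejer (2 ^ j) x.
  by rewrite -big_split; apply: eq_bigr => j _; rewrite mulrDl mulr_suml.
rewrite mulrDr; congr (_ + _); last first.
  rewrite mulrCA -mulr_sumr; congr (_ * (_ * _)); apply: eq_bigl => j /=.
  by rewrite -ltnS -MA ltn_exp2l ?ltn_ord.
transitivity (\sum_(i < M) 3 * \sum_(j < A | (2 ^ j <= i)%N)
    (a (n + i) - a (n + i.+1)) * fejer (2 ^ j) x).
  by apply: eq_bigr => i _; rewrite mulrCA mulr_sumr.
rewrite -mulr_sumr; congr (_ * _).
by rewrite (exchange_big_dep xpredT).
Qed.

Section bound.
Variables (theta C1 C2 : R).
Hypothesis theta_gt0 : 0 < theta.
Hypothesis theta_lt1 : theta < 1.
Hypothesis a_upper : forall j m, (2 ^ j <= m)%N -> a m <= C2 * theta ^+ j.+1.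
Hypothesis sum_a_upper : forall A n, (n <= 2 ^ A.+1)%N ->
  \sum_(i < n) a i <= C1 * (2 * theta) ^+ A.

Let K : R := 3 * C2 / (1 - theta).

Let C1_ge0 : 0 <= C1.
Proof.
have := sum_a_upper (leq0n (2 ^ 1)%N).
by rewrite big_ord0 expr0 mulr1.
Qed.

Let C2_ge0 : 0 <= C2.
Proof.
have := le_trans (a_ge0 _) (a_upper (leqnn (2 ^ 0)%N)).
by rewrite expr1 pmulr_lge0.
Qed.

Let K_ge0 : 0 <= K.
Proof. by rewrite /K divr_ge0 ?mulr_ge0// subr_ge0 ltW. Qed.

Let theta_le i j : (i <= j)%N -> theta ^+ j <= theta ^+ i.
Proof. by move=> ij; rewrite ler_wiXn2l// ltW. Qed.

(** Induction on [n] by removing its leading digit. Adding up the tails naively would cost one term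
    per digit; the correction [- theta ^+ A] is a budget that grows with [A]. [K] is chosen so that
    3 C2 theta^i = K (theta^i - theta^(i+1)): a tail is paid by the budget gained between two
    digits. *)
Lemma norm_weighted_kernel_aux n A x : (n < 2 ^ A)%N ->
  `|kernel n x| <= \sum_(j < A)
    (2 * C1 * theta ^+ j + K * (theta ^+ j - theta ^+ A)) * fejer (2 ^ j) x.
Proof.
elim/ltn_ind: n A => n IH A nA.
have [->|n0] := posnP n.
  rewrite /weighted_kernel big_ord0 normr0 sumr_ge0// => j _.
  have t0 : 0 <= theta ^+ j by rewrite exprn_ge0// ltW.
  have tA : 0 <= theta ^+ j - theta ^+ A by rewrite subr_ge0 theta_le// ltnW.
  rewrite mulr_ge0 ?fejer_pow2_ge0// addr_ge0 ?(mulr_ge0 K_ge0 tA)//.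
  by rewrite !mulr_ge0.
have [B [Bn nB]] : exists B, (2 ^ B <= n)%N /\ (n < 2 ^ B.+1)%N.
  exists (trunc_log 2 n); have := trunc_log_bounds (erefl : (1 < 2)%N) n0.
  by move=> /andP[].
have BA : (B < A)%N by rewrite -(ltn_exp2l _ _ (erefl : (1 < 2)%N)) (leq_ltn_trans Bn).
pose n' := (n - 2 ^ B)%N.
have n'n : (n' < n)%N by rewrite /n' ltn_subrL expn_gt0.
have n'B : (n' < 2 ^ B)%N by move: nB; rewrite expnS /n'; lia.
(* [A'] is the exact digit length of the remainder; its minimality, the last clause, bounds the
   weights by theta^A' below rank [A']. *)
have [A' [A'B n'A' A'n']] : exists A', [/\ (A' <= B)%N, (n' < 2 ^ A')%N &
    forall i, A' = i.+1 -> (2 ^ i <= n')%N].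
  have [n'0|n'0] := posnP n'; first by exists 0%N; rewrite n'0.
  have /andP[h1 h2] := trunc_log_bounds (erefl : (1 < 2)%N) n'0.
  exists (trunc_log 2 n').+1; split => //; last by move=> i [<-].
  by rewrite -(ltn_exp2l _ _ (erefl : (1 < 2)%N)) (leq_ltn_trans h1).
have -> : kernel n x = kernel (2 ^ B + n') x by rewrite /n' subnKC.
rewrite weighted_kernel_addl ?(ltnW n'B)//.
apply: (@le_trans _ _ (2 * C1 * theta ^+ B * fejer (2 ^ B) x +
   3 * \sum_(j < B) a (n' + 2 ^ j) * fejer (2 ^ j) x +
   \sum_(j < A') (2 * C1 * theta ^+ j + K * (theta ^+ j - theta ^+ A')) * fejer (2 ^ j) x)).
  apply: (le_trans (ler_normD _ _)); apply: lerD; last first.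
    by rewrite normrM norm_rademacher mul1r IH.
  apply: (le_trans (ler_normB _ _)); apply: lerD; last first.
    by rewrite normrM norm_walsh mul1r norm_kernel_tail.
  rewrite ger0_norm; last by rewrite mulr_ge0 ?dirichlet_pow2_ge0 ?sumr_ge0.
  apply: (@le_trans _ _ (C1 * (2 * theta) ^+ B * dirichlet (2 ^ B) x)).
    rewrite ler_wpM2r ?dirichlet_pow2_ge0// sum_a_upper//.
    by rewrite /n' subnKC// ltnW.
  rewrite exprMn.
  have -> : C1 * (2 ^+ B * theta ^+ B) * dirichlet (2 ^ B) x =
    C1 * theta ^+ B * (2 ^+ B * dirichlet (2 ^ B) x) by ring.
  have -> : 2 * C1 * theta ^+ B * fejer (2 ^ B) x =
    C1 * theta ^+ B * (2 * fejer (2 ^ B) x) by ring.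
  by rewrite ler_wpM2l ?dirichlet_le_fejer// mulr_ge0// exprn_ge0// ltW.
(* The coefficient of the Fejer kernel of rank [j]: leading digit, tail, induction hypothesis. The
   comparison is then made rank by rank, in the three ranges cut out by [A'] and [B]. *)
pose f (j : nat) := (if j == B then 2 * C1 * theta ^+ B else 0) +
  (if (j < B)%N then 3 * a (n' + 2 ^ j) else 0) +
  (if (j < A')%N then 2 * C1 * theta ^+ j + K * (theta ^+ j - theta ^+ A') else 0).
rewrite [leLHS](_ : _ = \sum_(j < A) f j * fejer (2 ^ j) x); last first.
  have fE j u : f j * u = (if j == B then 2 * C1 * theta ^+ B else 0) * u +
      (if (j < B)%N then 3 * a (n' + 2 ^ j) else 0) * u + (if (j < A')%N
      then 2 * C1 * theta ^+ j + K * (theta ^+ j - theta ^+ A') else 0) * u.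
    by rewrite /f -!mulrDl.
  under [RHS]eq_bigr do rewrite fE.
  rewrite !big_split/=; congr (_ + _ + _).
  - rewrite (bigD1 (Ordinal BA))//= eqxx big1 ?addr0// => j.
    by rewrite -val_eqE/= => /negbTE ->; rewrite mul0r.
  - rewrite mulr_sumr (big_ord_widen _ (fun j => 3 * (a (n' + 2 ^ j) * fejer (2 ^ j) x)) (ltnW BA)).
    rewrite big_mkcond; apply: eq_bigr => j _; case: ifP => _; last by rewrite mul0r.
    by rewrite mulrA.
  - rewrite (big_ord_widen _ (fun j => (2 * C1 * theta ^+ j + K * (theta ^+ j - theta ^+ A')) * fejer (2 ^ j) x)
      (leq_trans A'B (ltnW BA))).
    by rewrite big_mkcond; apply: eq_bigr => j _; case: ifP => _ //; rewrite mul0r.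
apply: ler_sum => j _; rewrite ler_wpM2r ?fejer_pow2_ge0// /f.
have t0 i : 0 <= theta ^+ i by rewrite exprn_ge0// ltW.
have Kt i : 3 * C2 * theta ^+ i = K * (theta ^+ i - theta ^+ i.+1).
  by rewrite /K exprS; field; rewrite subr_eq0 gt_eqF.
have Kd i : (i <= A)%N -> 0 <= K * (theta ^+ i - theta ^+ A).
  by move=> iA; rewrite mulr_ge0// subr_ge0 theta_le.
have CA : 0 <= 2 * C1 * theta ^+ j by rewrite !mulr_ge0.
have [jB|jB] := ltnP j B; last first.
  have -> : (j < A')%N = false by lia.
  have := Kd j (ltnW (ltn_ord j)).
  by case: eqP => [->|_]; lra.
have -> : (j == B :> nat) = false by lia.
(* Below [A'] the tail adds at most 3 C2 theta^A', which the budget regains between [A'] and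
   [A'.+1 <= A]; from [A'] to [B] the budget is still untouched. *)
have [jA'|A'j] := ltnP j A'.
  have : a (n' + 2 ^ j) <= C2 * theta ^+ A'.
    have := A'n' A'.-1; rewrite prednK ?(leq_ltn_trans _ jA')// => /(_ erefl) h.
    rewrite -(prednK (leq_ltn_trans (leq0n _) jA')).
    by apply: a_upper; exact: leq_trans (leq_addr _ _).
  have : K * theta ^+ A <= K * theta ^+ A'.+1.
    by rewrite ler_wpM2l// theta_le// (leq_ltn_trans A'B).
  have := Kt A'; rewrite !mulrBr; lra.
have : a (n' + 2 ^ j) <= C2 * theta ^+ j.
  apply: (@le_trans _ _ (C2 * theta ^+ j.+1)).
    by apply: a_upper; exact: leq_addl.
  by rewrite ler_wpM2l// theta_le.
have : K * theta ^+ A <= K * theta ^+ j.+1.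
  by rewrite ler_wpM2l// theta_le.
have := Kt j; rewrite !mulrBr; lra.
Qed.

Lemma norm_weighted_kernel n A x : (n < 2 ^ A)%N ->
  `|kernel n x| <= (2 * C1 + 3 * C2 / (1 - theta)) *
     \sum_(j < A) theta ^+ j * fejer (2 ^ j) x.
Proof.
move=> nA; apply: (le_trans (norm_weighted_kernel_aux x nA)).
rewrite mulr_sumr; apply: ler_sum => j _.
rewrite mulrA ler_wpM2r ?fejer_pow2_ge0// [leRHS]mulrDl lerD2l ler_wpM2l//.
by rewrite gerBl exprn_ge0// ltW.
Qed.

End bound.

End weighted_kernel_theory.

(** * Powers and Cesaro numbers *)

Section powR_extra.
Context {R : realType}.
Implicit Types u v p : R.

Lemma powR_subadditive p u v : 0 < p -> p <= 1 -> 0 <= u -> 0 <= v ->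
  (u + v) `^ p <= u `^ p + v `^ p.
Proof.
move=> p0 p1 u0 v0; have := addr_ge0 u0 v0.
rewrite le_eqVlt => /predU1P[<-|s0]; first by rewrite powR0 ?gt_eqF// addr_ge0 ?powR_ge0.
have H w : 0 <= w -> w <= u + v -> (u + v) `^ p * (w / (u + v)) <= w `^ p.
  move=> w0 ws.
  have -> : w `^ p = (u + v) `^ p * (w / (u + v)) `^ p.
    rewrite -powRM ?(ltW s0)//; last by rewrite divr_ge0// ltW.
    by rewrite mulrCA mulfV ?mulr1// gt_eqF.
  rewrite ler_wpM2l ?powR_ge0//.
  move: w0; rewrite le_eqVlt => /predU1P[<-|w0].
    by rewrite mul0r powR_ge0.
  by apply: ger1_powR => //; rewrite divr_gt0// ler_pdivrMr// mul1r.
apply: le_trans (lerD (H u u0 _) (H v v0 _)); rewrite ?lerDl ?lerDr//.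
by rewrite -mulrDr -mulrDl mulfV ?mulr1// gt_eqF.
Qed.

Lemma powR_sum_le p (I : Type) (r : seq I) (P : pred I) (f : I -> R) :
  0 < p -> p <= 1 -> (forall i, 0 <= f i) ->
  (\sum_(i <- r | P i) f i) `^ p <= \sum_(i <- r | P i) f i `^ p.
Proof.
move=> p0 p1 f0; elim: r => [|i r IH]; first by rewrite !big_nil powR0// gt_eqF.
rewrite !big_cons; case: (P i) => //.
by apply: (le_trans (powR_subadditive p0 p1 _ _)); rewrite ?sumr_ge0// lerD2l.
Qed.

Lemma powR_exprn u p n : 0 <= u -> (u ^+ n) `^ p = (u `^ p) ^+ n.
Proof. by move=> u0; rewrite -(powR_mulrn n u0) -(powR_mulrn n (powR_ge0 u p)) powRAC. Qed.

Lemma powRV u p : 0 <= u -> u^-1 `^ p = (u `^ p)^-1.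
Proof. by move=> u0; rewrite -(powR_inv1 u0) -powRrM mulN1r powRN. Qed.

Lemma ler_powR2 p u v : 0 <= p -> 0 <= u -> u <= v -> u `^ p <= v `^ p.
Proof. by move=> p0 u0 uv; rewrite ge0_ler_powR// nnegrE// (le_trans u0). Qed.

(* Young's inequality with exponents [1 / p] and [1 / (1 - p)], the second
   factor being [1]. *)
Lemma powR_bernoulli p u : 0 < p -> p < 1 -> -1 <= u -> (1 + u) `^ p <= 1 + p * u.
Proof.
move=> p0 p1 u1; have u0 : 0 <= 1 + u by lra.
have p10 : 0 < 1 - p by rewrite subr_gt0.
have := @conjugate_powR R ((1 + u) `^ p) 1 p^-1 (1 - p)^-1 (powR_ge0 _ _) ler01.
rewrite !invr_gt0 !invrK => /(_ p0 p10 ltac:(ring)).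
by rewrite mulr1 -powRrM mulfV ?gt_eqF// powRr1// powR1; lra.
Qed.

(** Comparison of the l^1 and l^p norms on 2^m atoms: each halving costs 2^(1 - p). This replaces
    Jensen's inequality, which goes the wrong way for p < 1, and needs a function of finitely many
    bits in its later uses. *)
Lemma mean_powR_le m p (f : dyadic_group -> R) : 0 < p -> p <= 1 ->
  (forall x, 0 <= f x) ->
  (mean m f) `^ p <= (2 / 2 `^ p) ^+ m * mean m (fun x => f x `^ p).
Proof.
move=> p0 p1; elim: m f => [|m IH] f f0; first by rewrite expr0 mul1r.
rewrite /= powRM ?addr_ge0 ?invr_ge0 ?mean_ge0//; [|by move=> x; exact: f0..].
have -> : 2^-1 `^ p = (2 `^ p)^-1 :> R.
  exact: powRV.
have c0 : 0 <= (2 `^ p)^-1 by rewrite invr_ge0 powR_ge0.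
apply: (@le_trans _ _ ((mean m (f \o set_bit m false) `^ p +
   mean m (f \o set_bit m true) `^ p) * (2 `^ p)^-1)).
  by rewrite ler_wpM2r// powR_subadditive// mean_ge0// => x; exact: f0.
apply: (@le_trans _ _ (((2 / 2 `^ p) ^+ m * mean m (fun x => (f \o set_bit m false) x `^ p) +
   (2 / 2 `^ p) ^+ m * mean m (fun x => (f \o set_bit m true) x `^ p)) * (2 `^ p)^-1)).
  by rewrite ler_wpM2r// lerD// IH// => x; exact: f0.
rewrite exprS le_eqVlt; apply/orP; left; apply/eqP.
by field; rewrite gt_eqF// powR_gt0.
Qed.

End powR_extra.

Section cesaro_number_theory.
Context {R : realType}.

Lemma cesaro_number0 (b : R) : cesaro_number b 0 = 1.
Proof. by rewrite /cesaro_number big_geq// fact0 divr1. Qed.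

Lemma cesaro_numberS (b : R) n :
  cesaro_number b n.+1 = cesaro_number b n * ((b + n.+1%:R) / n.+1%:R).
Proof.
rewrite /cesaro_number big_nat_recr//= factS natrM invfM; ring.
Qed.

Variable alpha : R.
Hypothesis alpha_gt0 : 0 < alpha.
Hypothesis alpha_lt1 : alpha < 1.

Local Notation a := (cesaro_number (alpha - 1)).
Local Notation b := (cesaro_number alpha).

Let nS_gt0 n : 0 < n.+1%:R :> R. Proof. by rewrite ltr0n. Qed.

Lemma cesaro_number_sub1_gt0 n : 0 < a n.
Proof.
elim: n => [|n IH]; first by rewrite cesaro_number0.
rewrite cesaro_numberS mulr_gt0// divr_gt0// -natr1.
by have := ler0n R n; move: alpha_gt0; lra.
Qed.

Lemma cesaro_number_sub1_noninc n : a n.+1 <= a n.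
Proof.
rewrite cesaro_numberS ger_pMr ?cesaro_number_sub1_gt0// ler_pdivrMr// mul1r.
by move: alpha_lt1; lra.
Qed.

Lemma cesaro_number_sub1_homo m n : (m <= n)%N -> a n <= a m.
Proof.
elim: n => [|n IH]; first by rewrite leqn0 => /eqP ->.
rewrite leq_eqVlt ltnS => /predU1P[->//|/IH]; apply: le_trans.
exact: cesaro_number_sub1_noninc.
Qed.

Lemma cesaro_number_sub1E n : a n * (n%:R + alpha) = alpha * b n.
Proof.
elim: n => [|n IH]; first by rewrite !cesaro_number0 add0r mulrC.
rewrite !cesaro_numberS (mulrA alpha) -IH -natr1.
by field; rewrite natr1 gt_eqF.
Qed.

Lemma cesaro_number_sum n : \sum_(i < n.+1) a i = b n.
Proof.
elim: n => [|n IH]; first by rewrite big_ord1 !cesaro_number0.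
rewrite big_ord_recr/= IH !cesaro_numberS mulrA.
have -> : alpha - 1 + n.+1%:R = n%:R + alpha by rewrite -natr1; ring.
by rewrite cesaro_number_sub1E -natr1; field; rewrite natr1 gt_eqF.
Qed.

Lemma cesaro_number_gt0 n : 0 < b n.
Proof.
rewrite -cesaro_number_sum big_ord_recr/= ltr_wpDl ?cesaro_number_sub1_gt0//.
by apply: sumr_ge0 => i _; rewrite ltW// cesaro_number_sub1_gt0.
Qed.

Lemma cesaro_number_nondec m n : (m <= n)%N -> b m <= b n.
Proof.
elim: n => [|n IH]; first by rewrite leqn0 => /eqP ->.
rewrite leq_eqVlt ltnS => /predU1P[->//|/IH mn]; apply: (le_trans mn).
by rewrite -!cesaro_number_sum [leRHS]big_ord_recr/= lerDl ltW// cesaro_number_sub1_gt0.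
Qed.

Lemma cesaro_number_ge n : n.+1%:R `^ alpha <= b n.
Proof.
elim: n => [|n IH]; first by rewrite powR1 cesaro_number0.
rewrite cesaro_numberS.
have -> : n.+2%:R = n.+1%:R * (1 + n.+1%:R^-1) :> R.
  by rewrite -[in LHS]natr1 mulrDr mulfV ?gt_eqF// mulr1.
have nV : 0 <= n.+1%:R^-1 :> R by rewrite invr_ge0.
rewrite powRM ?addr_ge0// ler_pM ?powR_ge0//.
apply: (le_trans (powR_bernoulli alpha_gt0 alpha_lt1 _)).
  by apply: le_trans nV; exact: lerN10.
by rewrite mulrDl mulfV ?gt_eqF// addrC.
Qed.

(** The inductive step is Bernoulli downwards, (1 - 1/N)^alpha <= 1 - alpha/N, together with (1 -
    z)(1 + z) <= 1. The constant 2 comes from the first value, 1 + alpha. *)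
Lemma cesaro_number_le n : b n.+1 <= 2 * n.+1%:R `^ alpha.
Proof.
elim: n => [|n IH].
  by rewrite powR1 cesaro_numberS cesaro_number0 mul1r divr1 mulr1; move: alpha_lt1; rewrite /=; lra.
rewrite cesaro_numberS; set N : R := n.+2%:R.
have N0 : 0 < N by [].
have -> : (alpha + N) / N = 1 + alpha / N by field; rewrite gt_eqF.
have nE : n.+1%:R = N * (1 + - N^-1) :> R.
  by rewrite mulrDr mulrN mulfV ?gt_eqF// mulr1 /N -[n.+2%:R]natr1 addrK.
have N1 : N^-1 <= 1 by rewrite invf_le1// /N ler1n.
have aN : 0 <= alpha / N by rewrite divr_ge0// ltW.
have aN1 : alpha / N <= 1.
  by rewrite ler_pdivrMr// mul1r (le_trans (ltW alpha_lt1))// /N ler1n.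
apply: (@le_trans _ _ (2 * n.+1%:R `^ alpha * (1 + alpha / N))).
  by rewrite ler_wpM2r// addr_ge0.
rewrite nE powRM ?(ltW N0) ?subr_ge0//.
have := @powR_bernoulli R alpha (- N^-1) alpha_gt0 alpha_lt1.
rewrite lerN2 => /(_ N1); rewrite mulrN => h.
have -> : 2 * (N `^ alpha * (1 - N^-1) `^ alpha) * (1 + alpha / N) =
   2 * N `^ alpha * ((1 - N^-1) `^ alpha * (1 + alpha / N)) by ring.
rewrite ler_piMr ?mulr_ge0 ?powR_ge0//.
apply: (@le_trans _ _ ((1 - alpha / N) * (1 + alpha / N))).
  by rewrite ler_wpM2r// addr_ge0.
by have := sqr_ge0 (alpha / N); rewrite expr2; set z := alpha / N; lra.
Qed.

Local Notation q := (2 `^ alpha).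
Local Notation theta := (2 `^ alpha / 2).

Lemma theta_gt0 : 0 < theta.
Proof. by rewrite divr_gt0// powR_gt0. Qed.

Lemma theta_lt1 : theta < 1.
Proof.
rewrite ltr_pdivrMr// mul1r /powR gt_eqF//.
rewrite -[ltRHS](@lnK R) ?posrE// ltr_expR gtr_pMl ?alpha_lt1//.
by rewrite ln_gt0// ltr1n.
Qed.

Lemma powR_pow2 j : (2 ^ j)%:R `^ alpha = q ^+ j.
Proof. by rewrite natrX powR_exprn. Qed.

Lemma pow_q_le_cesaro_number M n : (2 ^ M <= n)%N -> q ^+ M <= b n.
Proof.
move=> Mn; apply: (le_trans _ (cesaro_number_ge n)).
by rewrite -powR_pow2 ler_powR2 ?(ltW alpha_gt0)// ler_nat ltnW// ltnS.
Qed.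

Lemma cesaro_number_le_pow_q M n : (n <= 2 ^ M)%N -> b n <= 2 * q ^+ M.
Proof.
move=> /cesaro_number_nondec /le_trans; apply.
have /prednK e : (0 < 2 ^ M)%N by rewrite expn_gt0.
by rewrite -e (le_trans (cesaro_number_le _))// e powR_pow2.
Qed.

(** The bound is 2 theta^j, written with the exponent [j.+1] that [norm_weighted_kernel] expects. *)
Lemma cesaro_number_sub1_le j m : (2 ^ j <= m)%N -> a m <= 2 / theta * theta ^+ j.+1.
Proof.
move=> jm; have t0 := theta_gt0.
rewrite exprS mulrA divfK ?gt_eqF//.
apply: (le_trans (cesaro_number_sub1_homo jm)).
have j0 : 0 < (2 ^ j)%:R :> R by rewrite ltr0n expn_gt0.
have h1 : a (2 ^ j) * (2 ^ j)%:R <= b (2 ^ j).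
  apply: (@le_trans _ _ (a (2 ^ j) * ((2 ^ j)%:R + alpha))).
    by rewrite ler_wpM2l ?(ltW (cesaro_number_sub1_gt0 _))// lerDl ltW.
  by rewrite cesaro_number_sub1E ger_pMl ?cesaro_number_gt0// ltW.
have h2 := cesaro_number_le_pow_q (leqnn (2 ^ j)).
rewrite exprMn exprVn mulrA ler_pdivlMr ?exprn_gt0// -natrX.
exact: le_trans h1 h2.
Qed.

Lemma cesaro_number_sub1_ge A n : (n <= 2 ^ A)%N -> alpha / 2 * theta ^+ A <= a n.
Proof.
move=> nA; apply: (le_trans _ (cesaro_number_sub1_homo nA)).
have A1 : 1 <= (2 ^ A)%:R :> R by rewrite ler1n expn_gt0.
have A0 : 0 < (2 ^ A)%:R + alpha by rewrite ltr_wpDl.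
rewrite -(ler_pM2r A0) cesaro_number_sub1E.
apply: (@le_trans _ _ (alpha * q ^+ A)); last first.
  by rewrite ler_wpM2l ?(ltW alpha_gt0)// pow_q_le_cesaro_number.
rewrite exprMn exprVn -natrX.
have -> : alpha / 2 * (q ^+ A / (2 ^ A)%:R) * ((2 ^ A)%:R + alpha) =
  alpha * q ^+ A * (((2 ^ A)%:R + alpha) / (2 * (2 ^ A)%:R)).
  by field; rewrite pnatr_eq0 expn_eq0.
rewrite ler_piMr ?mulr_ge0 ?exprn_ge0 ?powR_ge0 ?(ltW alpha_gt0)//.
rewrite ler_pdivrMr ?mulr_gt0// ?ltr0n ?expn_gt0//.
by move: alpha_lt1 A1; lra.
Qed.

Lemma sum_cesaro_number_sub1_le A n : (n <= 2 ^ A.+1)%N ->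
  \sum_(i < n) a i <= 2 * q * (2 * theta) ^+ A.
Proof.
have -> : 2 * theta = q by field.
case: n => [|n] nA.
  by rewrite big_ord0 !mulr_ge0 ?exprn_ge0 ?powR_ge0.
rewrite cesaro_number_sum -mulrA -exprS.
by apply: cesaro_number_le_pow_q; exact: ltnW.
Qed.

Lemma norm_cesaro_kernel : exists2 C : R, 0 <= C & forall n A x, (n < 2 ^ A)%N ->
  `|weighted_kernel a n x| <= C * \sum_(j < A) theta ^+ j * fejer (2 ^ j) x.
Proof.
have a0 n : 0 <= a n by rewrite ltW// cesaro_number_sub1_gt0.
have t0 := theta_gt0; have t1 := theta_lt1.
exists (2 * (2 * q) + 3 * (2 / theta) / (1 - theta)).
  by rewrite addr_ge0 ?mulr_ge0 ?powR_ge0// ?divr_ge0 ?invr_ge0 ?powR_ge0// subr_ge0 ltW.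
move=> n A x nA.
apply: (norm_weighted_kernel a0 cesaro_number_sub1_noninc t0 t1 _ _ _ nA).
  exact: cesaro_number_sub1_le.
exact: sum_cesaro_number_sub1_le.
Qed.

End cesaro_number_theory.

(** * The maximal operator *)

Section hardy_bound.
Context {R : realType}.
Variable alpha : R.
Hypothesis alpha_gt0 : 0 < alpha.
Hypothesis alpha_lt1 : alpha < 1.

Local Notation dirichlet := (@dirichlet R).
Local Notation fejer := (@fejer R).
Local Notation p := (1 / (1 + alpha)).
Local Notation q := (2 `^ alpha).
Local Notation theta := (2 `^ alpha / 2).
Local Notation rho := (2 `^ p).
Local Notation a := (cesaro_number (alpha - 1)).
Local Notation b := (cesaro_number alpha).

Lemma p_gt0 : 0 < p.
Proof. by rewrite divr_gt0// addr_gt0. Qed.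

Lemma p_le1 : p <= 1.
Proof. by rewrite ler_pdivrMr ?addr_gt0// mul1r lerDl ltW. Qed.

Lemma rho_gt1 : 1 < rho.
Proof.
rewrite /powR gt_eqF// expR_gt1 mulr_gt0 ?p_gt0//.
by rewrite ln_gt0// ltr1n.
Qed.

Lemma q_gt1 : 1 < q.
Proof.
rewrite /powR gt_eqF// expR_gt1 mulr_gt0//.
by rewrite ln_gt0// ltr1n.
Qed.

Lemma powR_1Dalpha_p (u : R) : 0 <= u -> (u `^ (1 + alpha)) `^ p = u.
Proof.
by move=> u0; rewrite -powRrM mulrCA mulfV ?mulr1 ?powRr1// gt_eqF// addr_gt0.
Qed.

(** The critical relation (2^(1 + alpha))^p = 2, solved for q^p. *)
Lemma q_p : q `^ p = 2 / rho.
Proof.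
have r0 : rho != 0 by rewrite gt_eqF// powR_gt0.
apply: (mulIf r0); rewrite divfK// mulrC -powRM ?powR_ge0//.
rewrite -{1}[2](@powRr1 R)// -powRD ?powR_1Dalpha_p//.
by apply/implyP => _; rewrite pnatr_eq0.
Qed.

Lemma theta_p : theta `^ p = 2 / rho ^+ 2.
Proof.
rewrite powRM ?powR_ge0 ?invr_ge0// q_p.
rewrite powRV//.
by field; rewrite gt_eqF// powR_gt0.
Qed.

Lemma mean_rademacherD1 j x (g : dyadic_group -> R) : level j g ->
  mean j.+1 (fun t => (1 + rademacher j (dyadic_add x t)) * g t) = mean j g.
Proof.
move=> gj.
under eq_mean do rewrite rademacher_dyadic_add.
rewrite (mean_split (fun b u => (1 + rademacher j x * (-1) ^+ b) * u) gj) !meanZ/=.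
by field.
Qed.

Lemma mean_dirichlet_tail m j x (s : dyadic_group -> R) : level m s -> (m <= j)%N ->
  mean j (fun t => s t * dirichlet (2 ^ j) (dyadic_add x t)) =
  mean m (fun t => s t * dirichlet (2 ^ m) (dyadic_add x t)).
Proof.
move=> sm; elim: j => [|j IH]; first by rewrite leqn0 => /eqP ->.
rewrite leq_eqVlt ltnS => /predU1P[->//|mj].
rewrite -IH// -(@mean_rademacherD1 j x (fun t => s t * _)).
  by apply: eq_mean => t; rewrite dirichlet_pow2S; ring.
apply: level_comp2; first exact: levelW mj sm.
by apply: level_dyadic_add; exact: level_dirichlet.
Qed.

(** Against a function of [m] bits only the conditional expectation of the kernel counts. Averaging
    out one bit replaces [1 + rademacher j] by 1, so each rank from [m] to [j - 1] only adds 2^i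
    D_(2^m). *)
Lemma mean_fejer_tail m j x (s : dyadic_group -> R) : level m s -> (m <= j)%N ->
  mean j (fun t => s t * fejer (2 ^ j) (dyadic_add x t)) =
  mean m (fun t => s t * fejer (2 ^ m) (dyadic_add x t)) +
  (2 ^+ j - 2 ^+ m) * mean m (fun t => s t * dirichlet (2 ^ m) (dyadic_add x t)).
Proof.
move=> sm; elim: j => [|j IH].
  by rewrite leqn0 => /eqP ->; rewrite subrr mul0r addr0.
rewrite leq_eqVlt ltnS => /predU1P[->|mj]; first by rewrite subrr mul0r addr0.
have lf : level j (fun t => s t * fejer (2 ^ j) (dyadic_add x t)).
  apply: level_comp2; first exact: levelW mj sm.
  by apply: level_dyadic_add; exact: level_fejer.
have ld : level j (fun t => s t * dirichlet (2 ^ j) (dyadic_add x t)).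
  apply: level_comp2; first exact: levelW mj sm.
  by apply: level_dyadic_add; exact: level_dirichlet.
transitivity (mean j.+1 (fun t => (1 + rademacher j (dyadic_add x t)) *
    (s t * fejer (2 ^ j) (dyadic_add x t)) +
    2 ^+ j * (s t * dirichlet (2 ^ j) (dyadic_add x t)))).
  by apply: eq_mean => t; rewrite fejer_pow2S; ring.
rewrite meanD (mean_rademacherD1 _ lf) IH// meanZ (mean_level ld)//.
by rewrite (mean_dirichlet_tail _ sm mj) exprS; ring.
Qed.

Lemma mean_dirichlet_powR m :
  mean m (fun x => dirichlet (2 ^ m) x `^ p) = (rho / 2) ^+ m.
Proof.
elim: m => [|m IH]; first by rewrite /= expn0 dirichlet_1 powR1.
rewrite exprS -IH.
have lD : level m (dirichlet (2 ^ m)) by exact: level_dirichlet.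
under eq_mean do rewrite dirichlet_pow2S.
rewrite (mean_split (fun b u => ((1 + (-1) ^+ b) * u) `^ p) lD)/=.
under eq_mean do rewrite expr0 powRM ?dirichlet_pow2_ge0//.
under [X in _ + X]eq_mean do rewrite expr1 subrr mul0r powR0 ?gt_eqF ?p_gt0//.
by rewrite meanZ mean_cst addr0 mulrAC.
Qed.

Lemma mean_fejer_powR : exists2 C : R, 0 <= C & forall m,
  mean m (fun x => fejer (2 ^ m) x `^ p) <= C * (rho ^+ 2 / 2) ^+ m.
Proof.
have r1 := rho_gt1; have r10 : 0 < rho - 1 by rewrite subr_gt0.
have r0 : 0 < rho by rewrite powR_gt0.
(* The recursion asks for rho C / 2 + 1 <= C rho^2 / 2, that is C >= 2 / (rho (rho - 1)), and order
   1 for C >= 1. *)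
pose C := 1 + 2 / (rho * (rho - 1)).
have C0 : 0 <= C by rewrite addr_ge0// divr_ge0// mulr_ge0// ltW.
exists C => //; elim=> [|m IH].
  rewrite /= expn0 fejer_1 powR1 expr0 mulr1 lerDl divr_ge0// mulr_ge0//; exact: ltW.
have lf : level m (fejer (2 ^ m)) by exact: level_fejer.
have ld : level m (dirichlet (2 ^ m)) by exact: level_dirichlet.
have r0' x := rademacherD1_ge0 (R := R) m x.
have f0' x := fejer_pow2_ge0 (R := R) m x.
have d0' x := dirichlet_pow2_ge0 (R := R) m x.
have e0 : 0 <= 2 ^+ m :> R by rewrite exprn_ge0.
apply: (@le_trans _ _ (mean m.+1 (fun x =>
    ((1 + rademacher m x) * fejer (2 ^ m) x) `^ p +
    (2 ^+ m) `^ p * dirichlet (2 ^ m) x `^ p))).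
  apply: le_mean => x; rewrite fejer_pow2S -powRM//.
  by rewrite powR_subadditive ?p_gt0 ?p_le1 ?mulr_ge0.
rewrite meanD (mean_split (fun b u => ((1 + (-1) ^+ b) * u) `^ p) lf)/=.
under eq_mean do rewrite expr0 powRM//.
under [X in (_ + X) / _]eq_mean do rewrite expr1 subrr mul0r powR0 ?gt_eqF ?p_gt0//.
rewrite meanZ mean_cst addr0.
rewrite -/(mean m.+1 (fun x => (2 ^+ m) `^ p * dirichlet (2 ^ m) x `^ p)).
rewrite meanZ (mean_level (level_comp (fun u => u `^ p) ld))// mean_dirichlet_powR.
rewrite powR_exprn// -exprMn.
have -> : rho * (rho / 2) = rho ^+ 2 / 2 by rewrite expr2 mulrA.
rewrite (exprS (rho ^+ 2 / 2)); set z := (rho ^+ 2 / 2) ^+ m.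
have z0 : 0 <= z by rewrite exprn_ge0// divr_ge0// exprn_ge0// ltW.
apply: (@le_trans _ _ (rho * (C * z) / 2 + z)).
  by rewrite lerD2r ler_wpM2r ?invr_ge0// ler_wpM2l// ltW.
have -> : rho * (C * z) / 2 + z = (rho * C / 2 + 1) * z by field.
have -> : C * (rho ^+ 2 / 2 * z) = C * (rho ^+ 2 / 2) * z by ring.
rewrite ler_wpM2r//.
have -> : C * (rho ^+ 2 / 2) = (rho * C / 2 + 1) + rho * (rho - 1) / 2.
  by rewrite /C; field; rewrite !gt_eqF.
by rewrite lerDl divr_ge0// mulr_ge0// ltW.
Qed.

(* Up to a constant, [majorant m] dominates the average over the cosets of
   [I_m] of the kernels of [cesaro_mean alpha n], for all [n > 2 ^ m]. *)
Definition majorant m x : R :=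
  (q ^+ m)^-1 * \sum_(j < m.+1) theta ^+ j * fejer (2 ^ j) x + dirichlet (2 ^ m) x.

Lemma majorant_ge0 m x : 0 <= majorant m x.
Proof.
rewrite addr_ge0 ?dirichlet_pow2_ge0// mulr_ge0 ?invr_ge0 ?exprn_ge0 ?powR_ge0//.
apply: sumr_ge0 => j _; rewrite mulr_ge0 ?fejer_pow2_ge0// exprn_ge0.
Qed.

Lemma level_majorant m : level m (majorant m).
Proof.
apply: (level_comp2 +%R); last exact: level_dirichlet.
apply: level_comp. apply: level_sum => j _; apply: level_comp.
by apply: level_fejer; rewrite leq_exp2l// -ltnS.
Qed.

(** theta^p = 2 / rho^2 cancels the growth rate of [mean_fejer_powR], so each of the [m.+1] ranks
    contributes the same constant. This is the origin of the logarithm. *)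
Lemma mean_majorant : exists2 C : R, 0 <= C & forall m,
  mean m (fun x => majorant m x `^ p) <= C * m.+1%:R * (rho / 2) ^+ m.
Proof.
have [C C0 CP] := mean_fejer_powR.
exists (C + 1); first by rewrite addr_ge0.
move=> m; have t0 := ltW (theta_gt0 alpha).
have f0 j x : 0 <= theta ^+ j * fejer (2 ^ j) x by rewrite mulr_ge0 ?fejer_pow2_ge0 ?exprn_ge0.
have qm0 : 0 <= (q ^+ m)^-1 by rewrite invr_ge0 exprn_ge0// powR_ge0.
have r0 : 0 < rho by rewrite powR_gt0.
have rm0 : 0 <= (rho / 2) ^+ m by rewrite exprn_ge0// divr_ge0// ltW.
have rm : ((q ^+ m)^-1) `^ p = (rho / 2) ^+ m.
  rewrite -exprVn powR_exprn ?invr_ge0 ?powR_ge0//; congr (_ ^+ _).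
  by rewrite powRV ?powR_ge0// q_p invf_div.
apply: (@le_trans _ _ (mean m (fun x => (rho / 2) ^+ m *
   (\sum_(j < m.+1) (2 / rho ^+ 2) ^+ j * fejer (2 ^ j) x `^ p) +
   dirichlet (2 ^ m) x `^ p))).
  apply: le_mean => x.
  apply: (le_trans (powR_subadditive p_gt0 p_le1 _ _)); rewrite ?dirichlet_pow2_ge0//.
    by rewrite mulr_ge0// sumr_ge0.
  rewrite lerD2r powRM// ?sumr_ge0// rm ler_wpM2l//.
  apply: le_trans (powR_sum_le _ _ p_gt0 p_le1 _) _ => //.
  apply: ler_sum => j _; rewrite powRM ?exprn_ge0 ?fejer_pow2_ge0//.
  by rewrite powR_exprn// theta_p.
rewrite meanD meanZ mean_sum mean_dirichlet_powR.
apply: (@le_trans _ _ ((rho / 2) ^+ m * (m.+1%:R * C) + (rho / 2) ^+ m)).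
  rewrite lerD2r ler_wpM2l//.
  apply: (@le_trans _ _ (\sum_(j < m.+1) C)); last first.
    by rewrite sumr_const card_ord -[leLHS]mulr_natl.
  apply: ler_sum => j _; rewrite meanZ.
  have lf : level j (fejer (2 ^ j)) by exact: level_fejer.
  have jm : (j <= m)%N by rewrite -ltnS.
  rewrite (mean_level (level_comp (fun u => u `^ p) lf) jm).
  have r20 : 0 <= 2 / rho ^+ 2 by rewrite divr_ge0// exprn_ge0// ltW.
  apply: (le_trans (ler_wpM2l (exprn_ge0 _ r20) (CP j))).
  rewrite mulrCA -exprMn (_ : 2 / rho ^+ 2 * (rho ^+ 2 / 2) = 1) ?expr1n ?mulr1//.
  by field; rewrite gt_eqF.
rewrite [leLHS](_ : _ = (C * m.+1%:R + 1) * (rho / 2) ^+ m); last by ring.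
by rewrite ler_wpM2r// [leRHS]mulrDl mul1r lerD2l ler1n.
Qed.

(** Ranks up to [m] are kept. Beyond [m], [mean_fejer_tail] leaves theta^j Phi_m + q^j D_(2^m): the
    first series converges and is absorbed by its rank [m], whence [K1]; the second is dominated by
    q^M, whence [K2], and q^M is compensated by [b n], as n > 2^M. *)
Lemma mean_cesaro_kernel_le : exists2 C : R, 0 <= C &
  forall m M n (s : dyadic_group -> R) x,
    level m s -> (forall t, 0 <= s t) -> (m <= M)%N ->
    (2 ^ M < n)%N -> (n <= 2 ^ M.+1)%N ->
    (b n)^-1 * mean M.+1 (fun t => s t * `|weighted_kernel a n (dyadic_add x t)|) <=
    C * mean m (fun t => s t * majorant m (dyadic_add x t)).
Proof.
have [C C0 CP] := norm_cesaro_kernel alpha_gt0 alpha_lt1.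
have t0 := theta_gt0 alpha; have t1 := theta_lt1 alpha_lt1.
have q1 := q_gt1; have q0 : 0 < q by rewrite powR_gt0.
have q10 : 0 < q - 1 by rewrite subr_gt0.
have t10 : 0 < 1 - theta by rewrite subr_gt0.
pose K1 := 1 + (1 - theta)^-1; pose K2 := q ^+ 2 / (q - 1).
have K10 : 0 <= K1 by rewrite addr_ge0// invr_ge0 ltW.
have K20 : 0 <= K2 by rewrite divr_ge0 ?exprn_ge0// ltW.
exists (C * (K1 + K2)); first by rewrite mulr_ge0// addr_ge0.
move=> m M n s x sm s0 mM Mn nM.
pose X j := mean M.+1 (fun t => s t * fejer (2 ^ j) (dyadic_add x t)).
pose Y j := mean m (fun t => s t * fejer (2 ^ j) (dyadic_add x t)).
pose Z := mean m (fun t => s t * dirichlet (2 ^ m) (dyadic_add x t)).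
have Y0 j : 0 <= Y j by apply: mean_ge0 => t; rewrite mulr_ge0// fejer_pow2_ge0.
have Z0 : 0 <= Z by apply: mean_ge0 => t; rewrite mulr_ge0// dirichlet_pow2_ge0.
have tn j : 0 <= theta ^+ j by rewrite exprn_ge0// ltW.
have lj j i : (m <= i)%N -> (j <= i)%N ->
    level i (fun t => s t * fejer (2 ^ j) (dyadic_add x t)).
  move=> mi ji; apply: level_comp2; first exact: levelW mi sm.
  by apply: level_dyadic_add; apply: levelW ji _; exact: level_fejer.
have h1 : mean M.+1 (fun t => s t * `|weighted_kernel a n (dyadic_add x t)|) <=
    C * \sum_(0 <= j < M.+2) theta ^+ j * X j.
  apply: (@le_trans _ _ (mean M.+1 (fun t => C * \sum_(j < M.+2) theta ^+ j *
      (s t * fejer (2 ^ j) (dyadic_add x t))))).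
    apply: le_mean => t.
    apply: (le_trans (ler_wpM2l (s0 t) (CP n M.+2 _ _))).
      by apply: (leq_ltn_trans nM); rewrite ltn_exp2l.
    rewrite mulrCA ler_wpM2l// mulr_sumr; apply: ler_sum => j _.
    by rewrite mulrCA.
  rewrite meanZ mean_sum big_mkord ler_wpM2l//; apply: ler_sum => j _.
  by rewrite meanZ.
have mM2 : (m.+1 <= M.+2)%N by rewrite ltnS (leq_trans mM).
have h2 : \sum_(0 <= j < M.+2) theta ^+ j * X j <=
   \sum_(0 <= j < m.+1) theta ^+ j * Y j +
   \sum_(m.+1 <= j < M.+2) (theta ^+ j * Y m + q ^+ j * Z).
  rewrite (big_cat_nat (leq0n _) mM2)/=; apply: lerD.
    rewrite big_nat [leRHS]big_nat; apply: ler_sum => j /andP[_]; rewrite ltnS => jm.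
    by rewrite /X (mean_level (lj j m _ _))// (leq_trans mM).
  rewrite big_nat [leRHS]big_nat; apply: ler_sum => j /andP[mj]; rewrite ltnS => jM.
  rewrite /X (mean_level (lj j j (ltnW mj) (leqnn _)) jM) (mean_fejer_tail _ sm (ltnW mj)).
  have -> : q ^+ j = theta ^+ j * 2 ^+ j by rewrite -exprMn divfK.
  rewrite -mulrA -mulrDr ler_wpM2l// lerD2l ler_wpM2r//.
  by rewrite gerBl exprn_ge0.
have h3 : \sum_(m.+1 <= j < M.+2) theta ^+ j <= (1 - theta)^-1 * theta ^+ m.
  rewrite -(ler_pM2l t10) mulrA mulfV ?gt_eqF// mul1r.
  have H k : (m.+1 <= k)%N ->
      (1 - theta) * \sum_(m.+1 <= j < k) theta ^+ j = theta ^+ m.+1 - theta ^+ k.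
    elim: k => [|k IH]; first by rewrite ltn0.
    rewrite leq_eqVlt => /predU1P[<-|mk].
      by rewrite big_geq// mulr0 subrr.
    by rewrite big_nat_recr//= mulrDr IH// (exprS _ k) mulrBl mul1r addrA subrK.
  by rewrite H// (@le_trans _ _ (theta ^+ m.+1))// ?gerBl// exprS ler_piMl// ltW.
have h4 : \sum_(m.+1 <= j < M.+2) q ^+ j <= K2 * q ^+ M.
  apply: (@le_trans _ _ (\sum_(0 <= j < M.+2) q ^+ j)).
    rewrite [leRHS](big_cat_nat (leq0n _) mM2)/= lerDr; apply: sumr_ge0 => j _.
    by apply: exprn_ge0; exact: ltW.
  rewrite big_mkord -(ler_pM2l q10) -subrX1 /K2.
  have -> : (q - 1) * (q ^+ 2 / (q - 1) * q ^+ M) = q ^+ M.+2.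
    by rewrite mulrA mulrCA mulfV ?gt_eqF// mulr1 -exprD.
  by rewrite gerBl.
have bM := pow_q_le_cesaro_number alpha_gt0 alpha_lt1 (ltnW Mn).
have qM0 : 0 < q ^+ M by rewrite exprn_gt0.
have qm0 : 0 < q ^+ m by rewrite exprn_gt0.
have bn0 : 0 < b n by exact: lt_le_trans bM.
have mE : mean m (fun t => s t * majorant m (dyadic_add x t)) =
    (q ^+ m)^-1 * \sum_(0 <= j < m.+1) theta ^+ j * Y j + Z.
  rewrite /Z /majorant big_mkord.
  under eq_mean do rewrite mulrDr.
  rewrite meanD; congr (_ + _).
  under eq_mean do rewrite mulrCA mulr_sumr.
  rewrite meanZ mean_sum; congr (_ * _); apply: eq_bigr => j _.
  by under eq_mean do rewrite mulrCA; rewrite meanZ.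
rewrite mE; set S := \sum_(0 <= j < m.+1) _ in h2 *.
have tY0 j : 0 <= theta ^+ j * Y j by rewrite mulr_ge0.
have SY : theta ^+ m * Y m <= S by rewrite /S big_nat_recr//= lerDr sumr_ge0.
have S0 : 0 <= S by rewrite sumr_ge0.
have h5 : \sum_(0 <= j < M.+2) theta ^+ j * X j <= K1 * S + K2 * q ^+ M * Z.
  apply: (le_trans h2); rewrite big_split/= -!mulr_suml addrA.
  apply: lerD; last by rewrite ler_wpM2r.
  rewrite /K1 mulrDl mul1r lerD2l.
  apply: (@le_trans _ _ ((1 - theta)^-1 * theta ^+ m * Y m)); first by rewrite ler_wpM2r.
  by rewrite -mulrA ler_wpM2l// invr_ge0 ltW.
have bV : (b n)^-1 <= (q ^+ m)^-1.
  rewrite lef_pV2 ?posrE//; apply: le_trans bM.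
  by rewrite ler_weXn2l// ltW.
have bV' : (b n)^-1 * q ^+ M <= 1 by rewrite mulrC ler_pdivrMr// mul1r.
have bV0 : 0 <= (b n)^-1 by rewrite invr_ge0 ltW.
apply: (le_trans (ler_wpM2l bV0 (le_trans h1 (ler_wpM2l C0 h5)))).
rewrite mulrCA -[leRHS]mulrA ler_wpM2l//.
apply: (@le_trans _ _ (K1 * ((q ^+ m)^-1 * S) + K2 * Z)).
  rewrite mulrDr; apply: lerD.
    by rewrite mulrCA ler_wpM2l// ler_wpM2r.
  rewrite -mulrA mulrCA ler_wpM2l// mulrA -[leRHS]mul1r ler_wpM2r//.
have u0 : 0 <= (q ^+ m)^-1 * S by rewrite mulr_ge0// invr_ge0 ltW.
have : 0 <= K1 * Z by rewrite mulr_ge0.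
have : 0 <= K2 * ((q ^+ m)^-1 * S) by rewrite mulr_ge0.
set w := (q ^+ m)^-1 * S; clearbody K1 K2; rewrite mulrDl !mulrDr; lra.
Qed.

End hardy_bound.

(** * Predictable heights of a martingale *)

(** Integral-free form of [dyadic_martingale]; [dyadic_martingale_bit] and [bit_martingale_dyadic]
    translate both ways. *)
Definition bit_martingale {R : realType} (F : nat -> dyadic_group -> R) :=
  (forall n, level n (F n)) /\
  forall n x, F n x = (F n.+1 (set_bit n false x) + F n.+1 (set_bit n true x)) / 2.

Section height.
Context {R : realType}.
Variable F : nat -> dyadic_group -> R.
Hypothesis FM : bit_martingale F.

(* Predictable because [`|F m.+1 x - F m x|] does not depend on the bit [x m]. *)
Definition predictable_bound m x : R := `|F m x| + `|F m.+1 x - F m x|.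

(* [height] follows [predictable_bound] up to a factor 2: it is updated only
   when the bound more than doubles, and [new_height] is the new value at such
   an update, 0 elsewhere.  Hence the nonzero [new_height]s at a point grow
   geometrically, while each of them only depends on the past. *)
Fixpoint height m x : R :=
  if m is m'.+1 then
    if predictable_bound m x <= 2 * height m' x then height m' x
    else predictable_bound m x
  else predictable_bound 0 x.

Definition new_height m x : R :=
  if m is m'.+1 then
    if predictable_bound m x <= 2 * height m' x then 0 else predictable_bound m x
  else predictable_bound 0 x.

Lemma bit_martingale_incr n x :
  F n.+1 x - F n x = - (F n.+1 (set_bit n (~~ x n) x) - F n x).
Proof.
rewrite (FM.2 n x) -[X in F n.+1 X - _ = _](set_bit_id n x).
by case: (x n) => /=; field.
Qed.

Lemma level_predictable_bound m : level m (predictable_bound m).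
Proof.
move=> x y xy; rewrite /predictable_bound (FM.1 m _ _ xy); congr (_ + _).
have [xym|xym] := eqVneq (x m) (y m).
  congr `|_ - _|; apply: FM.1 => k; rewrite ltnS leq_eqVlt.
  by move=> /predU1P[->//|/xy].
rewrite [in RHS]bit_martingale_incr normrN; congr `|_ - _|; apply: FM.1 => k.
rewrite ltnS leq_eqVlt /set_bit => /predU1P[->|km].
  by rewrite eqxx; move: xym; case: (x m); case: (y m).
by rewrite ltn_eqF// xy.
Qed.

Lemma level_height m : level m (height m).
Proof.
elim: m => [|m IH]; first exact: level_predictable_bound.
move=> x y xy; have xy' k : (k < m)%N -> x k = y k by move=> km; exact/xy/ltnW.
by rewrite /= (level_predictable_bound xy) (IH _ _ xy').
Qed.

Lemma level_new_height m : level m (new_height m).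
Proof.
case: m => [|m]; first exact: level_predictable_bound.
move=> x y xy; have xy' k : (k < m)%N -> x k = y k by move=> km; exact/xy/ltnW.
by rewrite /= (level_predictable_bound xy) (level_height xy').
Qed.

Lemma predictable_bound_ge0 m x : 0 <= predictable_bound m x.
Proof. by rewrite addr_ge0. Qed.

Lemma new_height_ge0 m x : 0 <= new_height m x.
Proof. by case: m => [|m] /=; [|case: ifP]; rewrite // predictable_bound_ge0. Qed.

Lemma height_ge0 m x : 0 <= height m x.
Proof. by elim: m => [|m IH] /=; [|case: ifP]; rewrite // predictable_bound_ge0. Qed.

Lemma height_le_sum m x : height m x <= \sum_(j < m.+1) new_height j x.
Proof.
elim: m => [|m IH]; first by rewrite big_ord1.
rewrite big_ord_recr/=; case: ifP => _; first by rewrite addr0.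
by rewrite lerDr sumr_ge0// => j _; exact: new_height_ge0.
Qed.

Lemma predictable_bound_le_height m x : predictable_bound m x <= 2 * height m x.
Proof.
have := predictable_bound_ge0 m x.
case: m => [|m] /=; first by lra.
by case: ifP => //; lra.
Qed.

(** What predictability buys: the value at time [m.+1] is controlled by functions of at most [m]
    bits. *)
Lemma norm_le_sum_new_height m x :
  `|F m.+1 x| <= 2 * \sum_(j < m.+1) new_height j x.
Proof.
apply: (@le_trans _ _ (2 * height m x)); last by rewrite ler_wpM2l// height_le_sum.
apply: le_trans (predictable_bound_le_height m x).
by rewrite -{1}(subrK (F m x) (F m.+1 x)) addrC ler_normD.
Qed.

Lemma height_le m x c : (forall n, `|F n x| <= c) -> height m x <= 3 * c.
Proof.
move=> Fc; have H n : predictable_bound n x <= 3 * c.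
  have := ler_normB (F n.+1 x) (F n x); rewrite /predictable_bound.
  by have := Fc n; have := Fc n.+1; lra.
elim: m => [|m IH]; first exact: H.
by rewrite /=; case: ifP => _; [exact: IH|exact: H].
Qed.

(** At an update the new height exceeds twice the old one, so the p-th power of the height grows by
    at least the fraction 1 - 2^(-p) of its new value; these increments telescope. *)
Lemma sum_new_height_powR p m x : 0 < p ->
  (1 - (2 `^ p)^-1) * \sum_(j < m.+1) new_height j x `^ p <= height m x `^ p.
Proof.
move=> p0; have r0 : 0 < 2 `^ p :> R by rewrite powR_gt0.
have K0 : 0 <= 1 - (2 `^ p)^-1 :> R.
  rewrite subr_ge0 invf_le1//.
  by have := @ler_powR R 2 (ler1n R 2) _ _ (ltW p0); rewrite powRr0.
elim: m => [|m IH].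
  by rewrite big_ord1 /= ler_piMl ?powR_ge0// gerBl invr_ge0 ltW.
rewrite big_ord_recr mulrDr/=; case: ifPn => [_|].
  by rewrite powR0 ?gt_eqF// mulr0 addr0.
rewrite -ltNge => /ltW h; rewrite [X in _ + X]mulrBl mul1r.
apply: (@le_trans _ _ (height m x `^ p + (predictable_bound m.+1 x `^ p -
   (2 `^ p)^-1 * predictable_bound m.+1 x `^ p))).
  by rewrite lerD2r.
rewrite addrCA gerDl subr_le0 -(ler_pM2l r0) mulrA mulfV ?gt_eqF// mul1r.
rewrite -powRM ?height_ge0//.
by apply: ler_powR2; rewrite ?mulr_ge0 ?height_ge0// ltW.
Qed.

End height.

(** * Pointwise bound for the Cesaro means *)

Section pointwise_bound.
Context {R : realType}.
Variable alpha : R.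
Hypothesis alpha_gt0 : 0 < alpha.
Hypothesis alpha_lt1 : alpha < 1.

Local Notation p := (1 / (1 + alpha)).
Local Notation rho := (2 `^ p).
Local Notation a := (cesaro_number (alpha - 1)).
Local Notation b := (cesaro_number alpha).

(** (2 / rho)^m is the price of [mean_powR_le], and 1 / (m + 1) is what the logarithm grants to
    level [m]. They compensate both factors of [mean_majorant] in [mean_cesaro_majorant]. *)
Definition cesaro_majorant (F : nat -> dyadic_group -> R) m x : R :=
  m.+1%:R^-1 * (2 / rho) ^+ m *
  mean m (fun t => (new_height F m t * majorant alpha m (dyadic_add x t)) `^ p).

Lemma cesaro_majorant_ge0 F m x : 0 <= cesaro_majorant F m x.
Proof.
apply: mulr_ge0; last by apply: mean_ge0 => t; exact: powR_ge0.
by rewrite mulr_ge0 ?invr_ge0// exprn_ge0// divr_ge0// powR_ge0.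
Qed.

Lemma level_cesaro_majorant F m : level m (cesaro_majorant F m).
Proof.
move=> x y xy; rewrite /cesaro_majorant; congr (_ * _); apply: eq_mean => t.
congr (( _ * _) `^ _); apply: level_majorant => k km.
by rewrite /dyadic_add xy.
Qed.

Lemma mean_cesaro_majorant : exists2 C : R, 0 <= C & forall F m,
  bit_martingale F ->
  mean m (cesaro_majorant F m) <= C * mean m (fun t => new_height F m t `^ p).
Proof.
have [C C0 CP] := mean_majorant alpha_gt0.
exists C => // F m FM; rewrite /cesaro_majorant meanZ exchange_mean.
have h1 t : mean m (fun x => (new_height F m t * majorant alpha m (dyadic_add x t)) `^ p) =
    new_height F m t `^ p * mean m (fun x => majorant alpha m x `^ p).
  rewrite -(mean_dyadic_add t (level_comp (fun u => u `^ p) (@level_majorant R alpha m))).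
  rewrite -meanZ; apply: eq_mean => x.
  by rewrite powRM ?new_height_ge0 ?majorant_ge0// dyadic_addC.
under eq_mean do rewrite h1 mulrC.
rewrite meanZ mulrA; apply: ler_wpM2r; first by apply: mean_ge0 => t; exact: powR_ge0.
have r0 : 0 < rho by rewrite powR_gt0.
have c0 : 0 <= m.+1%:R^-1 * (2 / rho) ^+ m.
  by rewrite mulr_ge0 ?invr_ge0// exprn_ge0// divr_ge0// ltW.
apply: (le_trans (ler_wpM2l c0 (CP m))).
rewrite le_eqVlt; apply/orP; left; apply/eqP.
transitivity (C * (m.+1%:R^-1 * m.+1%:R) * ((2 / rho) * (rho / 2)) ^+ m).
  by rewrite (exprMn_comm _ (mulrC (2 / rho) (rho / 2))); set u := (2 / rho) ^+ m; ring.
rewrite mulVf ?pnatr_eq0// mulr1.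
have -> : 2 / rho * (rho / 2) = 1 by field; rewrite gt_eqF.
by rewrite expr1n mulr1.
Qed.

Lemma cesaro_powR_le : exists2 C : R, 0 <= C & forall F M n x,
  bit_martingale F -> (2 ^ M < n)%N -> (n <= 2 ^ M.+1)%N ->
  (`|(b n)^-1 * mean M.+1 (fun t => F M.+1 t * weighted_kernel a n (dyadic_add x t))|
     / ln n%:R `^ (1 + alpha)) `^ p <=
  C * \sum_(m < M.+1) cesaro_majorant F m x.
Proof.
have [C C0 CP] := mean_cesaro_kernel_le alpha_gt0 alpha_lt1.
have p0 := p_gt0 alpha_gt0; have p1 := p_le1 alpha_gt0.
have ln2 : 0 < ln 2 :> R by rewrite ln_gt0// ltr1n.
have r0 : 0 < rho by rewrite powR_gt0.
exists ((2 * C) `^ p * (2 / ln 2)).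
  by rewrite mulr_ge0 ?powR_ge0// divr_ge0// ltW.
move=> F M n x FM Mn nM.
have n1 : (1 < n)%N by apply: leq_ltn_trans Mn; rewrite expn_gt0.
have n0 : 0 < n%:R :> R by rewrite ltr0n ltnW.
(* n > 2^M only gives M ln 2; the extra ln 2, needed already for M = 0, is covered by n >= 2. *)
have lnn : M.+1%:R * ln 2 <= 2 * ln n%:R :> R.
  have h1 : M%:R * ln 2 <= ln n%:R :> R.
    rewrite mulr_natl -lnXn// ler_ln ?posrE ?exprn_gt0//.
    by rewrite -natrX ler_nat ltnW.
  have h2 : ln 2 <= ln n%:R :> R by rewrite ler_ln ?posrE// ler_nat.
  by rewrite -natr1 mulrDl mul1r; lra.
have ln0 : 0 < ln n%:R :> R by rewrite ln_gt0// ltr1n.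
have b0 : 0 < b n by exact: cesaro_number_gt0.
have f0 m t : 0 <= new_height F m t * majorant alpha m (dyadic_add x t).
  by rewrite mulr_ge0 ?new_height_ge0 ?majorant_ge0.
have h1 : `|(b n)^-1 * mean M.+1 (fun t => F M.+1 t * weighted_kernel a n (dyadic_add x t))| <=
   2 * C * \sum_(m < M.+1) mean m (fun t => new_height F m t * majorant alpha m (dyadic_add x t)).
  rewrite normrM ger0_norm ?invr_ge0 ?(ltW b0)//.
  apply: (@le_trans _ _ ((b n)^-1 * mean M.+1 (fun t => 2 * \sum_(m < M.+1)
      (new_height F m t * `|weighted_kernel a n (dyadic_add x t)|)))).
    rewrite ler_wpM2l ?invr_ge0 ?(ltW b0)//.
    apply: (le_trans (ler_norm_mean _ _)); apply: le_mean => t.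
    rewrite normrM -mulr_suml mulrA ler_wpM2r//.
    exact: norm_le_sum_new_height.
  rewrite meanZ mean_sum mulrCA -mulrA ler_wpM2l// !mulr_sumr.
  apply: ler_sum => m _; apply: CP => //; first exact: level_new_height.
    by move=> t; exact: new_height_ge0.
  by rewrite -ltnS.
rewrite [leLHS]powRM ?invr_ge0 ?powR_ge0// powRV ?powR_ge0//.
(* (1 + alpha) p = 1: under the p-th power the weight becomes a plain logarithm, which absorbs each
   [m.+1] with m <= M. *)
rewrite powR_1Dalpha_p ?(ltW ln0)//.
have X0 m : 0 <= mean m (fun t => new_height F m t * majorant alpha m (dyadic_add x t)).
  exact: mean_ge0.
apply: (@le_trans _ _ ((2 * C) `^ p * (\sum_(m < M.+1) (2 / rho) ^+ m *
    mean m (fun t => (new_height F m t * majorant alpha m (dyadic_add x t)) `^ p)) /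
    ln n%:R)).
  rewrite ler_wpM2r ?invr_ge0 ?(ltW ln0)//.
  apply: (le_trans (ler_powR2 (ltW p0) (normr_ge0 _) h1)).
  rewrite powRM ?mulr_ge0 ?sumr_ge0// ler_wpM2l ?powR_ge0//.
  apply: (le_trans (powR_sum_le _ _ p0 p1 _)) => [m|]; first exact: X0.
  by apply: ler_sum => m _; exact: mean_powR_le.
rewrite -!mulrA ler_wpM2l ?powR_ge0// mulr_suml !mulr_sumr; apply: ler_sum => m _.
rewrite /cesaro_majorant.
set Y := mean m _.
have Y0 : 0 <= Y by apply: mean_ge0 => t; exact: powR_ge0.
have u0 : 0 <= (2 / rho) ^+ m by rewrite exprn_ge0// divr_ge0// ltW.
set u := (2 / rho) ^+ m in u0 *.
rewrite [leRHS](_ : _ = 2 / ln 2 * m.+1%:R^-1 * (u * Y)); last by ring.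
rewrite [leLHS](_ : _ = (ln n%:R)^-1 * (u * Y)); last by ring.
rewrite ler_wpM2r ?mulr_ge0//.
have mM : m.+1%:R <= M.+1%:R :> R by rewrite ler_nat.
have m0 : 0 < m.+1%:R :> R by rewrite ltr0n.
set N : R := m.+1%:R in mM m0 *.
have -> : 2 / ln 2 * N^-1 = 2 / (N * ln 2) by field; rewrite !gt_eqF.
rewrite ler_pdivlMr ?mulr_gt0// mulrC ler_pdivrMr//.
by apply: le_trans lnn; rewrite ler_wpM2r// ltW.
Qed.

End pointwise_bound.

(** * Integrals of functions of finitely many bits *)

Lemma level_preimage {T : Type} m (f : dyadic_group -> T) (Y : set T) :
  level m f -> level m (f @^-1` Y).
Proof. by move=> fm x y xy; rewrite /preimage/= (fm _ _ xy). Qed.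

Lemma level_dyadic_itv m x : level m (dyadic_itv m x).
Proof.
by move=> y z yz; apply/propext; split => h k km; [rewrite -yz|rewrite yz] => //; exact: h.
Qed.

Lemma level_indic {R : realType} m (A : set dyadic_group) :
  level m A -> level m (\1_A : dyadic_group -> R).
Proof.
move=> Am x y /Am e; rewrite !indicE; congr ((nat_of_bool _)%:R).
by apply/idP/idP; rewrite !inE e.
Qed.

Lemma level_setE m (A : set dyadic_group) : level m A ->
  A = \bigcup_(s in [set s | size s = m /\ A (nth false s)]) bits_itv s.
Proof.
move=> Am; apply/seteqP; split => [x Ax|x [s [sm As]]].
  exists (mkseq x m); last by rewrite bits_itvE.
  rewrite /= size_mkseq; split => //.
  rewrite (Am (nth false (mkseq x m)) x)// => k km.
  by rewrite nth_mkseq.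
by rewrite /bits_itv sm => sx; rewrite (Am x (nth false s)).
Qed.

Lemma measurable_level_set m (A : set dyadic_group) : level m A -> measurable A.
Proof.
move=> Am; rewrite (level_setE Am) bigcup_mkcond.
apply: countable_bigcupT_measurable; first exact: countableP.
by move=> s; case: ifP => _ //; exact: measurable_dyadic_itv.
Qed.

Lemma measurable_level {d} {T : measurableType d} m (f : dyadic_group -> T) :
  level m f -> measurable_fun setT f.
Proof.
by move=> fm _ Y _; rewrite setTI; exact: (measurable_level_set (level_preimage Y fm)).
Qed.

(** The sets of level [m] form a sigma-algebra, and each is a countable union of intervals of rank
    [m]. *)
Lemma sigma_range_dyadic_itv m (A : set dyadic_group) :
  <<s range (dyadic_itv m) >> A <-> level m A.
Proof.
split; last first.
  move=> Am; rewrite (level_setE Am) bigcup_mkcond.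
  apply: (@countable_bigcupT_measurable _
    (g_sigma_algebraType (range (dyadic_itv m)))); first exact: countableP.
  move=> s; case: ifPn => [|_]; last exact: measurable0.
  rewrite inE => -[sm _]; apply: sub_sigma_algebra.
  by exists (nth false s) => //; rewrite /bits_itv sm.
apply: smallest_sub A; last first.
  by move=> _ [x _ <-]; exact: level_dyadic_itv.
split => //.
- by move=> A Am x y xy; rewrite !setTD /setC/= (Am _ _ xy).
- move=> A Am x y xy; apply/propext; split=> -[n _ h]; exists n => //.
    by rewrite -(Am n _ _ xy).
  by rewrite (Am n _ _ xy).
Qed.

Lemma measurable_range_dyadic_itv (R : realType) m (f : dyadic_group -> R) :
  measurable_fun setT (f : g_sigma_algebraType (range (dyadic_itv m)) -> R) <->
  level m f.
Proof.
split => [mf|fm].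
  have Am c : level m (f @^-1` [set c]).
    apply/sigma_range_dyadic_itv; rewrite -[X in _ X]setTI.
    exact: (mf measurableT [set c] (measurable_set1 c)).
  move=> x y xy; have := Am (f x) _ _ xy.
  by rewrite /preimage/= => /esym; rewrite propeqE => -[_ /(_ erefl)].
move=> _ Y _; rewrite setTI; apply/sigma_range_dyadic_itv.
exact: (level_preimage Y fm).
Qed.

Section integral_mean.
Context {R : realType}.
Local Notation mu := (haar R).
Implicit Types f : dyadic_group -> R.

Lemma dirichlet_indic m x t :
  dirichlet (2 ^ m) (dyadic_add x t) = 2 ^+ m * \1_(dyadic_itv m x) t :> R.
Proof.
rewrite indicE; have [|] := boolP (t \in dyadic_itv m x); rewrite ?inE ?notin_setE.
  move=> xt; rewrite (@dirichlet_small _ m) ?natrX ?mulr1// => k km.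
  by rewrite /dyadic_add xt// addbb.
rewrite mulr0 /dyadic_itv/= => /existsNP[k /not_implyP[km /eqP tx]].
apply: (@dirichlet_pow2_eq0 _ m k) => //; rewrite /dyadic_add.
by move: tx; case: (t k); case: (x k).
Qed.

Lemma mean_indic m f x : level m f ->
  mean m (fun t => f t * \1_(dyadic_itv m x) t) = f x / 2 ^+ m.
Proof.
move=> fm; apply: (mulIf (_ : 2 ^+ m != 0)); first by rewrite expf_neq0.
rewrite divfK ?expf_neq0// -(mean_mul_dirichlet x fm) mulrC -meanZ.
by apply: eq_mean => t; rewrite dirichlet_indic; ring.
Qed.

Lemma integral_mean_comm m (h : dyadic_group -> dyadic_group -> R) c :
  (forall t, mu.-integrable setT (EFin \o h t) /\ \int[mu]_x (h t x)%:E = (c t)%:E)%E ->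
  mu.-integrable setT (EFin \o (fun x => mean m (fun t => h t x))) /\
  (\int[mu]_x (mean m (fun t => h t x))%:E = (mean m c)%:E)%E.
Proof.
elim: m h c => [|m IH] h c hc; first exact: hc.
have [i0 e0] := IH (h \o set_bit m false) (c \o set_bit m false) (fun t => hc _).
have [i1 e1] := IH (h \o set_bit m true) (c \o set_bit m true) (fun t => hc _).
have E x : (mean m.+1 (fun t => h t x))%:E = (2^-1%:E * ((mean m (fun t => (h \o set_bit m false) t x))%:E +
    (mean m (fun t => (h \o set_bit m true) t x))%:E))%E.
  by rewrite -EFinD -EFinM mulrC.
have iD := integrableD measurableT i0 i1.
split.
  apply: eq_integrable (integrableZl measurableT 2^-1 iD) => // x _.
  by rewrite /= E.
under eq_integral do rewrite E.
rewrite integralZl// integralD//= e0 e1.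
by rewrite -EFinD -EFinM mulrC.
Qed.

(** By the reproducing kernel, [f] is the average over [t] of f(t) 2^m times the indicator of the
    interval of [t], so only the measures of intervals are needed. *)
Lemma level_integral m f : level m f ->
  mu.-integrable setT (EFin \o f) /\ (\int[mu]_x (f x)%:E = (mean m f)%:E)%E.
Proof.
move=> fm.
pose h t x := 2 ^+ m * f t * \1_(dyadic_itv m t) x : R.
have hE x : mean m (fun t => h t x) = f x.
  rewrite -(mean_mul_dirichlet x fm); apply: eq_mean => t.
  by rewrite dyadic_addC dirichlet_indic /h; ring.
have hf : (fun x => mean m (fun t => h t x)) = f by apply/funext.
suff : forall t, mu.-integrable setT (EFin \o h t) /\
    (\int[mu]_x (h t x)%:E = (f t)%:E)%E.
  move=> H; have [i e] := @integral_mean_comm m h f H; split; first by rewrite -hf.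
  by rewrite -e; apply: eq_integral => x _; rewrite hE.
move=> t; have ii := integrable_indic mu (measurable_dyadic_itv m t).
split; first exact: (integrableZl measurableT (2 ^+ m * f t) ii).
rewrite (@integralZl _ _ _ _ _ measurableT _ ii (2 ^+ m * f t)) integral_indic//; last first.
  exact: measurable_dyadic_itv.
rewrite setIT [X in (_ * X)%E](_ : _ = ((2^-1) ^+ m)%:E); last exact: haar_dyadic_itv.
rewrite -EFinM; congr EFin.
by rewrite mulrAC -exprMn divff// expr1n mul1r.
Qed.

Lemma integral_level m f : level m f -> (\int[mu]_x (f x)%:E = (mean m f)%:E)%E.
Proof. by move=> /level_integral[]. Qed.

Lemma integral_level_set m n f (A : set dyadic_group) : level m f -> level n A ->
  (n <= m)%N ->
  (\int[mu]_(x in A) (f x)%:E = (mean m (fun x => f x * \1_A x))%:E)%E.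
Proof.
move=> fm An nm; rewrite integral_mkcond -(@integral_level m).
  apply: eq_integral => x _; rewrite /patch indicE.
  by case: ifP => _; rewrite ?mulr1 ?mulr0.
apply: (level_comp2 *%R fm); exact: (level_indic (levelW nm An)).
Qed.

(** The conditional expectation is tested on the single interval of rank [n] around [x], where [F n]
    is constant and [F n.+1] takes two values. *)
Lemma dyadic_martingale_bit F : dyadic_martingale F -> bit_martingale (R := R) F.
Proof.
move=> [_ mF cF]; have lF n : level n (F n) by apply/measurable_range_dyadic_itv; exact: mF.
split => // n x.
have Ax := @level_dyadic_itv n x.
have [_ _ /(_ (dyadic_itv n x))] := cF n n.+1 (leqnSn n).
move=> /(_ (iffRL (sigma_range_dyadic_itv _ _) Ax)).
rewrite (integral_level_set (lF n) Ax)// (integral_level_set (lF n.+1) Ax)// => -[].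
rewrite mean_indic//= => h.
have n2 : 2 ^+ n != 0 :> R by rewrite expf_neq0.
apply: (mulIf (invr_neq0 n2)); rewrite h.
have H b : mean n ((fun t => F n.+1 t * \1_(dyadic_itv n x) t) \o set_bit n b) =
    F n.+1 (set_bit n b x) / 2 ^+ n.
  rewrite -(@mean_indic n (F n.+1 \o set_bit n b)); last exact: level_comp_set_bit.
  apply: eq_mean => t /=; congr (_ * _); apply: (level_indic Ax) => k kn.
  by rewrite /set_bit ltn_eqF.
by rewrite !H; field.
Qed.

End integral_mean.

(** * Fourier coefficients and Cesaro means as finite averages *)

Section fourier.
Context {R : realType}.
Local Notation mu := (haar R).
Variable F : nat -> dyadic_group -> R.
Hypothesis FM : bit_martingale F.

Lemma mean_bit_martingale m n (g : dyadic_group -> R) : level m g -> (m <= n)%N ->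
  mean n (fun t => F n t * g t) = mean m (fun t => F m t * g t).
Proof.
move=> gm; elim: n => [|n IH]; first by rewrite leqn0 => /eqP ->.
rewrite leq_eqVlt ltnS => /predU1P[->//|mn]; rewrite -IH//.
have H b : (fun t => F n.+1 t * g t) \o set_bit n b =
    (fun t => F n.+1 (set_bit n b t) * g t).
  by apply/funext => t /=; rewrite -[g (set_bit _ _ _)]/((g \o _) t) (level_set_bit b gm mn).
rewrite /= !H -meanD mulrC -meanZ; apply: eq_mean => t.
by rewrite (FM.2 n t); field.
Qed.

(** The sequence under the limit is constant from [N] on. *)
Lemma fourier_coefE N k : (k < 2 ^ N)%N ->
  fourier_coef F k = mean N (fun t => F N t * walsh k t).
Proof.
move=> kN; have wk : level N (@walsh R k) by exact: level_walsh.
apply: norm_lim_near_cst; exists N => // n /= Nn.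
rewrite /Rintegral (@integral_level _ n)/=; first exact: mean_bit_martingale.
by apply: (level_comp2 *%R (FM.1 n)); exact: levelW wk.
Qed.

Lemma walsh_sumE N k x : (k <= 2 ^ N)%N ->
  walsh_sum k F x = mean N (fun t => F N t * dirichlet k (dyadic_add x t)).
Proof.
move=> kN; rewrite /walsh_sum.
under [RHS]eq_mean do rewrite mulr_sumr.
rewrite mean_sum; apply: eq_bigr => i _.
rewrite (@fourier_coefE N); last exact: leq_trans (ltn_ord i) kN.
rewrite mulrC -meanZ; apply: eq_mean => t.
by rewrite walsh_dyadic_add; ring.
Qed.

Lemma cesaro_mean_rev alpha n x :
  cesaro_mean alpha n F x = (cesaro_number alpha n)^-1 *
    \sum_(k < n) cesaro_number (alpha - 1) k * walsh_sum (n - k) F x.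
Proof.
rewrite /cesaro_mean; congr (_ * _).
rewrite big_add1 big_mkord (reindex_inj rev_ord_inj)/=.
by apply: eq_bigr => k _; rewrite subnSK// subKn ?(ltnW (ltn_ord k)).
Qed.

Lemma cesaro_meanE alpha N n x : (n <= 2 ^ N)%N ->
  cesaro_mean alpha n F x = (cesaro_number alpha n)^-1 *
    mean N (fun t => F N t *
      weighted_kernel (cesaro_number (alpha - 1)) n (dyadic_add x t)).
Proof.
move=> nN; rewrite cesaro_mean_rev; congr (_ * _).
under [RHS]eq_mean do rewrite mulr_sumr.
rewrite mean_sum; apply: eq_bigr => k _.
rewrite (@walsh_sumE N) ?(leq_trans (leq_subr _ _) nN)//.
by rewrite -meanZ; apply: eq_mean => t; ring.
Qed.

End fourier.

Lemma level_cesaro_mean {R : realType} alpha n (F : nat -> dyadic_group -> R) :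
  level n (cesaro_mean alpha n F).
Proof.
apply: (level_comp ( *%R _)); rewrite /walsh_sum.
(* The bound [k <= n] is moved into the predicate of the sum, the only place where [level_sum] can
   see it. *)
rewrite (_ : (fun x => _) = (fun x => \sum_(1 <= k < n.+1 | (k <= n)%N)
   cesaro_number (alpha - 1) (n - k) * walsh_sum k F x)); last first.
  apply/funext => x; rewrite big_nat_cond [RHS]big_nat_cond.
  by apply: eq_bigl => k; rewrite andbT ltnS -andbA andbb.
apply: level_sum => k kn; apply: (level_comp ( *%R _)).
apply: level_sum => i _; apply: (level_comp ( *%R _)); apply: level_walsh.
by rewrite (leq_trans (ltn_ord i))// (leq_trans kn)// ltnW// ltn_expl.
Qed.

Section maximal_function.
Context {R : realType}.
Local Notation mu := (haar R).
Local Open Scope ereal_scope.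

Lemma maximal_functionE (F : nat -> dyadic_group -> R) x :
  maximal_function F x = esups (fun n => `|F n x|%:E) 0%N.
Proof.
rewrite /maximal_function /esups /sdrop; congr ereal_sup.
by apply/seteqP; split => _ [n _ <-]; exists n.
Qed.

Lemma measurable_maximal_function F :
  bit_martingale (R := R) F ->
  measurable_fun setT (maximal_function F : dyadic_group -> \bar R).
Proof.
move=> FM; rewrite (_ : maximal_function F = fun x => esups (fun n => `|F n x|%:E) 0%N).
  apply: measurable_fun_esups => n.
  exact: (measurable_level (level_comp (fun u => `|u|%:E) (FM.1 n))).
by apply/funext => x; exact: maximal_functionE.
Qed.

Lemma measurable_weighted_maximal alpha F :
  measurable_fun setT (@weighted_maximal R alpha F : dyadic_group -> \bar R).
Proof.
apply: (measurable_fun_esups (f := fun n x =>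
  (`|cesaro_mean alpha n F x| / ln n%:R `^ (1 + alpha))%:E)) => n.
exact: (measurable_level (level_comp
  (fun u : R => (`|u| / ln n%:R `^ (1 + alpha))%:E) (@level_cesaro_mean R alpha n F))).
Qed.

Lemma maximal_function_ge0 F x : 0 <= maximal_function (R := R) F x.
Proof.
apply: le_trans (_ : 0 <= `|F 0%N x|%:E) _; first by rewrite lee_fin.
by apply: ereal_sup_ubound; exists 0%N.
Qed.

Lemma sum_new_height_le_maximal p (F : nat -> dyadic_group -> R) x : (0 < p)%R ->
  bit_martingale F ->
  \sum_(m <oo) ((1 - (2 `^ p)^-1) * new_height F m x `^ p)%:E <=
  (3 `^ p)%:E * maximal_function F x `^ p.
Proof.
move=> p0 FM; have p3 : (0 < 3 `^ p :> R)%R by rewrite powR_gt0.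
have K0 : (0 <= 1 - (2 `^ p)^-1 :> R)%R.
  rewrite subr_ge0 invf_le1 ?powR_gt0//.
  by have := @ler_powR R 2 (ler1n R 2) _ _ (ltW p0); rewrite powRr0.
have H n : `|F n x|%:E <= maximal_function F x by apply: ereal_sup_ubound; exists n.
have F0 := maximal_function_ge0 F x.
case E : (maximal_function F x) H F0 => [c||] H F0 //; last first.
  by rewrite poweRyr ?gt_eqF// gt0_muley ?lte_fin// leey.
apply: lime_le.
  apply: is_cvg_nneseries => n _ _.
  by rewrite lee_fin mulr_ge0// powR_ge0.
apply: nearW => m; rewrite big_mkord sumEFin poweR_EFin -EFinM lee_fin.
case: m => [|m]; first by rewrite big_ord0 mulr_ge0// powR_ge0.
rewrite -mulr_sumr (le_trans (sum_new_height_powR F m x p0))//.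
have c0 : (0 <= c)%R by rewrite -lee_fin.
rewrite -powRM//; apply: ler_powR2; rewrite ?(ltW p0) ?height_ge0//.
by apply: height_le => n; rewrite -lee_fin.
Qed.

End maximal_function.

Lemma pow2_bracket n : (1 < n)%N -> exists2 M, (2 ^ M < n)%N & (n <= 2 ^ M.+1)%N.
Proof.
case: n => // n n0; have /andP[h1 h2] := trunc_log_bounds (erefl : (1 < 2)%N) n0.
by exists (trunc_log 2 n).
Qed.

(** The power is not moved inside the supremum: [T] raised to 1/p bounds every element of [S], hence
    its supremum. *)
Lemma ereal_sup_poweR_le {R : realType} (p : R) (S : set \bar R) (T : \bar R) :
  0 < p -> S !=set0 ->
  (forall y, S y -> exists r, [/\ y = r%:E, 0 <= r & ((r `^ p)%:E <= T)%E]) ->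
  (ereal_sup S `^ p <= T)%E.
Proof.
move=> p0 [y0 Sy0] HS.
have [r0 [y0E r00 r0T]] := HS _ Sy0.
have T0 : (0 <= T)%E by apply: le_trans r0T; rewrite lee_fin powR_ge0.
have ST : (ereal_sup S <= T `^ p^-1)%E.
  apply: ge_ereal_sup => y /HS[r [-> r0' rT]].
  have -> : r%:E = ((r `^ p)%:E `^ p^-1)%E.
    by rewrite poweR_EFin -powRrM mulfV ?gt_eqF// powRr1.
  apply: gt0_ler_poweR => //; rewrite ?invr_ge0 ?(ltW p0)//.
  - by rewrite in_itv/= leey andbT lee_fin powR_ge0.
  - by rewrite in_itv/= leey andbT.
have S0 : (0 <= ereal_sup S)%E.
  apply: (@le_trans _ _ y0); first by rewrite y0E lee_fin.
  exact: ereal_sup_ubound.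
have -> : T = ((T `^ p^-1) `^ p)%E.
  by rewrite -poweRrM mulVf ?gt_eqF// poweRe1.
apply: gt0_ler_poweR => //; rewrite ?(ltW p0)//.
- by rewrite in_itv/= leey andbT.
- by rewrite in_itv/= leey andbT poweR_ge0.
Qed.

(** * Integration of the pointwise bound *)

Section maximal_bound.
Context {R : realType}.
Variable alpha : R.
Hypothesis alpha_gt0 : 0 < alpha.
Hypothesis alpha_lt1 : alpha < 1.
Local Notation mu := (haar R).
Local Notation p := (1 / (1 + alpha)).

Lemma integral_weighted_maximal : exists2 C : R, 0 <= C & forall F,
  dyadic_martingale F ->
  (\int[mu]_x (weighted_maximal alpha F x `^ p) <=
    C%:E * \int[mu]_x (maximal_function F x `^ p))%E.
Proof.
have p0 := p_gt0 alpha_gt0.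
have [C1 C10 C1P] := cesaro_powR_le alpha_gt0 alpha_lt1.
have [C2 C20 C2P] := mean_cesaro_majorant alpha_gt0.
pose K : R := 1 - (2 `^ p)^-1.
have K0 : 0 < K.
  by rewrite subr_gt0 invf_lt1 ?powR_gt0// rho_gt1.
exists (C1 * C2 / K * 3 `^ p).
  by rewrite !mulr_ge0 ?powR_ge0// invr_ge0 ltW.
move=> F dF; have FM := dyadic_martingale_bit dF.
have g0 m x : 0 <= C1 * cesaro_majorant alpha F m x.
  by rewrite mulr_ge0// cesaro_majorant_ge0.
have mM : measurable_fun setT (fun x => (maximal_function F x `^ p)%E).
  by apply: (measurableT_comp (measurable_poweR p)); exact: measurable_maximal_function.
have lg m : level m (fun x => C1 * cesaro_majorant alpha F m x).
  by apply: (level_comp ( *%R C1)); exact: level_cesaro_majorant.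
have lh m : level m (fun x => K * new_height F m x `^ p).
  by apply: (level_comp (fun u => K * u `^ p)); exact: level_new_height.
have h0 m x : 0 <= K * new_height F m x `^ p.
  by rewrite mulr_ge0 ?powR_ge0// ltW.
have mg m : measurable_fun setT (fun x => (C1 * cesaro_majorant alpha F m x)%:E).
  exact: (measurable_level (level_comp EFin (lg m))).
have mh m : measurable_fun setT (fun x => (K * new_height F m x `^ p)%:E).
  exact: (measurable_level (level_comp EFin (lh m))).
(* The series no longer depends on [n], so it dominates the supremum. It is compared level by level
   with that of the heights, whose sum is bounded pointwise by the maximal function. *)
apply: (@le_trans _ _ (\int[mu]_x (\sum_(m <oo) (C1 * cesaro_majorant alpha F m x)%:E))%E).
  apply: ge0_le_integral => //.
  - by move=> x _; exact: poweR_ge0.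
  - by apply: (measurableT_comp (measurable_poweR p)); exact: measurable_weighted_maximal.
  - by apply: (ge0_emeasurable_sum (P := xpredT)) => [m x _ _|m _]; [rewrite lee_fin|].
  move=> x _; apply: ereal_sup_poweR_le => //.
    by eexists; exists 2%N; [|reflexivity].
  move=> _ [n n2 <-]; have [M Mn nM] := pow2_bracket n2.
  eexists; split; [by []|by apply: divr_ge0 => //; exact: powR_ge0|].
  apply: (@le_trans _ _ (\sum_(0 <= m < M.+1) (C1 * cesaro_majorant alpha F m x)%:E)%E).
    rewrite sumEFin lee_fin big_mkord -mulr_sumr.
    by rewrite (cesaro_meanE FM _ _ nM); exact: C1P.
  by apply: nneseries_lim_ge => m _ _; rewrite lee_fin.
rewrite integral_nneseries//; last by move=> m x _; rewrite lee_fin.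
apply: (@le_trans _ _ ((C1 * C2 / K)%:E *
    \int[mu]_x (\sum_(m <oo) (K * new_height F m x `^ p)%:E))%E).
  rewrite integral_nneseries//; last by move=> m x _; rewrite lee_fin.
  rewrite -nneseriesZl//; last first.
    by move=> m _; apply: integral_ge0 => x _; rewrite lee_fin.
  apply: lee_nneseries => m.
    by move=> _ _; apply: integral_ge0 => x _; rewrite lee_fin.
  move=> _; rewrite (integral_level (lg m)) (integral_level (lh m)) -EFinM lee_fin.
  rewrite meanZ meanZ mulrA divfK ?gt_eqF// -mulrA ler_wpM2l//.
  exact: C2P.
rewrite [in leRHS](EFinM (C1 * C2 / K)) -[leRHS]muleA; apply: lee_wpmul2l.
  by rewrite lee_fin mulr_ge0 ?mulr_ge0// invr_ge0 ltW.
rewrite -ge0_integralZl_EFin ?powR_ge0//; last by move=> x _; exact: poweR_ge0.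
apply: ge0_le_integral => //.
- by move=> x _; apply: nneseries_ge0 => m _ _; rewrite lee_fin.
- by apply: (ge0_emeasurable_sum (P := xpredT)) => [m x _ _|m _]; [rewrite lee_fin|].
- exact: measurable_funeM.
- by move=> x _; exact: sum_new_height_le_maximal.
Qed.

End maximal_bound.

(** * Lower bound for the kernels, and divergence *)

Lemma fejer_rev {R : realType} n x :
  \sum_(j < n) dirichlet (n - j) x = fejer n x :> R.
Proof.
elim: n => [|n IH]; first by rewrite big_ord0 fejer0.
by rewrite big_ord_recl/= subn0 fejerS -IH addrC.
Qed.

Section lacunary.
Context {R : realType}.
Variable alpha : R.
Hypothesis alpha_gt0 : 0 < alpha.
Hypothesis alpha_lt1 : alpha < 1.
Variable H : nat.
Hypothesis H_gt1 : (1 < H)%N.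

Local Notation p := (1 / (1 + alpha)).
Local Notation q := (2 `^ alpha).
Local Notation theta := (2 `^ alpha / 2).
Local Notation a := (cesaro_number (alpha - 1)).
Local Notation kernel := (weighted_kernel a).

Fixpoint lacunary (r : nat) : nat :=
  if r is r'.+1 then (2 ^ (r' * H) + lacunary r')%N else 0%N.

Lemma lacunary_le r : (lacunary r <= 2 ^ (r * H))%N.
Proof.
elim: r => // r IH; rewrite /= mulSn expnD.
have h2 : (2 ^ 1 <= 2 ^ H)%N by rewrite leq_exp2l// ltnW.
by apply: leq_trans (leq_mul h2 (leqnn _)); rewrite expn1 mul2n -addnn leq_add2l.
Qed.

Let a_ge0 n : 0 <= a n. Proof. exact/ltW/cesaro_number_sub1_gt0. Qed.

(* The bits of [x] at the ranks [0, ..., k * H + 1] are [0, ..., 0, 1, 1]. *)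
Definition shell_point k : dyadic_group := fun j => (k * H <= j)%N.
Definition shell k : set dyadic_group := dyadic_itv (k * H).+2 (shell_point k).

Lemma shell0 k x j : shell k x -> (j < k * H)%N -> x j = false.
Proof.
move=> /(_ j) xk jk; rewrite xk; last by apply: ltn_trans jk _.
by rewrite /shell_point leqNgt jk.
Qed.

Lemma shell1 k x : shell k x -> x (k * H)%N.
Proof. by move=> /(_ (k * H)%N) -> //; rewrite /shell_point leqnn. Qed.

Lemma shell2 k x : shell k x -> x (k * H).+1.
Proof. by move=> /(_ (k * H).+1) -> //; rewrite /shell_point leqnSn. Qed.

Lemma shell_inj k l x : shell k x -> shell l x -> k = l.
Proof.
have step i j : (i < j)%N -> shell i x -> shell j x -> False.
  move=> ij /shell1 xi /shell0 xj; have := xj (i * H)%N.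
  by rewrite xi ltn_mul2r (ltn_trans _ H_gt1)//= ij => /(_ erefl).
by move=> xk xl; case: (ltngtP k l) => // kl; [have := step _ _ kl xk xl|have := step _ _ kl xl xk].
Qed.

Lemma kernel_shell k x : shell k x ->
  alpha * theta / 4 * (2 * q) ^+ (k * H) <= kernel (lacunary k.+1) x.
Proof.
move=> xk; have t0 := theta_gt0 alpha; set A := (k * H)%N.
have x0 := shell0 xk; have x1 := shell1 xk.
have D1 i : (i <= 2 ^ A)%N -> dirichlet i x = i%:R :> R.
  by move=> iA; apply: (dirichlet_small iA) => j; exact: x0.
have nA := lacunary_le k; rewrite /= -/A; set n := lacunary k in nA *.
have rA : rademacher A x = -1 :> R by rewrite /rademacher x1 expr1.
rewrite /weighted_kernel addnC big_split_ord/=.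
apply: (@le_trans _ _ (0 + alpha / 2 * theta ^+ A.+1 * fejer (2 ^ A) x)).
  have fA : 2 ^+ A * 2 ^+ A <= 2 * fejer (2 ^ A) x :> R.
    by rewrite -[X in _ * X <= _]natrX -(D1 _ (leqnn _)) dirichlet_le_fejer.
  have -> : (2 * q) ^+ A = theta ^+ A * 2 ^+ A * 2 ^+ A.
    by rewrite -!exprMn; congr (_ ^+ A); field.
  rewrite add0r exprS.
  have -> : alpha * theta / 4 * (theta ^+ A * 2 ^+ A * 2 ^+ A) =
    alpha / 2 * (theta * theta ^+ A) * ((2 ^+ A * 2 ^+ A) / 2) by field.
  apply: ler_wpM2l; last by rewrite ler_pdivrMr// [leRHS]mulrC.
  by rewrite mulr_ge0 ?divr_ge0 ?(ltW alpha_gt0)// mulr_ge0 ?exprn_ge0// ltW.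
apply: lerD.
  apply: sumr_ge0 => j _; apply: mulr_ge0 => //.
  have -> : (n + 2 ^ A - j = 2 ^ A + (n - j))%N by have := ltn_ord j; lia.
  have jA : (n - j <= 2 ^ A)%N by rewrite (leq_trans (leq_subr _ _)).
  by rewrite dirichlet_addl// !D1// rA mulN1r subr_ge0 ler_nat.
rewrite -fejer_rev mulr_sumr; apply: ler_sum => j _.
rewrite subnDl D1 ?leq_subr// ler_wpM2r//.
apply: cesaro_number_sub1_ge => //.
by rewrite expnS mul2n -addnn leq_add// ltnW.
Qed.

(** The reason for two ones in [shell_point]: the first kills the later Dirichlet kernels, the
    second kills the factor 1 + r inherited by the Fejer kernels. *)
Lemma fejer_shell_eq0 k x j : shell k x -> ((k * H).+2 <= j)%N ->
  fejer (2 ^ j) x = 0 :> R.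
Proof.
move=> xk; elim: j => // j IH; rewrite leq_eqVlt => /predU1P[|jk].
  move=> [<-]; rewrite fejer_pow2S (dirichlet_pow2_eq0 _ (shell1 xk))//.
  by rewrite /rademacher (shell2 xk) expr1 subrr mul0r mulr0 addr0.
rewrite fejer_pow2S IH// (dirichlet_pow2_eq0 _ (shell1 xk))//.
  by rewrite !mulr0 addr0.
by rewrite ltnS in jk; exact: ltn_trans jk.
Qed.

Lemma fejer_le j x : fejer (2 ^ j) x <= 4 ^+ j :> R.
Proof.
have dle i : dirichlet (2 ^ i) x <= 2 ^+ i :> R.
  apply: le_trans (ler_norm _) _; apply: (le_trans (ler_norm_sum _ _ _)).
  rewrite (eq_bigr (fun=> 1)); last by move=> k _; rewrite norm_walsh.
  by rewrite sumr_const card_ord -natrX.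
elim: j => [|j IH]; first by rewrite expn0 fejer_1 expr0.
rewrite fejer_pow2S exprS.
have r2 : 1 + rademacher j x <= 2 :> R.
  by rewrite /rademacher; case: (x j); rewrite /= ?expr1 ?expr0; lra.
have h1 : (1 + rademacher j x) * fejer (2 ^ j) x <= 2 * 4 ^+ j :> R.
  by apply: ler_pM => //; [exact: rademacherD1_ge0|exact: fejer_pow2_ge0].
have h2 : 2 ^+ j * dirichlet (2 ^ j) x <= 4 ^+ j :> R.
  have -> : 4 = 2 * 2 :> R by rewrite -natrM.
  by rewrite exprMn ler_wpM2l// exprn_ge0.
have : 0 <= 4 ^+ j :> R by rewrite exprn_ge0.
lra.
Qed.

(** Only the ranks below [A.+2] survive on the shell. The weights there have index at least 2^B,
    hence size theta^B, and theta^B 4^A gains theta^H for each block between the shell and the new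
    digit. The constant is 32 = 2 * 4^2. *)
Lemma kernel_tail_shell k l x : shell k x ->
  `|kernel_tail a ((k + l).+2 * H) (lacunary (k + l).+2) x| <=
  32 * (theta ^+ H) ^+ l.+1 * (2 * q) ^+ (k * H).
Proof.
move=> xk; have t0 := theta_gt0 alpha.
have := norm_kernel_tail a_ge0 (cesaro_number_sub1_noninc alpha_gt0 alpha_lt1)
  ((k + l).+2 * H) (lacunary (k + l).+2) x.
move/le_trans; apply.
set A := (k * H)%N; set B := ((k + l).+1 * H)%N.
apply: (@le_trans _ _ (3 * \sum_(j < A.+2) (2 / theta * theta ^+ B.+1) * 4 ^+ j)).
  rewrite ler_wpM2l//.
  have AB : (A.+2 <= (k + l).+2 * H)%N.
    have h1 : (k * H + 1 * H <= (k + l).+2 * H)%N by rewrite -mulnDl leq_mul2r; lia.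
    by rewrite /A; lia.
  rewrite (big_ord_widen _ (fun j => 2 / theta * theta ^+ B.+1 * 4 ^+ j) AB).
  rewrite [leRHS]big_mkcond; apply: ler_sum => j _; case: ltnP => [jA|Aj].
    apply: ler_pM => //; [exact: fejer_pow2_ge0| |exact: fejer_le].
    apply: cesaro_number_sub1_le => //.
    by rewrite /= -/B; lia.
  by rewrite (fejer_shell_eq0 xk)// mulr0.
rewrite -mulr_sumr.
have geo n : 3 * \sum_(j < n) 4 ^+ j <= 4 ^+ n :> R.
  elim: n => [|n IH]; first by rewrite big_ord0 mulr0 expr0.
  by rewrite big_ord_recr/= exprS; lra.
rewrite mulrCA.
have c0 : 0 <= 2 / theta * theta ^+ B.+1.
  by rewrite mulr_ge0 ?divr_ge0 ?exprn_ge0// ltW.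
apply: (le_trans (ler_wpM2l c0 (geo A.+2))).
rewrite le_eqVlt; apply/orP; left; apply/eqP.
have -> : (2 * q) ^+ A = theta ^+ A * 4 ^+ A.
  by rewrite -exprMn; congr (_ ^+ A); field.
rewrite (exprS theta B) (mulrA (2 / theta)) divfK ?gt_eqF// -exprM (exprS 4 A.+1) (exprS 4 A).
have -> : B = (H * l.+1 + A)%N by rewrite /B /A; lia.
by rewrite exprD; ring.
Qed.

Lemma norm_kernel_lacunary k l x : shell k x -> theta ^+ H <= 2^-1 ->
  `|kernel (lacunary k.+2) x| - 64 * theta ^+ H * (2 * q) ^+ (k * H) <=
  `|kernel (lacunary (k + l).+2) x|.
Proof.
move=> xk; set eta := theta ^+ H => eta2.
have t0 := theta_gt0 alpha.
have e0 : 0 <= eta by rewrite exprn_ge0// ltW.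
set Q := (2 * q) ^+ _; have Q0 : 0 <= Q by rewrite exprn_ge0// mulr_ge0// powR_ge0.
(* The factor 1 - eta^l makes the induction close: the next loss 32 eta^(l+1) fits in the increase
   of the budget because eta <= 1/2. *)
suff : `|kernel (lacunary k.+2) x| - 64 * eta * (1 - eta ^+ l) * Q <=
    `|kernel (lacunary (k + l).+2) x|.
  apply: le_trans; rewrite lerD2l lerN2 ler_wpM2r//.
  by rewrite ler_piMr ?mulr_ge0// gerBl exprn_ge0.
elim: l => [|l IH]; first by rewrite addn0 expr0 subrr mulr0 mul0r subr0.
have tl := kernel_tail_shell l xk; rewrite -/eta -/Q in tl.
have step : `|kernel (lacunary (k + l).+2) x| - 32 * eta ^+ l.+1 * Q <=
    `|kernel (lacunary (k + l.+1).+2) x|.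
  have Hk : (k * H < (k + l).+2 * H)%N by rewrite ltn_mul2r (ltn_trans _ H_gt1)//=; lia.
  have := weighted_kernel_addl a x (lacunary_le (k + l).+2).
  rewrite (dirichlet_pow2_eq0 Hk (shell1 xk)) mulr0 sub0r addnS => ->.
  rewrite [X in _ <= `|X|]addrC; apply: le_trans (lerB_dist _ _).
  rewrite normrM norm_rademacher mul1r lerD2l lerN2 normrM norm_walsh mul1r.
  exact: tl.
apply: le_trans step.
have h : 64 * eta * (1 - eta ^+ l) * Q + 32 * eta ^+ l.+1 * Q <=
    64 * eta * (1 - eta ^+ l.+1) * Q.
  rewrite -mulrDl ler_wpM2r// exprS.
  have := mulr_ge0 e0 (exprn_ge0 l e0); set w := eta * eta ^+ l => w0.
  have : eta * w <= 2^-1 * w by rewrite ler_wpM2r.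
  have -> : 64 * eta * (1 - eta ^+ l) = 64 * eta - 64 * w by rewrite /w; ring.
  have -> : 64 * eta * (1 - w) = 64 * eta - 64 * (eta * w) by ring.
  lra.
by lra.
Qed.

(* The kernel at [lacunary k.+2] is the sum of two terms that do not depend on
   the bit [x (k.+1 * H)], one of which is multiplied by the sign of this bit:
   for one of the two signs they do not cancel each other. *)
Lemma kernel_flip k l x (e : dyadic_group) : shell k x -> theta ^+ H <= 2^-1 ->
  64 * theta ^+ H <= alpha * theta / 8 ->
  (forall j, e j = (j == k.+1 * H)%N) ->
  (alpha * theta / 4 * (2 * q) ^+ (k * H)) `^ p <=
  `|kernel (lacunary (k + l).+2) x| `^ p +
  `|kernel (lacunary (k + l).+2) (dyadic_add e x)| `^ p.
Proof.
move=> xk eta2 eta8 ee; set y := dyadic_add e x.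
have t0 := theta_gt0 alpha.
have p0 := p_gt0 alpha_gt0; have p1 := p_le1 alpha_gt0.
have kH : ((k * H).+2 <= k.+1 * H)%N by rewrite mulSn; lia.
have xy j : (j < k.+1 * H)%N -> y j = x j.
  by move=> jk; rewrite /y /dyadic_add ee ltn_eqF.
have yk : shell k y by move=> j jk; rewrite xy ?xk// (leq_trans jk).
have := norm_kernel_lacunary l xk eta2; have := norm_kernel_lacunary l yk eta2.
set Q := (2 * q) ^+ _; have Q0 : 0 <= Q by rewrite exprn_ge0// mulr_ge0// powR_ge0.
have h1 := kernel_shell xk; rewrite -/Q in h1.
have h2 : 2 * `|kernel (lacunary k.+1) x| <=
    `|kernel (lacunary k.+2) y| + `|kernel (lacunary k.+2) x|.
  have := weighted_kernel_addl a x (lacunary_le k.+1).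
  have := weighted_kernel_addl a y (lacunary_le k.+1).
  rewrite -[(2 ^ _ + lacunary k.+1)%N]/(lacunary k.+2).
  rewrite (level_kernel_tail a _ xy) (level_weighted_kernel a (lacunary_le k.+1) xy).
  rewrite (@level_walsh _ (k.+1 * H) _ _ _ _ xy); last by rewrite subn1 prednK// expn_gt0.
  rewrite (dirichlet_pow2_eq0 _ (shell1 xk)) ?(dirichlet_pow2_eq0 _ (shell1 yk));
    [|lia|lia].
  have -> : rademacher (k.+1 * H) y = - rademacher (k.+1 * H) x :> R.
    by rewrite /rademacher /y /dyadic_add ee eqxx; case: (x _); rewrite /= ?expr0 ?expr1 ?opprK.
  rewrite !mulr0 !sub0r.
  set u := walsh _ _ * _; set v := kernel (lacunary k.+1) x => -> ->.
  have := ler_normB (- u + rademacher (k.+1 * H) x * v) (- u + - rademacher (k.+1 * H) x * v).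
  rewrite (_ : _ - _ = 2 * (rademacher (k.+1 * H) x * v)); last by ring.
  by rewrite !normrM norm_rademacher mul1r (ger0_norm (ler0n _ _)) addrC.
move=> h3 h4; apply: (@le_trans _ _ ((`|kernel (lacunary (k + l).+2) x| +
    `|kernel (lacunary (k + l).+2) y|) `^ p)); last exact: powR_subadditive.
apply: ler_powR2; first exact: ltW.
  by rewrite !mulr_ge0 ?invr_ge0 ?powR_ge0// ltW.
have h5 : alpha * theta / 4 * Q <= `|kernel (lacunary k.+1) x|.
  exact: le_trans h1 (ler_norm _).
(* Let c = alpha theta Q / 4. The two kernels at [lacunary k.+2] have absolute values of sum at
   least 2 c, and each loses at most c / 2 to the later digits. *)
have h6 : 64 * theta ^+ H * Q <= alpha * theta / 8 * Q by rewrite ler_wpM2r.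
have e8 : alpha * theta / 8 * Q = 2^-1 * (alpha * theta / 4 * Q) by field.
rewrite e8 in h6; move: h2 h3 h4 h5 h6.
set z := 64 * _ * Q; set c := _ * Q; lra.
Qed.

(** The shell of rank [k] has measure 2^(-kH) / 4, and there the p-th power of the kernel has size
    2^(kH), since (2 q)^p = 2: all shells contribute equally. The 8 is this 4 times the 2 lost by
    averaging over the flipped bit. Shells stop at k < r because the bit of rank [k.+1 * H] must
    carry a digit of the index. *)
Lemma mean_kernel_lacunary r m : theta ^+ H <= 2^-1 ->
  64 * theta ^+ H <= alpha * theta / 8 -> (r.+1 * H <= m)%N ->
  (alpha * theta / 4) `^ p / 8 * r%:R <=
  mean m (fun x => `|kernel (lacunary r.+1) x| `^ p).
Proof.
move=> eta2 eta8 rm; have t0 := theta_gt0 alpha.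
have c0 : 0 <= alpha * theta / 4 by rewrite !mulr_ge0// ltW.
pose L x := `|kernel (lacunary r.+1) x| `^ p.
have L0 x : 0 <= L x by exact: powR_ge0.
have lL : level m L.
  apply: (level_comp (fun u => `|u| `^ p)); apply: level_weighted_kernel.
  by apply: (leq_trans (lacunary_le _)); rewrite leq_exp2l.
have lI k : (k < r)%N -> level m (\1_(shell k) : dyadic_group -> R).
  move=> kr; have km : ((k * H).+2 <= m)%N.
    apply: leq_trans rm; have : (k.+1 * H <= r.+1 * H)%N by rewrite leq_mul2r; lia.
    by rewrite mulSn; lia.
  exact: levelW km (level_indic (@level_dyadic_itv _ _)).
have disj x : \sum_(k < r) \1_(shell k) x <= 1 :> R.
  have [[k xk]|nx] := pselect (exists k : 'I_r, shell k x).
    rewrite (bigD1 k)//= big1 ?addr0; last first.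
      move=> l lk; rewrite indicE memNset// => xl.
      by move: lk; rewrite -val_eqE/= (shell_inj xl xk) eqxx.
    by rewrite indicE lern1; case: (_ \in _).
  rewrite big1// => k _; rewrite indicE memNset// => xk; apply: nx.
  by exists k.
apply: (@le_trans _ _ (\sum_(k < r) mean m (fun x => \1_(shell k) x * L x))); last first.
  rewrite -mean_sum; apply: le_mean => x.
  by rewrite -mulr_suml ler_piMl.
rewrite mulr_natr -[X in _ *+ X]card_ord -sumr_const; apply: ler_sum => k _.
pose e : dyadic_group := fun j => (j == k.+1 * H)%N.
have kr := ltn_ord k.
have kH : ((k * H).+2 <= k.+1 * H)%N by rewrite mulSn; lia.
have km : ((k * H).+2 <= m)%N.
  apply: leq_trans rm; apply: (leq_trans kH); rewrite leq_mul2r; lia.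
have ie x : \1_(shell k) (dyadic_add e x) = \1_(shell k) x :> R.
  apply: (level_indic (@level_dyadic_itv _ _)) => j jk.
  by rewrite /dyadic_add /e ltn_eqF//; exact: leq_trans kH.
have lIL : level m (fun x => \1_(shell k) x * L x).
  by apply: (level_comp2 *%R); [exact: lI|].
have h : mean m (fun x => \1_(shell k) x * (L x + L (dyadic_add e x))) =
    2 * mean m (fun x => \1_(shell k) x * L x).
  under eq_mean do rewrite mulrDr.
  rewrite meanD -[X in _ + X](_ : mean m (fun x => \1_(shell k) x * L x) = _).
    by ring.
  by rewrite -(mean_dyadic_add e lIL); apply: eq_mean => x; rewrite ie.
have i0 x : 0 <= \1_(shell k) x :> R by rewrite indicE.
have mI : mean m (\1_(shell k) : dyadic_group -> R) = (2 ^+ (k * H).+2)^-1.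
  rewrite (_ : \1_(shell k) = (fun x => (fun=> 1) x * \1_(shell k) x) :> (_ -> R)); last first.
    by apply/funext => x; rewrite mul1r.
  rewrite (@mean_level _ (k * H).+2)//.
    by rewrite mean_indic// div1r.
  by apply: (level_comp2 *%R) => //; exact: (level_indic (@level_dyadic_itv _ _)).
have : mean m (fun x => (alpha * theta / 4 * (2 * q) ^+ (k * H)) `^ p * \1_(shell k) x) <=
    2 * mean m (fun x => \1_(shell k) x * L x).
  rewrite -h; apply: le_mean => x; rewrite mulrC indicE.
  have [|] := boolP (x \in shell k); last by rewrite !mul0r.
  rewrite inE [leLHS]mul1r [leRHS]mul1r => xk.
  have [l rE] : exists l, (r = (k + l).+1)%N by exists (r - k.+1)%N; lia.
  by have := kernel_flip l xk eta2 eta8 (fun=> erefl); rewrite -[X in lacunary X.+1]rE.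
rewrite meanZ mI powRM// ?exprn_ge0 ?mulr_ge0 ?powR_ge0//.
rewrite powR_exprn ?mulr_ge0 ?powR_ge0//.
have -> : (2 * q) `^ p = 2.
  by rewrite powRM ?powR_ge0// (q_p alpha_gt0) mulrC divfK// gt_eqF// powR_gt0.
rewrite !exprS; set z := (alpha * theta / 4) `^ p.
have -> : z * 2 ^+ (k * H) * (2 * (2 * 2 ^+ (k * H)))^-1 = z / 4.
  by field; rewrite expf_neq0.
lra.
Qed.

End lacunary.

(** Take r + 1 = m %/ H; with at least four blocks, the remainder and the lost block cost at most a
    factor 2. *)
Lemma block_count H m : (0 < H)%N -> (4 * H <= m)%N ->
  exists2 r, (r.+1 * H <= m)%N & (m <= r * (2 * H))%N.
Proof.
move=> H0; rewrite -leq_divRL//; have := leq_trunc_div m H; have := ltn_ceil m H0.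
case: (m %/ H)%N => // d h1 h2 d3; exists d => //.
apply: (leq_trans (ltnW h1)); rewrite mulnA leq_mul2r; lia.
Qed.

Lemma kernel_lower_bound {R : realType} (alpha : R) : 0 < alpha -> alpha < 1 ->
  exists2 c : R, 0 < c & exists m0, forall m, (m0 <= m)%N ->
    exists2 n, (n <= 2 ^ m)%N &
      c * m%:R <= mean m (fun x =>
        `|weighted_kernel (cesaro_number (alpha - 1)) n x| `^ (1 / (1 + alpha))).
Proof.
move=> a0 a1; have t0 := theta_gt0 alpha; have t1 := theta_lt1 a1.
set theta := 2 `^ alpha / 2 in t0 t1.
have at0 : 0 < alpha * theta by rewrite mulr_gt0.
(* The two smallness conditions of [kernel_flip]. [H] depends on alpha alone, so the bound stays
   linear in [m]. *)
pose eps := Num.min 2^-1 (alpha * theta / 8 / 64).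
have eps0 : 0 < eps by rewrite lt_min invr_gt0 ltr0n !divr_gt0// ltr0n.
have [H H1 eta] : exists2 H, (1 < H)%N & theta ^+ H <= eps.
  have /cvgrPdist_lt /(_ _ eps0) [N _ /(_ (maxn N 2) (leq_maxl _ _))] :
      (fun n => theta ^+ n) @ \oo --> 0.
    by apply: cvg_expr; rewrite ger0_norm// ltW.
  rewrite /= sub0r normrN ger0_norm ?exprn_ge0 ?(ltW t0)// => h.
  by exists (maxn N 2); [rewrite leq_max orbT|exact: ltW].
have eta2 : theta ^+ H <= 2^-1 by apply: (le_trans eta); rewrite ge_min lexx.
have eta8 : 64 * theta ^+ H <= alpha * theta / 8.
  have : theta ^+ H <= alpha * theta / 8 / 64.
    by apply: (le_trans eta); rewrite ge_min lexx orbT.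
  by rewrite ler_pdivlMr// mulrC.
have H0 : 0 < H%:R :> R by rewrite ltr0n ltnW.
pose c := (alpha * theta / 4) `^ (1 / (1 + alpha)) / 8.
have c0 : 0 < c by rewrite divr_gt0// powR_gt0// divr_gt0.
exists (c / (2 * H%:R)); first by rewrite divr_gt0// mulr_gt0.
exists (4 * H)%N => m mH.
have [r mE1 mE2] := block_count (ltnW H1) mH.
exists (lacunary H r.+1).
  by apply: (leq_trans (lacunary_le H1 _)); rewrite leq_exp2l.
apply: le_trans (mean_kernel_lacunary a0 a1 H1 eta2 eta8 mE1).
rewrite -/c -mulrA ler_wpM2l ?(ltW c0)// mulrC ler_pdivrMr ?mulr_gt0//.
by rewrite -!natrM ler_nat.
Qed.

Lemma bit_martingale_dyadic {R : realType} (F : nat -> dyadic_group -> R) :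
  bit_martingale F -> dyadic_martingale F.
Proof.
move=> FM; have iF n : (haar R).-integrable setT (EFin \o F n).
  by have [] := level_integral (FM.1 n).
split => // [n|n m nm]; first exact/measurable_range_dyadic_itv/FM.1.
split => //; first exact/measurable_range_dyadic_itv/FM.1.
move=> A /sigma_range_dyadic_itv An.
rewrite (integral_level_set (FM.1 n) An (leqnn n)) (integral_level_set (FM.1 m) An nm).
by rewrite (mean_bit_martingale FM (level_indic An) nm).
Qed.

Lemma mean_rademacher {R : realType} m (v : dyadic_group -> R) : level m v ->
  mean m.+1 (fun t => rademacher m t * v t) = 0.
Proof.
move=> mv; rewrite (mean_split (fun b u => (-1) ^+ b * u) mv) !meanZ/=.
by rewrite expr0 expr1 mul1r mulN1r subrr mul0r.
Qed.

(** * Martingales built from dyadic Walsh blocks *)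

Section rademacher_martingale.
Context {R : realType}.
Variable gamma : nat -> R.
Hypothesis gamma_ge0 : forall m, 0 <= gamma m.

Definition rademacher_martingale (n : nat) (x : dyadic_group) : R :=
  \sum_(m < n) gamma m * (rademacher m x * dirichlet (2 ^ m) x).

Local Notation F := rademacher_martingale.
Local Notation V m := (\sum_(j < m) gamma j * 2 ^+ j).

Lemma rademacher_martingaleS n x :
  F n.+1 x = F n x + gamma n * (rademacher n x * dirichlet (2 ^ n) x).
Proof. by rewrite /F big_ord_recr. Qed.

Lemma rademacher_martingale_bit : bit_martingale F.
Proof.
have lF n : level n (F n).
  apply: level_sum => m _; apply: level_comp; apply: level_comp2.
    exact: level_rademacher.
  by apply: (levelW (ltnW (ltn_ord m))); exact: level_dirichlet.
split => // n x; rewrite !rademacher_martingaleS.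
have e (T : Type) (f : dyadic_group -> T) b : level n f -> f (set_bit n b x) = f x.
  by move=> fn; rewrite -[LHS]/((f \o _) x) (level_set_bit _ fn).
have ln : level n (@dirichlet R (2 ^ n)) by exact: level_dirichlet.
rewrite !(e _ _ _ (lF n)) !(e _ _ _ ln) /rademacher /set_bit eqxx/=.
by rewrite expr0 expr1; field.
Qed.

(** r_m D_(2^m) is the sum of the Walsh functions of orders from 2^m to 2^(m+1) - 1, so different
    terms occupy disjoint blocks and a partial sum cuts only one of them. *)
Lemma walsh_sum_rademacher_martingale m i x : (i <= 2 ^ m)%N ->
  walsh_sum (2 ^ m + i) F x = F m x + gamma m * (rademacher m x * dirichlet i x).
Proof.
move=> im; have FM := rademacher_martingale_bit.
have lD : level m (@dirichlet R (2 ^ m)) by exact: level_dirichlet.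
have lDi : level m (@dirichlet R i) by exact: level_dirichlet.
have lDx := level_dyadic_add x lD; have lDix := level_dyadic_add x lDi.
rewrite (@walsh_sumE _ _ FM m.+1); last by rewrite expnS mul2n -addnn leq_add2l.
(* The product is sorted by the parity of its degree in r_m(t): [u] is the even part, and the odd
   part has mean zero. *)
pose u t := F m t * dirichlet (2 ^ m) (dyadic_add x t) +
  gamma m * rademacher m x * (dirichlet i (dyadic_add x t) * dirichlet (2 ^ m) t).
pose v t := gamma m * (dirichlet (2 ^ m) t * dirichlet (2 ^ m) (dyadic_add x t)) +
  rademacher m x * (F m t * dirichlet i (dyadic_add x t)).
have lu : level m u.
  apply: (level_comp2 +%R); first exact: (level_comp2 *%R (FM.1 m) lDx).
  by apply: (level_comp ( *%R _)); exact: (level_comp2 *%R lDix lD).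
have lv : level m v.
  apply: (level_comp2 +%R); apply: (level_comp ( *%R _)).
    exact: (level_comp2 *%R lD lDx).
  exact: (level_comp2 *%R (FM.1 m) lDix).
transitivity (mean m.+1 (fun t => u t + rademacher m t * v t)).
  apply: eq_mean => t; rewrite rademacher_martingaleS dirichlet_addl//.
  rewrite rademacher_dyadic_add /u /v.
  have r2 := @rademacher_sqr R m t.
  transitivity (F m t * dirichlet (2 ^ m) (dyadic_add x t) +
    gamma m * rademacher m x * (dirichlet i (dyadic_add x t) * dirichlet (2 ^ m) t) *
      (rademacher m t * rademacher m t) +
    rademacher m t * (gamma m * (dirichlet (2 ^ m) t * dirichlet (2 ^ m) (dyadic_add x t)) +
     rademacher m x * (F m t * dirichlet i (dyadic_add x t)))); first by ring.
  by rewrite r2 mulr1.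
rewrite meanD mean_rademacher// addr0 (mean_level lu)// meanD meanZ.
rewrite (mean_mul_dirichlet _ (FM.1 m)); congr (_ + _).
(* The reproducing property is read at the zero sequence. *)
have := mean_mul_dirichlet (fun=> false) lDix.
have add0 t : dyadic_add (fun=> false) t = t by apply/funext => k.
under eq_mean do rewrite add0.
move=> ->; rewrite mulrA; congr (_ * dirichlet _ _).
by apply/funext => k; rewrite /dyadic_add addbF.
Qed.

Lemma walsh_sum_pow2_rademacher_martingale m x : walsh_sum (2 ^ m) F x = F m x.
Proof.
have := walsh_sum_rademacher_martingale x (leq0n (2 ^ m)).
by rewrite addn0 dirichlet0 !mulr0 addr0.
Qed.

Lemma norm_walsh_sum_rademacher_martingale m k x : (k <= 2 ^ m)%N ->
  `|walsh_sum k F x| <= V m.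
Proof.
elim: m k => [|m IH] k.
  rewrite expn0 big_ord0; case: k => [|[|//]] _.
    by rewrite /walsh_sum big_ord0 normr0.
  by rewrite -(expn0 2) walsh_sum_pow2_rademacher_martingale /F big_ord0 normr0.
have [km _|mk] := leqP k (2 ^ m).
  by rewrite big_ord_recr/= (le_trans (IH _ km))// lerDl mulr_ge0// exprn_ge0.
rewrite expnS mul2n -addnn -{1 2}(subnKC (ltnW mk)) leq_add2l => km.
rewrite walsh_sum_rademacher_martingale// big_ord_recr/=.
apply: (le_trans (ler_normD _ _)); apply: lerD.
  by have := IH _ (leqnn _); rewrite walsh_sum_pow2_rademacher_martingale.
rewrite !normrM norm_rademacher mul1r ger0_norm// ler_wpM2l//.
apply: (le_trans (ler_norm_sum _ _ _)).
rewrite (eq_bigr (fun=> 1)); last by move=> i _; rewrite norm_walsh.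
by rewrite sumr_const card_ord -natrX ler_nat.
Qed.

Section cesaro.
Variable alpha : R.
Hypothesis alpha_gt0 : 0 < alpha.
Hypothesis alpha_lt1 : alpha < 1.
Local Notation p := (1 / (1 + alpha)).
Local Notation q := (2 `^ alpha).
Local Notation a := (cesaro_number (alpha - 1)).
Local Notation b := (cesaro_number alpha).

Lemma cesaro_mean_rademacher_martingale m n x : (n <= 2 ^ m)%N ->
  gamma m / b (2 ^ m + n) * `|weighted_kernel a n x| <=
  `|cesaro_mean alpha (2 ^ m + n) F x| + V m.
Proof.
move=> nm; set N := (2 ^ m + n)%N.
have b0 : 0 < b N by exact: cesaro_number_gt0.
have a0 k : 0 <= a k by rewrite ltW// cesaro_number_sub1_gt0.
have V0 : 0 <= V m by rewrite sumr_ge0// => j _; rewrite mulr_ge0// exprn_ge0.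
(* [E] collects all that the earlier blocks produce, and the part of block [m] in the partial sums
   of order at most 2^m is zero. Its weights sum to at most [b N], so after division it stays below
   [V m]. *)
pose E := \sum_(k < n) a k * F m x + \sum_(k < 2 ^ m) a (n + k)%N * walsh_sum (2 ^ m - k) F x.
have cE : cesaro_mean alpha N F x = (b N)^-1 * E +
    gamma m / b N * (rademacher m x * weighted_kernel a n x).
  rewrite (cesaro_mean_rev F) /N addnC big_split_ord/=.
  have -> : \sum_(k < n) a k * walsh_sum (n + 2 ^ m - k) F x =
      \sum_(k < n) a k * F m x +
      gamma m * (rademacher m x * weighted_kernel a n x).
    rewrite /weighted_kernel !mulr_sumr -big_split; apply: eq_bigr => k _ /=.
    have -> : (n + 2 ^ m - k = 2 ^ m + (n - k))%N by have := ltn_ord k; lia.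
    rewrite walsh_sum_rademacher_martingale; last by rewrite (leq_trans (leq_subr _ _)).
    by ring.
  under [X in _ * (_ + X)]eq_bigr do rewrite subnDl.
  by rewrite /E; ring.
have FV : `|F m x| <= V m.
  rewrite -walsh_sum_pow2_rademacher_martingale.
  exact: norm_walsh_sum_rademacher_martingale.
have EV : `|E| <= b N * V m.
  apply: (@le_trans _ _ ((\sum_(k < n + 2 ^ m) a k) * V m)); last first.
    rewrite ler_wpM2r//.
    have -> : (n + 2 ^ m = N.-1.+1)%N by rewrite prednK /N ?addn_gt0 ?expn_gt0// addnC.
    by rewrite cesaro_number_sum// cesaro_number_nondec// leq_pred.
  rewrite big_split_ord/= mulrDl !mulr_suml.
  apply: (le_trans (ler_normD _ _)); apply: lerD; apply: (le_trans (ler_norm_sum _ _ _));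
    apply: ler_sum => k _; rewrite normrM (ger0_norm (a0 _)) ler_wpM2l//.
  by apply: norm_walsh_sum_rademacher_martingale; rewrite leq_subr.
have -> : gamma m / b N * `|weighted_kernel a n x| =
    `|gamma m / b N * (rademacher m x * weighted_kernel a n x)|.
  by rewrite !normrM norm_rademacher mul1r normfV (ger0_norm (gamma_ge0 m)) (gtr0_norm b0).
have -> : gamma m / b N * (rademacher m x * weighted_kernel a n x) =
    cesaro_mean alpha N F x - (b N)^-1 * E by rewrite cE addrAC subrr add0r.
apply: (le_trans (ler_normB _ _)); rewrite lerD2l normrM normfV (gtr0_norm b0).
by rewrite mulrC ler_pdivrMr// mulrC.
Qed.

Lemma mean_cesaro_rademacher_martingale m n : (n <= 2 ^ m)%N ->
  (gamma m / q ^+ m) `^ p / 2 *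
    mean m (fun x => `|weighted_kernel a n x| `^ p) <=
  mean (2 ^ m + n) (fun x => `|cesaro_mean alpha (2 ^ m + n) F x| `^ p) + V m `^ p.
Proof.
move=> nm; set N := (2 ^ m + n)%N.
have p0 := p_gt0 alpha_gt0; have p1 := p_le1 alpha_gt0.
have b0 : 0 < b N by exact: cesaro_number_gt0.
have q0 : 0 < q :> R by rewrite powR_gt0.
have qm0 : 0 < q ^+ m by rewrite exprn_gt0.
have V0 : 0 <= V m by rewrite sumr_ge0// => j _; rewrite mulr_ge0// exprn_ge0.
have lk : level m (fun x => `|weighted_kernel a n x| `^ p).
  by apply: (level_comp (fun u => `|u| `^ p)); exact: level_weighted_kernel.
have mN : (m <= N)%N by rewrite (leq_trans (ltnW (ltn_expl m (ltnSn 1))))// leq_addr.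
rewrite -(mean_level lk mN) -meanZ.
rewrite -[V m `^ p](@mean_cst _ N) -meanD; apply: le_mean => x.
have gb0 : 0 <= gamma m / b N by apply: divr_ge0 => //; exact: ltW.
apply: (@le_trans _ _ ((gamma m / b N * `|weighted_kernel a n x|) `^ p)); last first.
  apply: le_trans (powR_subadditive p0 p1 (normr_ge0 _) V0).
  apply: ler_powR2; first exact: ltW.
    exact: mulr_ge0.
  exact: cesaro_mean_rademacher_martingale.
rewrite [leRHS]powRM// ler_wpM2r ?powR_ge0//.
have q2 : (2 * q) `^ p = 2 :> R.
  by rewrite powRM ?powR_ge0// (q_p alpha_gt0) mulrC divfK// gt_eqF// powR_gt0.
(* The factor 1/2 is (2 q)^(-p): it pays for [b N <= 2 * q ^+ m.+1], as N <= 2^(m+1). *)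
have -> : (gamma m / q ^+ m) `^ p / 2 = (gamma m / (2 * q ^+ m.+1)) `^ p.
  have -> : gamma m / (2 * q ^+ m.+1) = gamma m / q ^+ m * (2 * q)^-1.
    by rewrite exprS; field; rewrite !gt_eqF.
  rewrite [RHS]powRM ?invr_ge0 ?divr_ge0 ?mulr_ge0 ?(ltW q0) ?(ltW qm0)//.
  by rewrite (@powRV _ (2 * q)) ?mulr_ge0 ?(ltW q0)// q2.
apply: ler_powR2; first exact: ltW.
  by rewrite divr_ge0// mulr_ge0// exprn_ge0// ltW.
have Q0 : 0 < 2 * q ^+ m.+1 :> R by rewrite mulr_gt0// exprn_gt0.
rewrite ler_wpM2l// lef_pV2 ?posrE//.
apply: cesaro_number_le_pow_q => //.
by rewrite expnS mul2n -addnn leq_add2l.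
Qed.

(** Pointwise the maximal function is at most the series of the gamma_m D_(2^m), and by [q_p] the
    integral of D_(2^m)^p is q^(-mp). *)
Lemma hardy_rademacher_martingale :
  (\int[haar R]_x (maximal_function F x `^ p) <=
   \sum_(m <oo) ((gamma m / q ^+ m) `^ p)%:E)%E.
Proof.
have p0 := p_gt0 alpha_gt0; have p1 := p_le1 alpha_gt0.
have q0 : 0 < q :> R by rewrite powR_gt0.
pose g m x := (gamma m * dirichlet (2 ^ m) x) `^ p : R.
have g0 m x : 0 <= g m x by exact: powR_ge0.
have D0 m x : 0 <= gamma m * dirichlet (2 ^ m) x by rewrite mulr_ge0// dirichlet_pow2_ge0.
have lg m : level m (g m).
  apply: (level_comp (fun u => (gamma m * u) `^ p)); exact: level_dirichlet.
have mg m : measurable_fun setT (fun x => (g m x)%:E).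
  exact: (measurable_level (level_comp EFin (lg m))).
apply: (@le_trans _ _ (\int[haar R]_x (\sum_(m <oo) (g m x)%:E))%E).
  apply: ge0_le_integral => //.
  - by move=> x _; exact: poweR_ge0.
  - apply: (measurableT_comp (measurable_poweR p)).
    exact: (measurable_maximal_function rademacher_martingale_bit).
  - by apply: (ge0_emeasurable_sum (P := xpredT)) => [m x _ _|m _]; [rewrite lee_fin|].
  move=> x _; apply: ereal_sup_poweR_le => //.
    by exists (`|F 0%N x|)%:E; exists 0%N.
  move=> _ [n _ <-]; exists `|F n x|; split => //.
  apply: (@le_trans _ _ (\sum_(0 <= m < n) (g m x)%:E)%E); last first.
    by apply: nneseries_lim_ge => m _ _; rewrite lee_fin.
  rewrite sumEFin lee_fin big_mkord.
  apply: le_trans (powR_sum_le _ _ p0 p1 _) => //.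
  apply: ler_powR2 => //; first exact: ltW.
  apply: (le_trans (ler_norm_sum _ _ _)); apply: ler_sum => m _.
  by rewrite !normrM norm_rademacher mul1r !ger0_norm ?dirichlet_pow2_ge0.
rewrite integral_nneseries//; last by move=> m x _; rewrite lee_fin.
apply: lee_nneseries => m; first by move=> _ _; apply: integral_ge0 => x _; rewrite lee_fin.
move=> _; rewrite (integral_level (lg m)) lee_fin /g.
under eq_mean do rewrite powRM ?dirichlet_pow2_ge0//.
rewrite meanZ (mean_dirichlet_powR alpha_gt0).
rewrite powRM ?invr_ge0 ?exprn_ge0 ?(ltW q0)// powRV ?exprn_ge0 ?(ltW q0)//.
rewrite powR_exprn ?(ltW q0)// (q_p alpha_gt0) -exprVn invf_div.
exact: lexx.
Qed.

End cesaro.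

End rademacher_martingale.

(** * Greedy selection of the blocks *)

Section greedy.
Context {R : realType}.
Variables (q p : R) (m0 : nat) (Psi : nat -> R).
Hypothesis q_gt0 : 0 < q.
Hypothesis p_gt0 : 0 < p.
Hypothesis q_p : (2 * q) `^ p = 2.
Hypothesis Psi_unbounded : forall G M, 0 <= G -> exists2 m, (M <= m)%N & G <= Psi m.

(* The number of indices selected before [m], and the bound on the partial sums
   of order at most [2 ^ m] produced by them. *)
Fixpoint greedy_state m : nat * R :=
  if m is m'.+1 then
    let s := greedy_state m' in
    if (m0 <= m')%N && (s.1%:R + s.2 `^ p <= Psi m' / 2 ^+ s.1) then
      (s.1.+1, s.2 + q ^+ m' / (2 * q) ^+ s.1 * 2 ^+ m')
    else s
  else (0%N, 0).

(** With k earlier choices, a new one has weight 2^(-k) in p-th power. The test asks that, so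
    weighted, [Psi m] exceed by k the p-th power of the perturbation from the earlier choices. [m0]
    will be the rank from which the kernel bound holds. *)
Definition greedy m : bool :=
  (m0 <= m)%N &&
  ((greedy_state m).1%:R + (greedy_state m).2 `^ p <= Psi m / 2 ^+ (greedy_state m).1).

(** By (2 q)^p = 2, the choice of number k contributes exactly 2^(-k) to the series that bounds the
    Hardy norm. *)
Definition greedy_coef m : R :=
  if greedy m then q ^+ m / (2 * q) ^+ (greedy_state m).1 else 0.

Lemma greedy_coef_ge0 m : 0 <= greedy_coef m.
Proof.
rewrite /greedy_coef; case: ifP => // _.
by rewrite divr_ge0 ?exprn_ge0// ?mulr_ge0// ltW.
Qed.

Lemma greedy_stateS m : greedy_state m.+1 =
  if greedy m then ((greedy_state m).1.+1, (greedy_state m).2 + greedy_coef m * 2 ^+ m)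
  else greedy_state m.
Proof. by rewrite /greedy_coef /= -/(greedy m); case: ifP. Qed.

Lemma greedy_state2 m : (greedy_state m).2 = \sum_(j < m) greedy_coef j * 2 ^+ j.
Proof.
elim: m => [|m IH]; first by rewrite big_ord0.
rewrite greedy_stateS big_ord_recr/= -IH /greedy_coef.
by case: (greedy m) => //=; rewrite mul0r addr0.
Qed.

Lemma greedy_coef_powR m :
  (greedy_coef m / q ^+ m) `^ p = if greedy m then (2 ^+ (greedy_state m).1)^-1 else 0.
Proof.
rewrite /greedy_coef; case: ifP => _; last by rewrite mul0r powR0// gt_eqF.
have qm0 : q ^+ m != 0 by rewrite expf_neq0// gt_eqF.
rewrite mulrAC mulfV// mul1r powRV; last by rewrite exprn_ge0// mulr_ge0// ltW.
by rewrite powR_exprn ?q_p// mulr_ge0// ltW.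
Qed.

Lemma sum_greedy_coef_powR m :
  \sum_(j < m) (greedy_coef j / q ^+ j) `^ p = 2 - 2 * (2 ^+ (greedy_state m).1)^-1.
Proof.
elim: m => [|m IH]; first by rewrite big_ord0 expr0 invr1 mulr1 subrr.
rewrite greedy_stateS big_ord_recr/= IH greedy_coef_powR.
case: (greedy m) => /=; last by rewrite addr0.
rewrite exprS invfM mulVKf//; set z := (2 ^+ _)^-1.
by rewrite mulr_natl mulr2n opprD addrA subrK.
Qed.

Lemma greedy_state1_le m n : (m <= n)%N -> ((greedy_state m).1 <= (greedy_state n).1)%N.
Proof.
elim: n => [|n IH]; first by rewrite leqn0 => /eqP ->.
rewrite leq_eqVlt ltnS => /predU1P[->//|/IH mn]; apply: (leq_trans mn).
by rewrite greedy_stateS; case: (greedy n).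
Qed.

(** Without further choices the state would freeze, and [Psi] would have to stay below a fixed
    threshold. *)
Lemma greedy_next M : exists2 m, (M <= m)%N & greedy m.
Proof.
apply: contrapT => nex.
have nG m : (M <= m)%N -> greedy m = false.
  by move=> Mm; apply/negP => Gm; apply: nex; exists m.
have st m : (M <= m)%N -> greedy_state m = greedy_state M.
  elim: m => [|m IH]; first by rewrite leqn0 => /eqP ->.
  by rewrite leq_eqVlt ltnS => /predU1P[->//|Mm]; rewrite greedy_stateS nG// IH.
pose G := ((greedy_state M).1%:R + (greedy_state M).2 `^ p) * 2 ^+ (greedy_state M).1.
have G0 : 0 <= G by rewrite mulr_ge0 ?exprn_ge0// addr_ge0// powR_ge0.
have [m mM Gm] := Psi_unbounded (maxn M m0) G0.
move: mM; rewrite geq_max => /andP[Mm m0m].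
have := nG _ Mm; rewrite /greedy m0m st//= => /negP; apply.
by rewrite ler_pdivlMr ?exprn_gt0.
Qed.

Lemma greedy_unbounded K : exists2 m, greedy m & (K <= (greedy_state m).1)%N.
Proof.
have [M KM] : exists M, (K <= (greedy_state M).1)%N.
  elim: K => [|K [M KM]]; first by exists 0%N.
  have [m Mm Gm] := greedy_next M; exists m.+1.
  by rewrite greedy_stateS Gm/= ltnS (leq_trans KM)// greedy_state1_le.
have [m Mm Gm] := greedy_next M; exists m => //.
by rewrite (leq_trans KM)// greedy_state1_le.
Qed.

End greedy.

(** * The two halves of the theorem *)

Section main.
Context {R : realType}.
Variable alpha : R.
Hypothesis alpha_gt0 : 0 < alpha.
Hypothesis alpha_lt1 : alpha < 1.
Local Notation p := (1 / (1 + alpha)).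
Local Notation q := (2 `^ alpha).

Lemma weighted_maximal_ge0 (F : nat -> dyadic_group -> R) x :
  (0 <= weighted_maximal alpha F x)%E.
Proof.
apply: (@le_trans _ _ (`|cesaro_mean alpha 2 F x| / ln 2%:R `^ (1 + alpha))%:E).
  by rewrite lee_fin; apply: divr_ge0 => //; exact: powR_ge0.
by apply: ereal_sup_ubound; exists 2%N.
Qed.

Lemma Lnorm_weighted_maximal_le : exists c : R, forall F, in_hardy p F ->
  ('N[haar R]_p%:E[weighted_maximal alpha F] <= c%:E * hardy_norm p F)%E.
Proof.
have p0 := p_gt0 alpha_gt0.
have [C C0 CP] := integral_weighted_maximal alpha_gt0 alpha_lt1.
exists (C `^ p^-1) => F [FM _]; rewrite /hardy_norm unlock /Lnorm.
under eq_integral do rewrite gee0_abs ?weighted_maximal_ge0//.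
under [in leRHS]eq_integral do rewrite gee0_abs ?maximal_function_ge0//.
have I0 : (0 <= \int[haar R]_x (maximal_function F x `^ p))%E.
  by apply: integral_ge0 => x _; exact: poweR_ge0.
rewrite -poweR_EFin -poweRM ?lee_fin//.
apply: gt0_ler_poweR; rewrite ?invr_ge0 ?(ltW p0)//; last exact: CP.
- rewrite in_itv/= leey andbT; apply: integral_ge0 => x _; exact: poweR_ge0.
- by rewrite in_itv/= leey andbT mule_ge0// lee_fin.
Qed.

Lemma limn_esup_pinfty_ex (u : nat -> \bar R) (A : R) N : limn_esup u = +oo%E ->
  exists2 n, (N <= n)%N & (A%:E < u n)%E.
Proof.
move=> uoo.
have : (+oo <= ereal_sup (u @` [set n | (N <= n)%N]))%E.
  rewrite -uoo; apply: ereal_inf_lbound; exists [set n | (N <= n)%N] => //.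
  by exists N.
rewrite leye_eq => /eqP soo.
have : (A%:E < ereal_sup (u @` [set n | (N <= n)%N]))%E by rewrite soo ltry.
by move=> /ereal_sup_gt[_ [n Nn <-] An]; exists n.
Qed.

Section divergence.
Variable phi : nat -> R.
Hypothesis phi_ge1 : forall n, (0 < n)%N -> 1 <= phi n.
Hypothesis phi_nondec : forall m n, (0 < m)%N -> (m <= n)%N -> phi m <= phi n.
Hypothesis phi_limsup :
  limn_esup (fun n => (ln n%:R `^ (1 + alpha) / phi n)%:E) = +oo%E.

Lemma growth_unbounded (c : R) : 0 < c -> forall G M, 0 <= G -> exists2 m, (M <= m)%N &
  G <= c / 2 * (m%:R / phi (2 ^ m.+1) `^ p).
Proof.
move=> c0 G M G0; have p0 := p_gt0 alpha_gt0.
(* With 2^(m+1) <= n < 2^(m+2) one has ln n <= 2 (m + 2) <= 6 m, and [phi] at 2^(m+1) is at most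
   [phi n]. The p-th root scale then gives 12 G / c times phi^p at most 6 m, which is the claim;
   starting from 2^(M+2) ensures m >= 1. *)
pose A := (12 * G / c) `^ (1 + alpha).
have [n Mn] := limn_esup_pinfty_ex A (2 ^ M.+2) phi_limsup; rewrite lte_fin => An.
have n0 : (0 < n)%N by rewrite (leq_trans _ Mn)// expn_gt0.
have := trunc_log_bounds (erefl : (1 < 2)%N) n0.
have : (M.+2 <= trunc_log 2 n)%N by rewrite trunc_log_max.
case: (trunc_log 2 n) => // m; rewrite ltnS => Mm /andP[mn nm].
have m1 : 1 <= m%:R :> R by rewrite ler1n (leq_trans _ Mm).
exists m; first exact: ltnW.
have phi1 : 1 <= phi (2 ^ m.+1) by apply: phi_ge1; rewrite expn_gt0.
have phin : phi (2 ^ m.+1) <= phi n by apply: phi_nondec; rewrite ?expn_gt0.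
have phi0 : 0 < phi (2 ^ m.+1) by apply: lt_le_trans phi1.
have A0 : 0 <= A by exact: powR_ge0.
have ln0 : 0 <= ln n%:R :> R by rewrite ln_ge0// ler1n.
have lnn : ln n%:R <= 6 * m%:R :> R.
  apply: (@le_trans _ _ (ln ((2 ^ m.+2)%:R))).
    by rewrite ler_ln ?posrE ?ltr0n ?expn_gt0// ler_nat ltnW.
  rewrite natrX lnXn// -[leLHS]mulr_natl -[m.+2%:R]natr1 -[m.+1%:R]natr1.
  have l2 : ln 2 <= 2 :> R by rewrite ltW// ln_sublinear.
  have : (m%:R + 1 + 1) * ln 2 <= (m%:R + 1 + 1) * 2 :> R by rewrite ler_wpM2l// !addr_ge0.
  by move: m1; lra.
have h : A * phi (2 ^ m.+1) <= ln n%:R `^ (1 + alpha).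
  apply: (@le_trans _ _ (A * phi n)); first by rewrite ler_wpM2l.
  by rewrite -ler_pdivlMr ?ltW// (lt_le_trans phi0).
have h2 : 12 * G / c * phi (2 ^ m.+1) `^ p <= 6 * m%:R.
  apply: le_trans lnn; rewrite -[leRHS](powR_1Dalpha_p alpha_gt0)//.
  rewrite -[12 * G / c](powR_1Dalpha_p alpha_gt0); last first.
    by rewrite divr_ge0 ?mulr_ge0// ltW.
  rewrite -powRM ?powR_ge0 ?(ltW phi0)//; apply: ler_powR2 => //; first exact: ltW.
  by rewrite mulr_ge0// ltW.
have P0 : 0 < phi (2 ^ m.+1) `^ p by rewrite powR_gt0.
rewrite mulrA ler_pdivlMr//.
have -> : G * phi (2 ^ m.+1) `^ p = c / 12 * (12 * G / c * phi (2 ^ m.+1) `^ p).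
  by field; rewrite gt_eqF.
have -> : c / 2 * m%:R = c / 12 * (6 * m%:R) by field.
by rewrite ler_wpM2l// divr_ge0// ltW.
Qed.

Lemma divergent_martingale : exists F : nat -> dyadic_group -> R,
  in_hardy p F /\
  ereal_sup [set ('N[haar R]_p%:E[(fun x => (cesaro_mean alpha n F x / phi n)%:E)])%E
            | n in [set n | (0 < n)%N]] = +oo%E.
Proof.
have p0 := p_gt0 alpha_gt0; have p1 := p_le1 alpha_gt0.
have q0 : 0 < q :> R by rewrite powR_gt0.
have q2 : (2 * q) `^ p = 2 :> R.
  by rewrite powRM ?powR_ge0// (q_p alpha_gt0) mulrC divfK// gt_eqF// powR_gt0.
have [c c0 [m0 cP]] := kernel_lower_bound alpha_gt0 alpha_lt1.
(* The kernel bound [c * m], halved by [mean_cesaro_rademacher_martingale], over [phi] at 2^(m+1),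
   which bounds all indices 2^m + n with n <= 2^m. *)
pose Psi m : R := c / 2 * (m%:R / phi (2 ^ m.+1) `^ p).
pose gamma := greedy_coef q p m0 Psi.
have g0 m : 0 <= gamma m by exact: greedy_coef_ge0.
pose F := rademacher_martingale gamma.
have FM : bit_martingale F by exact: rademacher_martingale_bit.
exists F; split.
  split; first exact: bit_martingale_dyadic.
  rewrite /hardy_norm unlock /Lnorm.
  under eq_integral do rewrite gee0_abs ?maximal_function_ge0//.
  apply: poweR_lty; apply: (@le_lt_trans _ _ 2%:E); last exact: ltry.
  apply: (le_trans (hardy_rademacher_martingale g0 alpha_gt0)).
  apply: lime_le.
    by apply: is_cvg_nneseries => m _ _; rewrite lee_fin powR_ge0.
  apply: nearW => m; rewrite sumEFin lee_fin big_mkord.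
  rewrite (sum_greedy_coef_powR m0 Psi q0 p0 q2).
  by rewrite gerBl mulr_ge0// invr_ge0 exprn_ge0.
apply/eqyP => A A0.
have [K AK] : exists K, A <= K%:R by exists (Num.bound A); rewrite ltW// archi_boundP// ltW.
have [m Gm Km] := @greedy_unbounded R q p m0 Psi (growth_unbounded c0) K.
have /andP[m0m] := Gm; rewrite greedy_state2.
move: Km; set k := (greedy_state q p m0 Psi m).1 => Kk.
rewrite -/gamma; set V := \sum_(j < m) _ => kV.
have [n nm Pn] := cP _ m0m.
set N := (2 ^ m + n)%N.
have N0 : (0 < N)%N by rewrite /N addn_gt0 expn_gt0.
have phiN : phi N <= phi (2 ^ m.+1).
  by apply: phi_nondec => //; rewrite expnS mul2n -addnn leq_add2l.
have phi1 : 1 <= phi N by exact: phi_ge1.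
have phi0 : 0 < phi N by exact: lt_le_trans phi1.
have lN := @level_cesaro_mean R alpha N F.
pose S := mean N (fun x => `|cesaro_mean alpha N F x| `^ p).
have SV : (2 ^+ k)^-1 / 2 * (c * m%:R) <= S + V `^ p.
  apply: le_trans (mean_cesaro_rademacher_martingale g0 alpha_gt0 alpha_lt1 nm).
  rewrite (greedy_coef_powR m0 Psi q0 p0 q2) Gm -/k.
  by apply: ler_wpM2l.
pose f := phi N `^ p; pose g := phi (2 ^ m.+1) `^ p.
have f1 : 1 <= f.
  by have := ler_powR2 (ltW p0) ler01 phi1; rewrite powR1.
have fg : f <= g by rewrite ler_powR2// ltW.
have f0 : 0 < f by exact: lt_le_trans f1.
have gp : 0 < g by exact: lt_le_trans fg.
have V0 : 0 <= V `^ p by exact: powR_ge0.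
(* The surplus k of the greedy test survives once V^p is subtracted, because f >= 1 gives V^p <= V^p
   f. *)
have kS : k%:R <= S / f.
  rewrite ler_pdivlMr//.
  have h1 : (k%:R + V `^ p) * g <= (2 ^+ k)^-1 / 2 * (c * m%:R).
    rewrite -ler_pdivlMr//; apply: (le_trans kV); rewrite /Psi -/g.
    rewrite le_eqVlt; apply/orP; left; apply/eqP.
    by set z := (2 ^+ k)^-1; ring.
  have h2 : (k%:R + V `^ p) * f <= (k%:R + V `^ p) * g by rewrite ler_wpM2l// addr_ge0.
  have h3 : V `^ p <= V `^ p * f by rewrite ler_peMr.
  rewrite -(lerD2r (V `^ p)); apply: le_trans (le_trans h2 (le_trans h1 SV)).
  by rewrite mulrDl lerD2l.
have IE : (\int[haar R]_x (`|(cesaro_mean alpha N F x / phi N)%:E| `^ p) = (S / f)%:E)%E.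
  transitivity (\int[haar R]_x ((f^-1 * `|cesaro_mean alpha N F x| `^ p)%:E))%E.
    apply: eq_integral => x _; rewrite abse_EFin poweR_EFin normrM normfV (gtr0_norm phi0).
    by rewrite powRM ?invr_ge0 ?(ltW phi0)// powRV ?(ltW phi0)// mulrC.
  rewrite (integral_level (m := N)); last first.
    exact: (level_comp (fun u => f^-1 * `|u| `^ p) lN).
  by rewrite meanZ mulrC.
apply: (@le_trans _ _ ('N[haar R]_p%:E [(fun x => (cesaro_mean alpha N F x / phi N)%:E)])%E).
  rewrite unlock /Lnorm IE poweR_EFin lee_fin.
  apply: (le_trans AK); apply: (@le_trans _ _ k%:R); first by rewrite ler_nat.
  (* The norm is at least k^(1/p), and 1/p >= 1 gives k^(1/p) >= k only for k >= 1. *)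
  have [->|k1] := posnP k; first exact: powR_ge0.
  apply: (@le_trans _ _ (k%:R `^ p^-1)).
    by apply: le1r_powR; [rewrite ler1n|rewrite invf_ge1].
  by apply: ler_powR2; rewrite // invr_ge0 ltW.
by apply: ereal_sup_ubound; exists N.
Qed.

End divergence.
End main.

Theorem theorem1 (R : realType) (alpha : R) (alpha_gt0 : 0 < alpha)
    (alpha_lt1 : alpha < 1) :
  (exists c : R, forall F : nat -> dyadic_group -> R,
     in_hardy (1 / (1 + alpha)) F ->
     ('N[haar R]_(1 / (1 + alpha))%:E[weighted_maximal alpha F]
        <= c%:E * hardy_norm (1 / (1 + alpha)) F)%E) /\
  (forall phi : nat -> R,
     (forall n, (0 < n)%N -> 1 <= phi n) ->
     (forall m n, (0 < m)%N -> (m <= n)%N -> phi m <= phi n) ->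
     limn_esup (fun n => (ln n%:R `^ (1 + alpha) / phi n)%:E) = +oo%E ->
     exists F : nat -> dyadic_group -> R,
       in_hardy (1 / (1 + alpha)) F /\
       ereal_sup
         [set ('N[haar R]_(1 / (1 + alpha))%:E
                 [(fun x => (cesaro_mean alpha n F x / phi n)%:E)])%E
         | n in [set n | (0 < n)%N]] = +oo%E).
Proof.
split; first exact: Lnorm_weighted_maximal_le.
by move=> phi phi1 phin phioo; exact: (divergent_martingale alpha_gt0 alpha_lt1 phi1 phin phioo).
Qed.
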